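(* Let $\sigma$ be a complete intersection cone of dimension $n>1$. Then the number of extreme rays of $\sigma$ is at most $2n-2$, and it equals $2n-2$ if and only if $\sigma$ is a general bipyramidal cone.
   Context: For finite $A\subset\mathbb{Z}^N$ with $\mathbb{N}A\cap(-\mathbb{N}A)=\{\mathbf0\}$, the toric ideal $I_A$ is the kernel of $K[x_1,\dots,x_m]\to K[t_1^{\pm1},\dots,t_N^{\pm1}]$, $x_i\mapsto\mathbf{t}^{\mathbf{a}_i}$; it is a complete intersection if its minimal number of generators equals its height. A cone $\sigma$ is a complete intersection cone if $\sigma=\mathrm{pos}_{\mathbb{Q}}(A)$ (nonnegative rational combinations) for such an $A$ with $I_A$ a complete intersection. The dimension of a cone is the dimension of its rational linear span. Extreme rays are the one-dimensional faces, where a face of $\sigma$ is $\sigma\cap\{\mathbf{x}:\mathbf{c}\cdot\mathbf{x}=0\}$ with $\mathbf{c}\cdot\mathbf{x}\ge0$ on $\sigma$. For strongly convex rational polyhedral cones $\sigma_1,\sigma_2$ with some $\mathbf{a}\in\sigma_1\cap\sigma_2$ such that $\mathrm{span}_{\mathbb{Q}}(\sigma_1)\cap\mathrm{span}_{\mathbb{Q}}(\sigma_2)=\mathbb{Q}\mathbf{a}$, the direct sum $\sigma_1\oplus\sigma_2=\mathrm{pos}_{\mathbb{Q}}(\sigma_1\cup\sigma_2)$ is of internal type if $\mathbf{a}$ lies on no extreme ray of $\sigma_1$ nor of $\sigma_2$. A 2-simplex cone is $\mathrm{pos}_{\mathbb{Q}}(\mathbf{r}_1,\mathbf{r}_2)$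 with $\mathbf{r}_1,\mathbf{r}_2$ linearly independent. General bipyramidal cones are the elements of the smallest class of cones containing all 2-simplex cones and closed under direct sums of internal type. *)

(* Defs.v *)
From HB Require Import structures.
From mathcomp Require Import all_boot all_order all_algebra.
From mathcomp Require Import mpoly.
Set Implicit Arguments. Unset Strict Implicit. Unset Printing Implicit Defensive.
Import Order.TTheory GRing.Theory Num.Theory.
Local Open Scope ring_scope.

Section Ideals.
Variables (K : fieldType) (m : nat).
Notation P := {mpoly K[m]}.

Definition is_ideal (I : P -> Prop) : Prop :=
  [/\ I 0, (forall f g, I f -> I g -> I (f + g)) & (forall r f, I f -> I (r * f))].

Definition is_prime_ideal (I : P -> Prop) : Prop :=
  [/\ is_ideal I, ~ I 1 & (forall f g, I (f * g) -> I f \/ I g)].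

Definition prime_chain_to (Pr : P -> Prop) (k : nat) : Prop :=
  exists Q : nat -> P -> Prop,
    [/\ (forall i, (i <= k)%N -> is_prime_ideal (Q i)),
        (forall i, (i < k)%N -> (forall f, Q i f -> Q i.+1 f) /\ exists f, Q i.+1 f /\ ~ Q i f)
      & (forall f, Q k f <-> Pr f)].

(* height(I) = min over primes Pr containing I of height(Pr),
   height(Pr) = sup of lengths of chains of primes ending at Pr. *)
Definition ideal_height (I : P -> Prop) (h : nat) : Prop :=
  (forall Pr, is_prime_ideal Pr -> (forall f, I f -> Pr f) -> prime_chain_to Pr h) /\
  (exists Pr, [/\ is_prime_ideal Pr, (forall f, I f -> Pr f) &
                  forall k, prime_chain_to Pr k -> (k <= h)%N]).

Definition generated_by (k : nat) (g : 'I_k -> P) (I : P -> Prop) : Prop :=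
  forall f, I f <-> exists r : 'I_k -> P, f = \sum_(j < k) r j * g j.

Definition min_num_generators (I : P -> Prop) (mu : nat) : Prop :=
  (exists g : 'I_mu -> P, generated_by g I) /\
  (forall k (g : 'I_k -> P), generated_by g I -> (mu <= k)%N).

Definition complete_intersection (I : P -> Prop) : Prop :=
  exists h, ideal_height I h /\ min_num_generators I h.
End Ideals.

(* Toric ideals. A = {a_1,...,a_m} subset Z^N is given by the matrix    *)
(* A : 'M[int]_(m, N) whose i-th row is a_i (rows pairwise distinct).   *)
(* The map x_i |-> t^{a_i} sends the monomial x^u to t^{u A}; its       *)
(* kernel consists of the f whose image in the Laurent polynomial ring  *)
(* K[Z^N] (coefficient at each exponent b in Z^N) vanishes.             *)
Definition Adeg (m N : nat) (A : 'M[int]_(m, N)) (u : 'X_{1..m}) : 'rV[int]_N :=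
  \row_j \sum_(i < m) (u i)%:Z * A i j.

Definition toric_ideal (K : fieldType) (m N : nat) (A : 'M[int]_(m, N))
  (f : {mpoly K[m]}) : Prop :=
  forall b : 'rV[int]_N, \sum_(u <- msupp f | Adeg A u == b) f@_u = 0.

Definition pointed_semigroup (m N : nat) (A : 'M[int]_(m, N)) : Prop :=
  forall u v : 'rV[int]_m, (forall i, 0 <= u 0 i) -> (forall i, 0 <= v 0 i) ->
    u *m A = - (v *m A) -> u *m A = 0.

Definition vset (N : nat) := 'rV[rat]_N -> Prop.

Definition dotQ (N : nat) (c x : 'rV[rat]_N) : rat := \sum_(j < N) c 0 j * x 0 j.

Definition posQ (N : nat) (S : vset N) : vset N := fun x =>
  exists k (v : 'I_k -> 'rV[rat]_N) (c : 'I_k -> rat),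
    [/\ forall i, S (v i), forall i, 0 <= c i & x = \sum_(i < k) c i *: v i].

Definition spanQ (N : nat) (S : vset N) : vset N := fun x =>
  exists k (v : 'I_k -> 'rV[rat]_N) (c : 'I_k -> rat),
    (forall i, S (v i)) /\ x = \sum_(i < k) c i *: v i.

(* dimension of a set = dimension of its rational linear span *)
Definition set_dim (N : nat) (S : vset N) (n : nat) : Prop :=
  (exists M : 'M[rat]_(n, N), (forall i, S (row i M)) /\ \rank M = n) /\
  (forall k (M : 'M[rat]_(k, N)), (forall i, S (row i M)) -> (\rank M <= n)%N).

Definition CI_cone (K : fieldType) (N : nat) (sigma : vset N) : Prop :=
  exists m (A : 'M[int]_(m, N)),
    [/\ injective (fun i : 'I_m => row i A),
        pointed_semigroup A,
        complete_intersection (@toric_ideal K m N A)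
      & forall x, sigma x <-> posQ (fun y => exists i, y = row i (map_mx intr A)) x].

Definition supporting (N : nat) (sigma : vset N) (c : 'rV[rat]_N) : Prop :=
  forall x, sigma x -> 0 <= dotQ c x.

Definition face (N : nat) (sigma : vset N) (c : 'rV[rat]_N) : vset N :=
  fun x => sigma x /\ dotQ c x = 0.

Definition extreme_ray_normal (N : nat) (sigma : vset N) (c : 'rV[rat]_N) : Prop :=
  supporting sigma c /\ set_dim (face sigma c) 1.

Definition num_extreme_rays (N : nat) (sigma : vset N) (k : nat) : Prop :=
  exists c : 'I_k -> 'rV[rat]_N,
    [/\ forall i, extreme_ray_normal sigma (c i),
        forall i j, i != j -> ~ (forall x, face sigma (c i) x <-> face sigma (c j) x)
      & forall d, extreme_ray_normal sigma d ->
          exists i, forall x, face sigma d x <-> face sigma (c i) x].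

Definition on_extreme_ray (N : nat) (sigma : vset N) (a : 'rV[rat]_N) : Prop :=
  exists c, extreme_ray_normal sigma c /\ face sigma c a.

Definition rational_polyhedral (N : nat) (sigma : vset N) : Prop :=
  exists k (v : 'I_k -> 'rV[rat]_N),
    forall x, sigma x <-> posQ (fun y => exists i, y = v i) x.

Definition strongly_convex (N : nat) (sigma : vset N) : Prop :=
  forall x, sigma x -> sigma (- x) -> x = 0.

Definition scrp_cone (N : nat) (sigma : vset N) : Prop :=
  rational_polyhedral sigma /\ strongly_convex sigma.

Definition internal_direct_sum (N : nat) (sigma1 sigma2 sigma : vset N) : Prop :=
  [/\ scrp_cone sigma1, scrp_cone sigma2,
      exists a, [/\ sigma1 a, sigma2 a,
                    (forall x, (spanQ sigma1 x /\ spanQ sigma2 x) <-> exists q : rat, x = q *: a),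
                    ~ on_extreme_ray sigma1 a & ~ on_extreme_ray sigma2 a]
    & forall x, sigma x <-> posQ (fun y => sigma1 y \/ sigma2 y) x].

Definition lin_indep2 (N : nat) (r1 r2 : 'rV[rat]_N) : Prop :=
  forall c1 c2 : rat, c1 *: r1 + c2 *: r2 = 0 -> c1 = 0 /\ c2 = 0.

Inductive bipyramidal (N : nat) : vset N -> Prop :=
| bipyr_simplex (r1 r2 : 'rV[rat]_N) (sigma : vset N) :
    lin_indep2 r1 r2 ->
    (forall x, sigma x <-> posQ (fun y => y = r1 \/ y = r2) x) ->
    bipyramidal sigma
| bipyr_sum (sigma1 sigma2 sigma : vset N) :
    bipyramidal sigma1 -> bipyramidal sigma2 ->
    internal_direct_sum sigma1 sigma2 sigma -> bipyramidal sigma.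

(* Main.v *)
(* Let [A] have [m] rows and rank [n].  A chain of [h] primes ending at the toric
   ideal [I] yields, by a count of independent polynomials of bounded degree,
   [h + n <= m]; and a graded Nakayama argument extracts from [h] generators of
   [I] at most [h] binomials [x^u - x^v] whose moves connect every fiber of the
   degree map.  So [I] is generated by at most [m - n] moves.

   If [t] of these moves met a [t]-element set [T] of variables on both sides,
   then enlarging [T] until every other move avoids it, the variables outside
   [T] would still span the space of degrees with too few relations.  Hence the
   edge colouring in which a move with sides [u], [v] colours the complete
   bipartite graph between their supports has no cycle with pairwise distinct
   colours.  Such a colouring has a cut crossed by a single colour, one side of
   it on each side of the cut.  Geometrically the cone splits as a sum of two
   smaller cones of the same kind whose spans meet in the line through the
   degree [a] of the crossing move.

   Dimensions add up to [n + 1] and a ray of the sum is a ray of a summand, which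
   gives [2n - 2] by induction; a ray is lost exactly when [a] lies on an
   extreme ray of a summand.  Conversely, in a direct sum of internal type no ray
   is lost, because a supporting functional of one summand that is positive at
   [a] extends by a strictly positive functional on the other. *)

(* The variables of degree 0, which pointedness allows, obstruct the Nakayama step: the grading is
   not positive on them. So the localisation is at the point where they take the value 1, and the
   binomials [x_j - 1] are put into the family first. They use up as many of the [h] generators as
   there are such variables, and the remaining moves satisfy the same bound with [m] replaced by the
   number of variables of nonzero degree. From there on everything is linear algebra over the
   rationals and [K] disappears. The induction runs on [config] rather than on complete
   intersections: nonnegative moves that span the relations and whose colouring has no rainbow
   cycle. The spans of the two summands meet in a line because every relation is a combination of
   moves and only one move joins the two sides: up to relations within the sides, a relation across
   the cut is a multiple of that move. *)
Require Import Defs.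
From HB Require Import structures.
From mathcomp Require Import all_boot all_order all_algebra zify ring lra.
From mathcomp Require Import ssrcomplements mpoly.
From Stdlib Require Import Classical FunctionalExtensionality PropExtensionality.
Set Implicit Arguments. Unset Strict Implicit. Unset Printing Implicit Defensive.
Import Order.TTheory GRing.Theory Num.Theory.
Local Open Scope ring_scope.

(** * Cuts of bipartite colourings *)

Section Cuts.
Variable V : finType.
Implicit Types (C X Y T P Q : {set V}) (c : {set V} * {set V})
  (s : seq ({set V} * {set V})).

(* A color is a complete bipartite graph, given by its two sides.  Choosing one
   edge per color always gives a forest iff no [T] contains [#|T|] or more colors
   restricting to a nonempty graph on [T]; this is [valid]. *)
Definition meets T P := T :&: P != set0.
Definition mixed T c := meets T c.1 && meets T c.2.
Definition inside X c := (c.1 \subset X) && (c.2 \subset X).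
Definition valid C s := forall T, T \subset C -> T != set0 ->
  (count (mixed T) s < #|T|)%N.
Definition colors_of C c := [&& inside C c, c.1 != set0 & c.2 != set0].
Definition crosses C X c := ~~ inside X c && ~~ inside (C :\: X) c.
Definition splits C X c :=
  (c.1 \subset X) && (c.2 \subset C :\: X) ||
  (c.2 \subset X) && (c.1 \subset C :\: X).
Definition good_cut C X s := [/\ X \subset C, count (crosses C X) s = 1%N &
  all (fun c => crosses C X c ==> splits C X c) s].
(* The complete bipartite graph between [P] and [Q] may be added as a new color. *)
Definition unlinked C s P Q := [forall T : {set V},
  [&& T \subset C, meets T P & meets T Q] ==> ((count (mixed T) s).+1 < #|T|)%N].

Lemma meets_memP T P : reflect (exists2 x, x \in T & x \in P) (meets T P).
Proof.
apply: (iffP (set0Pn _)) => [[x]|[x xT xP]].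
  by rewrite inE => /andP[xT xP]; exists x.
by exists x; rewrite inE xT.
Qed.

Lemma meets_neq0 T P : meets T P -> T != set0.
Proof. by case/meets_memP => x xT _; apply/set0Pn; exists x. Qed.

Lemma meetsS T T' P P' : T \subset T' -> P \subset P' -> meets T P -> meets T' P'.
Proof.
move=> /subsetP sT /subsetP sP /meets_memP[x xT xP].
by apply/meets_memP; exists x; [apply: sT | apply: sP].
Qed.

Lemma meetsU T P Q : meets T (P :|: Q) = meets T P || meets T Q.
Proof. by rewrite /meets setIUr setU_eq0 negb_and. Qed.

Lemma mixedS T T' c : T \subset T' -> mixed T c -> mixed T' c.
Proof.
by move=> sT /andP[h1 h2]; apply/andP; split; [move: h1|move: h2]; apply: meetsS.
Qed.

Definition swap c := (c.2, c.1).

Lemma mixed_swap T c : mixed T (swap c) = mixed T c.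
Proof. by rewrite /mixed /= andbC. Qed.

Lemma inside_swap T c : inside T (swap c) = inside T c.
Proof. by rewrite /inside /= andbC. Qed.

Lemma valid_perm C s s' : perm_eq s s' -> valid C s -> valid C s'.
Proof. by move=> /permP e h T sT T0; rewrite -e; apply: h. Qed.

Lemma good_cut_perm C X s s' : perm_eq s s' -> good_cut C X s -> good_cut C X s'.
Proof.
move=> e [h1 h2 h3]; split=> //; first by rewrite -(permP e).
by rewrite -(perm_all _ e).
Qed.

Lemma insideS X Y c : X \subset Y -> inside X c -> inside Y c.
Proof. by move=> s /andP[h1 h2]; rewrite /inside !(subset_trans _ s). Qed.

Lemma crossesC C X c : X \subset C -> crosses C (C :\: X) c = crosses C X c.
Proof.
by move=> sX; rewrite /crosses setDDr setDv set0U (setIidPr sX) andbC.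
Qed.

Lemma splitsC C X c : X \subset C -> splits C (C :\: X) c = splits C X c.
Proof.
move=> sX; rewrite /splits setDDr setDv set0U (setIidPr sX) orbC.
by rewrite [X in X || _]andbC [X in _ || X]andbC.
Qed.

Lemma good_cutC C X s : good_cut C X s -> good_cut C (C :\: X) s.
Proof.
case=> sX h1 h2; split; first exact: subsetDl.
  by rewrite (eq_count (a2 := crosses C X)) // => c; apply: crossesC.
by rewrite (eq_all (a2 := fun c => crosses C X c ==> splits C X c)) // => c; rewrite crossesC // splitsC.
Qed.

Lemma good_cut_swap C X c s : good_cut C X (swap c :: s) -> good_cut C X (c :: s).
Proof.
have e Y : inside Y (swap c) = inside Y c by apply: inside_swap.
have e1 : crosses C X (swap c) = crosses C X c by rewrite /crosses !e.
have e2 : splits C X (swap c) = splits C X c by rewrite /splits /= orbC.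
by case=> h1 /= h2 h3; split => //=; rewrite -e1 -?e2.
Qed.

Lemma valid_swap C c s : valid C (c :: s) -> valid C (swap c :: s).
Proof. by move=> h T sT T0 /=; rewrite mixed_swap; apply: h. Qed.

Lemma colors_of_swap C c : colors_of C (swap c) = colors_of C c.
Proof. by rewrite /colors_of inside_swap /= [X in _ && X]andbC. Qed.

Lemma colorsS C C' c : inside C' c -> colors_of C c -> colors_of C' c.
Proof. by move=> i /and3P[_ h1 h2]; apply/and3P. Qed.

Lemma valid_sub C C' s s' : C' \subset C ->
  (forall T, T \subset C' -> count (mixed T) s' <= count (mixed T) s)%N ->
  valid C s -> valid C' s'.
Proof.
move=> sC le h T sT T0; apply: leq_ltn_trans (le _ sT) _.
by apply: h => //; apply: subset_trans sC.
Qed.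

Lemma crosses_inside C X c : inside X c -> crosses C X c = false.
Proof. by rewrite /crosses => ->. Qed.

Lemma crosses_insideD C X c : inside (C :\: X) c -> crosses C X c = false.
Proof. by rewrite /crosses => ->; rewrite andbF. Qed.

Lemma count_crosses0 C X s :
  all (fun c => inside X c || inside (C :\: X) c) s -> count (crosses C X) s = 0%N.
Proof.
move=> h; apply/eqP; rewrite -leqn0 leqNgt -has_count; apply/hasPn => c cs.
by case/orP: (allP h _ cs) => i; rewrite ?(crosses_inside _ i) ?(crosses_insideD i).
Qed.

Lemma all_ncross C X s : count (crosses C X) s = 0%N ->
  all (fun c => inside X c || inside (C :\: X) c) s.
Proof.
move=> h; apply/allP => c cs; apply/negPn; rewrite negb_or -/(crosses C X c).
have : ~~ has (crosses C X) s by rewrite has_count h.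
by move/hasPn => /(_ _ cs).
Qed.

Lemma crosses_splits C X c : colors_of C c -> splits C X c -> crosses C X c.
Proof.
move=> cc h; rewrite /crosses; apply/andP; split; apply/negP => /andP[i1 i2].
  case/orP: h => /andP[j1 j2]; case/and3P: cc => _ /set0Pn[x x1] /set0Pn[y y2].
    by move: (subsetP j2 _ y2); rewrite inE (subsetP i2).
  by move: (subsetP j2 _ x1); rewrite inE (subsetP i1).
case/orP: h => /andP[j1 j2]; case/and3P: cc => _ /set0Pn[x x1] /set0Pn[y y2].
  by move: (subsetP i1 _ x1); rewrite inE (subsetP j1).
by move: (subsetP i2 _ y2); rewrite inE (subsetP j1).
Qed.

Lemma good_cut1 C X c s : colors_of C c -> X \subset C -> splits C X c ->
  all (fun c => inside X c || inside (C :\: X) c) s -> good_cut C X (c :: s).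
Proof.
move=> cc sX sp al; split => //=.
  by rewrite count_crosses0 // addn0 crosses_splits.
rewrite sp implybT /=; apply/allP => d ds.
by case/orP: (allP al _ ds) => i; rewrite ?(crosses_inside _ i) ?(crosses_insideD i).
Qed.

(* A good cut of [Y] seen only by colors living inside [Y] is a good cut of [C]
   once every other color touches [Y] on one side of the cut only. *)
Lemma good_cut_peel C Y X sY s' : Y \subset C -> good_cut Y X sY ->
  all (inside Y) sY -> all (inside C) s' ->
  all (fun c => [disjoint (c.1 :|: c.2) & Y :\: X]) s' ->
  good_cut C (Y :\: X) (sY ++ s').
Proof.
move=> sYC [sXY ct sp] iY iC dj.
have al : all (fun c => inside (Y :\: X) c || inside (C :\: (Y :\: X)) c) s'.
  apply/allP => c cs; apply/orP; right.
  move: (allP iC _ cs) (allP dj _ cs) => /andP[/subsetP i1 /subsetP i2].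
  rewrite disjoint_sym => /disjointFl d.
  apply/andP; split; apply/subsetP => x xc; rewrite in_setD d ?inE ?xc ?orbT //=.
    exact: i1.
  exact: i2.
have eC c : c \in sY -> inside (C :\: (Y :\: X)) c = inside X c.
  move=> cs; case/andP: (allP iY _ cs) => /subsetP i1 /subsetP i2.
  have e P : {subset P <= Y} -> (P \subset C :\: (Y :\: X)) = (P \subset X).
    move=> sP; apply/subsetP/subsetP => h x xP.
      by move: (h _ xP); rewrite !inE (sP _ xP) andbT negbK => /andP[].
    by rewrite !inE (h _ xP) /= (subsetP sYC) // sP.
  by rewrite /inside !e.
have eX c : c \in sY -> crosses C (Y :\: X) c = crosses Y X c.
  by move=> cs; rewrite /crosses eC // andbC.
split.
- exact: subset_trans (subsetDl _ _) sYC.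
- by rewrite count_cat (eq_in_count eX) ct count_crosses0.
- rewrite all_cat; apply/andP; split; last first.
    apply/allP => d ds; case/orP: (allP al _ ds) => i.
      by rewrite ?(crosses_inside _ i).
    by rewrite (crosses_insideD i).
  apply/allP => c cs; rewrite eX //; apply/implyP => cr.
  move: (allP sp _ cs); rewrite cr /=; case/andP: (allP iY _ cs) => /subsetP i1 /subsetP i2.
  have e P : P \subset X -> P \subset C :\: (Y :\: X).
    move=> sP; apply/subsetP => x xP; rewrite !inE (subsetP sP) //=.
    by rewrite (subsetP sYC) // (subsetP sXY) // (subsetP sP).
  by case/orP => /andP[/e j1 j2]; rewrite /splits j1 j2 ?orbT.
Qed.

(** * Inductive step for cuts: separating, deleting and peeling *)

Section Step.
Variables (C : {set V}) (s : seq ({set V} * {set V})).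
(** The induction hypothesis of [good_cut_exists], assumed so that the cases of its step can be
    separate lemmas. *)
Hypothesis IH : forall C' s', (#|C'| + size s' < #|C| + size s)%N ->
  all (colors_of C') s' -> valid C' s' -> s' != [::] -> exists X, good_cut C' X s'.
Hypothesis (sC : all (colors_of C) s) (sV : valid C s).

(** The pair [(P, Q)] is added as a color and the induction hypothesis cuts the result. Either this
    color is the one that crosses, and then no color of [s'] does, or [P] and [Q] stay together and
    a color of [s'] crosses. *)
Lemma separate C' s' P Q : (#|C'| + (size s').+1 < #|C| + size s)%N ->
  all (colors_of C') s' -> valid C' s' -> P \subset C' -> Q \subset C' ->
  P != set0 -> Q != set0 -> unlinked C' s' P Q ->
  exists X, [/\ X \subset C', P \subset X &
    (good_cut C' X s' /\ Q \subset X) \/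
    (all (fun c => inside X c || inside (C' :\: X) c) s' /\ Q \subset C' :\: X)].
Proof.
move=> lt al va sP sQ P0 Q0 ul.
have cPQ : colors_of C' (P, Q) by apply/and3P; split => //; apply/andP.
have [||||X gX] := IH (C' := C') (s' := (P, Q) :: s'); rewrite //= ?cPQ //.
  move=> T sT T0 /=; case: (boolP (mixed T (P, Q))) => [/andP[m1 m2]|_]; last exact: va.
  by move/forallP: ul => /(_ T); rewrite sT m1 m2.
have [X' [gX' XP]] : exists X', good_cut C' X' ((P, Q) :: s') /\ P \subset X'.
  case: (boolP (P \subset X)) => PX; first by exists X.
  exists (C' :\: X); split; first exact: good_cutC.
  case: gX => _ _ /= /andP[+ _]; rewrite /crosses /inside /= (negPf PX) /=.
  case: (boolP (P \subset C' :\: X)) => //= NP.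
  by rewrite /splits /= (negPf PX) (negPf NP) andbF.
case: gX' => sX' ct sp; exists X'; split=> //.
case: (boolP (Q \subset X')) => QX; [left|right].
  split=> //; split=> //; last by case/andP: sp.
  by move: ct; rewrite /= crosses_inside ?add0n // /inside /= XP.
have cr : crosses C' X' (P, Q).
  rewrite /crosses /inside /= (negPf QX) andbF /=; apply/nandP; left.
  apply/negP => sP'; case/set0Pn: P0 => x xP.
  by move: (subsetP sP' _ xP); rewrite inE (subsetP XP).
move: ct sp => /=; rewrite cr /= add1n => -[ct] /andP[sp _].
split; first exact: all_ncross.
by move: sp; rewrite /splits /= (negPf QX) /= orbF => /andP[].
Qed.

(* If only [c1] leaves [X], and does so along one of its two sides, then [X] can
   be deleted: it may be put back on the side of what remains of [c1.1]. *)
Lemma good_cut_delete c1 s' X : perm_eq s (c1 :: s') -> X \subset C ->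
  all (fun c => inside X c || inside (C :\: X) c) s' ->
  meets X c1.1 -> ~~ meets X c1.2 -> exists X, good_cut C X s.
Proof.
move=> pe sX al m1 m2.
have cc1 : colors_of C c1 by apply: (allP sC); rewrite (perm_mem pe) mem_head.
case/and3P: (cc1) => /andP[i1 i2] n1 n2.
have d2 : c1.2 \subset C :\: X.
  apply/subsetP => x x2; rewrite inE (subsetP i2) // andbT; apply/negP => xX.
  by case/meets_memP: m2; exists x.
(* If the whole side [c1.1] lies in [X], then [X] is itself a good cut, crossed by [c1]. *)
case: (boolP (c1.1 \subset X)) => h1.
  exists X; apply: (good_cut_perm (s := c1 :: s')); first by rewrite perm_sym.
  by apply: good_cut1 => //; rewrite /splits h1 d2.
pose C' := C :\: X; pose s'' := filter (inside C') s'.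
pose c' := (c1.1 :\: X, c1.2).
have X0 := meets_neq0 m1.
have sz : (size s = (size s').+1)%N by rewrite (perm_size pe).
have ltC : (#|C'| < #|C|)%N.
  apply: proper_card; rewrite properE subsetDl; apply/subsetPn.
  by case/set0Pn: X0 => x xX; exists x; rewrite ?inE ?xX // (subsetP sX).
have c'C : colors_of C' c'.
  apply/and3P; split => //=; last by rewrite setD_eq0.
  by apply/andP; split => //=; apply: setSD.
have [||||X' g'] := IH (C' := C') (s' := c' :: s'') => //.
- rewrite /= sz; have : (size s'' <= size s')%N by rewrite size_filter count_size.
  by move: ltC; clear; lia.
- rewrite /= c'C /=; apply/allP => c; rewrite mem_filter => /andP[ic cs].
  apply: (colorsS ic); apply: (allP sC); first by rewrite (perm_mem pe) inE cs orbT.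
- apply: valid_sub (subsetDl _ _) _ (valid_perm pe sV) => T sT /=.
  apply: leq_add; last first.
    rewrite count_filter; apply: sub_count => c /=; by case/andP.
  case: (boolP (mixed T c')) => // /andP[k1 k2].
  by rewrite /mixed k2 (meetsS _ _ k1) //= subsetDl.
have [X'' [g'' h'']] : exists X'', good_cut C' X'' (c' :: s'') /\ c'.1 \subset X''.
  case: (boolP (c'.1 \subset X')) => PX; first by exists X'.
  exists (C' :\: X'); split; first exact: good_cutC.
  case: g' => _ _ /= /andP[+ _]; rewrite /crosses /inside (negPf PX) /=.
  case: (boolP (c'.1 \subset C' :\: X')) => //= NP.
  by rewrite /splits (negPf PX) (negPf NP) andbF.
(* [X''] contains what is left of [c1.1], so adding [X] brings all of [c1.1] to one side, and [c1]
   crosses exactly when [c'] does. *)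
exists (X :|: X''); apply: (good_cut_perm (s := c1 :: s')); first by rewrite perm_sym.
case: g'' => sX'' ct sp.
have dXX P : P \subset C' -> (P \subset X :|: X'') = (P \subset X'').
  move=> sP; apply/subsetP/subsetP => h x xP.
    move: (h _ xP); rewrite inE => /orP[xX|//].
    by move: (subsetP sP _ xP); rewrite inE xX.
  by rewrite inE h // orbT.
have e1 : c1.1 \subset X :|: X''.
  apply/subsetP => x x1; rewrite inE; case: (boolP (x \in X)) => //= nx.
  by apply: (subsetP h''); rewrite /= inE nx.
have e3 P : P \subset C' -> (P \subset C :\: (X :|: X'')) = (P \subset C' :\: X'').
  by move=> sP; rewrite setDDl.
have eI c : inside C' c -> crosses C (X :|: X'') c = crosses C' X'' c.
  by case/andP => k1 k2; rewrite /crosses /inside !dXX // !e3.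
have ec1 : crosses C (X :|: X'') c1 = crosses C' X'' c'.
  rewrite /crosses /inside e1 h'' /= (dXX _ d2) (e3 _ d2).
  congr (_ && ~~ _).
  have -> : (c1.1 \subset C :\: (X :|: X'')) = false.
    apply/negP => k; case/set0Pn: n1 => x x1.
    by move: (subsetP k _ x1); rewrite inE (subsetP e1).
  symmetry; apply/negP => /andP[k _]; move: h1; rewrite -setD_eq0 => /set0Pn[x xc].
  by move: (subsetP k _ xc); rewrite inE (subsetP h'').
have cs' : count (crosses C (X :|: X'')) s' = count (crosses C' X'') s''.
  rewrite count_filter; apply: eq_in_count => c cs /=.
  case: (boolP (inside C' c)) => i; first by rewrite andbT eI.
  rewrite andbF; case/orP: (allP al _ cs) => j; last by rewrite j in i.
  by apply: crosses_inside; apply: insideS j; apply: subsetUl.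
split.
- rewrite subUset sX /=; apply: subset_trans sX'' (subsetDl _ _).
- by rewrite /= ec1 cs'.
- move: sp => /= /andP[sp1 sp2]; apply/andP; split.
    rewrite ec1; apply/implyP => k; move: sp1; rewrite k /= => sp1.
    rewrite /splits e1 /= (e3 _ d2); case/orP: sp1; first by case/andP => _ /= ->.
    case/andP => _ /= k'; move: h1; rewrite -setD_eq0 => /set0Pn[x xc].
    by move: (subsetP k' _ xc); rewrite inE (subsetP h'').
  apply/allP => c cs; case: (boolP (inside C' c)) => i; last first.
    case/orP: (allP al _ cs) => j; last by rewrite j in i.
    by rewrite crosses_inside //; apply: insideS j; apply: subsetUl.
  rewrite eI //; move: (allP sp2 c); rewrite mem_filter i cs => /(_ isT).
  by rewrite /splits; case/andP: i => k1 k2; rewrite !dXX // !e3.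
Qed.

End Step.

Section Step2.
Variables (C : {set V}) (s : seq ({set V} * {set V})).
Hypothesis IH : forall C' s', (#|C'| + size s' < #|C| + size s)%N ->
  all (colors_of C') s' -> valid C' s' -> s' != [::] -> exists X, good_cut C' X s'.
Hypothesis (sC : all (colors_of C) s) (sV : valid C s).

Lemma good_cut_delete_swap c1 s' X : perm_eq s (c1 :: s') -> X \subset C ->
  all (fun c => inside X c || inside (C :\: X) c) s' ->
  ~~ meets X c1.1 -> meets X c1.2 -> exists X, good_cut C X s.
Proof.
move=> pe sX al m1 m2.
have [|||Y g] := @good_cut_delete C (swap c1 :: s') _ _ _ (swap c1) s' X (perm_refl _) sX al m2 m1.
- by move=> C' s1; rewrite /= -[(size s').+1]/(size (c1 :: s')) -(perm_size pe); apply: IH.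
- by move: sC; rewrite (perm_all _ pe) /= colors_of_swap.
- exact: valid_swap (valid_perm pe sV).
exists Y; apply: (good_cut_perm (s := c1 :: s')); first by rewrite perm_sym.
exact: good_cut_swap.
Qed.

Section Cases.
(** The situation after [C] has been cut along a second color: [C1] is one side, [s1] the colors
    living there, and [o] the others, which reach [C1] only within [Z], the end of the cutting
    color. [c1] is the color still to be placed, with traces [P1] and [Q1] on [C1]. *)
Variables (C1 Z : {set V}) (c1 : {set V} * {set V}) (s1 o : seq ({set V} * {set V})).
Hypotheses (sC1 : C1 \proper C) (pe : perm_eq s (c1 :: s1 ++ o)) (o0 : o != [::]).
Hypotheses (is1 : all (inside C1) s1) (sZ : Z \subset C1) (Z0 : Z != set0).
Hypothesis oZ : all (fun c => (c.1 :|: c.2) :&: C1 \subset Z) o.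

Let P1 := c1.1 :&: C1.
Let Q1 := c1.2 :&: C1.

Let measureC1 X (sX : seq ({set V} * {set V})) : X \subset C1 -> (size sX <= size s1)%N ->
  (#|X| + (size sX).+1 < #|C| + size s)%N.
Proof.
move=> /subset_leq_card; move: (proper_card sC1); rewrite (perm_size pe) /= size_cat.
by case: (o) o0 => //= a l _; clear; lia.
Qed.

Let ins1 c : c \in s1 -> c \in s.
Proof. by move=> cs; rewrite (perm_mem pe) !inE mem_cat cs orbT. Qed.

Let colors1 c : c \in s1 -> colors_of C1 c.
Proof. by move=> cs; apply: colorsS (allP is1 _ cs) (allP sC _ (ins1 cs)). Qed.

Let valid1 : valid C1 s1.
Proof.
apply: valid_sub (proper_sub sC1) _ (valid_perm pe sV) => T _ /=.
by rewrite count_cat addnCA leq_addr.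
Qed.

(** The color [c1] is not counted in [sX], so it supplies the extra 1: on a set met by both of its
    traces, validity of [s] counts [c1] as well. *)
Lemma unlinked_own X sX : X \subset C1 -> subseq sX s1 -> unlinked X sX P1 Q1.
Proof.
move=> sXC ss; apply/forallP => T; apply/implyP => /and3P[sT m1 m2].
apply: leq_trans (_ : (count (mixed T) s < _)%N); last first.
  apply: sV; last exact: meets_neq0 m1.
  by apply: subset_trans sT (subset_trans sXC (proper_sub sC1)).
rewrite (permP pe) /= count_cat.
have -> : mixed T c1 by rewrite /mixed (meetsS _ _ m1) ?(meetsS _ _ m2) ?subsetIl.
by have := leq_count_subseq (mixed T) ss; rewrite /=; clear; lia.
Qed.

Lemma outer_inside X : X \subset C1 -> Z \subset C1 :\: X ->
  all (fun c => inside X c || inside (C1 :\: X) c) s1 ->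
  all (fun c => inside X c || inside (C :\: X) c) (s1 ++ o).
Proof.
move=> sX dZ al; rewrite all_cat; apply/andP; split; apply/allP => c cs.
  case/orP: (allP al _ cs) => [->//|p]; apply/orP; right.
  by apply: insideS p; apply: setSD; apply: proper_sub.
have : colors_of C c.
  by apply: (allP sC); rewrite (perm_mem pe) inE mem_cat cs !orbT.
case/and3P => /andP[i1 i2] _ _; apply/orP; right.
have h x : x \in c.1 :|: c.2 -> x \notin X.
  move=> xc; apply/negP => xX.
  have : x \in Z by apply: (subsetP (allP oZ _ cs)); rewrite inE xc (subsetP sX).
  by move/(subsetP dZ); rewrite inE xX.
by apply/andP; split; apply/subsetP => x xc; rewrite inE h ?inE ?xc ?orbT //=;
   [apply: (subsetP i1)|apply: (subsetP i2)].
Qed.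

(** All colors outside [s1] touch [C1] within [X] only, so [C1 :\: X] can be detached from the whole
    of [C] across the color that cuts [C1]. *)
Lemma peel_outer X : good_cut C1 X s1 -> Z \subset X -> P1 \subset X -> Q1 \subset X ->
  exists X, good_cut C X s.
Proof.
move=> g sZX sP sQ; exists (C1 :\: X).
apply: (good_cut_perm (s := s1 ++ c1 :: o)).
  by rewrite perm_sym (perm_trans pe) // -cat1s perm_catCA.
apply: good_cut_peel (proper_sub sC1) g is1 _ _.
  apply/allP => c cs; suff /and3P[] : colors_of C c by [].
  apply: (allP sC); rewrite (perm_mem pe) inE mem_cat.
  by move: cs; rewrite inE => /orP[->|->]; rewrite ?orbT.
have D P : P :&: C1 \subset X -> [disjoint P & C1 :\: X].
  move=> h; rewrite -setI_eq0; apply/eqP/setP => x; rewrite !inE.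
  apply/negP => /and3P[xP nX xC]; move: nX; rewrite (subsetP h) //.
  by rewrite inE xP.
rewrite /= D /=; last by rewrite setIUl subUset; apply/andP.
apply/allP => c cs; apply: D; exact: subset_trans (allP oZ _ cs) _.
Qed.

(** By [unlinked_own], [P1] is separable from [Q1] too, hence from [Z :|: Q1] at once. If a color of
    [s1] crosses, the cut is peeled off; otherwise only [c1] leaves [X], along [c1.1] alone, and [X]
    can be deleted. *)
Lemma good_cut_caseB : P1 != set0 -> unlinked C1 s1 P1 Z -> exists X, good_cut C X s.
Proof.
move=> P0 uZ.
have uU : unlinked C1 s1 P1 (Z :|: Q1).
  apply/forallP => T; apply/implyP => /and3P[sT m1]; rewrite meetsU => /orP[m2|m2].
    by move/forallP: uZ => /(_ T); rewrite sT m1 m2.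
  by move/forallP: (unlinked_own (subxx _) (subseq_refl s1)) => /(_ T); rewrite sT m1 m2.
have [||||X [sX sPX]] := separate IH (measureC1 (subxx _) (leqnn _)) _ valid1 _ _ P0 _ uU.
- exact/allP.
- exact: subsetIr.
- by rewrite subUset sZ subsetIr.
- by case/set0Pn: Z0 => x xZ; apply/set0Pn; exists x; rewrite inE xZ.
case=> [[g]|[al]]; rewrite subUset => /andP[sZX sQX]; first exact: peel_outer g _ _ _.
apply: (good_cut_delete IH sC sV (X := X) pe).
- exact: subset_trans sX (proper_sub sC1).
- exact: outer_inside.
- case/set0Pn: P0 => x xP; apply/meets_memP; exists x; first exact: (subsetP sPX).
  by move: xP; rewrite inE => /andP[].
- apply/negP => /meets_memP[x xX x2].
  have : x \in C1 :\: X by apply: (subsetP sQX); rewrite inE x2 (subsetP sX).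
  by rewrite inE xX.
Qed.

(** Both traces of [c1] are separated from [Z] together. If no color of [s1] crosses, [c1] is the
    only color leaving [X] but may do so along both sides; then [P1] is separated from [Q1] inside
    [X]. *)
Lemma good_cut_caseA : P1 :|: Q1 != set0 -> unlinked C1 s1 P1 Z -> unlinked C1 s1 Q1 Z ->
  exists X, good_cut C X s.
Proof.
move=> PQ0 uP uQ.
have uU : unlinked C1 s1 (P1 :|: Q1) Z.
  apply/forallP => T; apply/implyP => /and3P[sT]; rewrite meetsU => /orP[m2|m2] m1.
    by move/forallP: uP => /(_ T); rewrite sT m1 m2.
  by move/forallP: uQ => /(_ T); rewrite sT m1 m2.
have sPQ : P1 :|: Q1 \subset C1 by rewrite subUset !subsetIr.
have [|X [sX sPX]] := separate IH (measureC1 (subxx _) (leqnn _)) _ valid1 sPQ sZ PQ0 Z0 uU.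
  exact/allP.
move: sPX; rewrite subUset => /andP[sPX sQX].
case=> [[g sZX]|[al sZX]]; first exact: peel_outer g _ _ _.
have sXC : X \subset C by apply: subset_trans sX (proper_sub sC1).
have al' := outer_inside sX sZX al.
have mP P Y : Y \subset X -> P :&: C1 \subset Y -> meets Y P = (P :&: C1 != set0).
  move=> sYX sPY; apply/meets_memP/set0Pn => [[x xX xP]|[x xP]].
    by exists x; rewrite inE xP (subsetP sX) // (subsetP sYX).
  by exists x; [apply: (subsetP sPY)|move: xP; rewrite inE => /andP[]].
case: (eqVneq P1 set0) => P0.
  apply: (good_cut_delete_swap pe sXC al'); rewrite mP //; first by rewrite -/P1 P0 eqxx.
  by move: PQ0; rewrite P0 set0U.
case: (eqVneq Q1 set0) => Q0.
  by apply: (good_cut_delete IH sC sV pe sXC al'); rewrite mP // -/Q1 Q0 eqxx.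
pose sX1 := filter (inside X) s1.
have ssX : subseq sX1 s1 by apply: filter_subseq.
have [||Y [sY sPY]] := separate IH (measureC1 sX (size_subseq ssX)) _ _ sPX sQX P0 Q0 (unlinked_own sX ssX).
- apply/allP => c; rewrite mem_filter => /andP[i cs].
  exact: colorsS i (colors1 cs).
- by apply: valid_sub sX _ valid1 => T _; apply: leq_count_subseq.
have peX : perm_eq s (c1 :: sX1 ++ (filter (predC (inside X)) s1 ++ o)).
  by rewrite (perm_trans pe) // perm_cons catA perm_cat2r perm_sym perm_filterC.
case=> [[g sQY]|[alY sQY]].
  exists (X :\: Y).
  apply: (good_cut_perm (s := sX1 ++ c1 :: (filter (predC (inside X)) s1 ++ o))).
    by rewrite perm_sym (perm_trans peX) // -cat1s perm_catCA.
  apply: good_cut_peel sXC g (filter_all _ _) _ _.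
    apply/allP => c cs; suff /and3P[] : colors_of C c by [].
    apply: (allP sC); rewrite (perm_mem peX) inE mem_cat.
    by move: cs; rewrite inE => /orP[->|->]; rewrite ?orbT.
  have D P : P :&: X \subset Y -> [disjoint P & X :\: Y].
    move=> h; rewrite -setI_eq0; apply/eqP/setP => x; rewrite !inE.
    by apply/negP => /and3P[xP nX xC]; move: nX; rewrite (subsetP h) // inE xP.
  have sub P Y' : P :&: C1 \subset Y' -> P :&: X \subset Y'.
    by apply: subset_trans; apply: setIS.
  rewrite /= D /=; last by rewrite setIUl subUset !sub.
  apply/allP => c; rewrite mem_cat mem_filter /= => cs; apply: D.
  have : inside (C :\: X) c.
    case/orP: cs => [/andP[ni cs]|cs].
      by move: (allP al' c); rewrite mem_cat cs (negPf ni) => /(_ isT).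
    move: (allP al' c); rewrite mem_cat cs orbT => /(_ isT) /orP[i|//].
    have cc : colors_of C c by apply: (allP sC); rewrite (perm_mem pe) inE mem_cat cs !orbT.
    case/and3P: cc => _ /set0Pn[x x1] _; case/andP: i => /subsetP i1 _.
    have : x \in Z.
      by apply: (subsetP (allP oZ _ cs)); rewrite !inE x1 (subsetP sX) // i1.
    by move/(subsetP sZX); rewrite inE i1.
  case/andP => /subsetP i1 /subsetP i2; apply/subsetP => x; rewrite !inE => /andP[/orP[/i1|/i2]];
    by rewrite inE => /andP[/negPf ->].
apply: (good_cut_delete IH sC sV pe (X := Y)).
- exact: subset_trans sY sXC.
- apply/allP => c cs; case/orP: (allP al' _ cs) => i; last first.
    by apply/orP; right; apply: insideS i; apply: setDS.
  have cs1 : c \in sX1.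
    rewrite mem_filter i; move: cs; rewrite mem_cat => /orP[//|cs].
    have cc : colors_of C c by apply: (allP sC); rewrite (perm_mem pe) inE mem_cat cs !orbT.
    case/and3P: cc => _ /set0Pn[x x1] _; case/andP: i => /subsetP i1 _.
    have : x \in Z.
      by apply: (subsetP (allP oZ _ cs)); rewrite !inE x1 (subsetP sX) // i1.
    by move/(subsetP sZX); rewrite inE i1.
  case/orP: (allP alY _ cs1) => [->//|j]; apply/orP; right.
  by apply: insideS j; apply: setSD.
- by rewrite mP.
- apply/negP => /meets_memP[x xY x2].
  have : x \in X :\: Y.
    by apply: (subsetP sQY); rewrite inE x2 (subsetP sX) // (subsetP sY).
  by rewrite inE xY.
Qed.

End Cases.
End Step2.

(** If both failed, there would be [T1] in [C1] and [T2] in [C2] with at least [#|T1| - 1] and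
    [#|T2| - 1] mixed colors. Since [c1] and [c2] are mixed on the union, it would carry at least
    [#|T1| + #|T2|] colors. *)
Lemma unlinked_dichotomy C C1 C2 s1 s2 c1 c2 :
  C1 \subset C -> C2 \subset C -> [disjoint C1 & C2] ->
  valid C (c1 :: c2 :: s1 ++ s2) ->
  unlinked C1 s1 (c1.1 :&: C1) (c2.1 :&: C1) || unlinked C2 s2 (c1.2 :&: C2) (c2.2 :&: C2).
Proof.
move=> sC1 sC2 dj va; apply/negPn/negP; rewrite negb_or => /andP[].
move=> /forallPn[T1]; rewrite negb_imply -leqNgt => /andP[/and3P[t1 m1 m2] l1].
move=> /forallPn[T2]; rewrite negb_imply -leqNgt => /andP[/and3P[t2 m3 m4] l2].
have : (count (mixed (T1 :|: T2)) (c1 :: c2 :: s1 ++ s2) < #|T1 :|: T2|)%N.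
  apply: va; first by rewrite subUset (subset_trans t1) // (subset_trans t2).
  by rewrite setU_eq0 negb_and (meets_neq0 m1).
have M c : meets T1 (c.1 :&: C1) -> meets T2 (c.2 :&: C2) -> mixed (T1 :|: T2) c.
  move=> a b; apply/andP; split; [move: a|move: b]; apply: meetsS;
    by rewrite ?subsetUl ?subsetUr ?subsetIl.
rewrite /= count_cat !M // cardsU (_ : T1 :&: T2 = set0) ?cards0; last first.
  apply/eqP; rewrite setI_eq0; exact: disjointWl t1 (disjointWr t2 dj).
have := @sub_count _ (mixed T1) (mixed (T1 :|: T2)) (fun c => @mixedS _ _ c (subsetUl _ _)) s1.
have := @sub_count _ (mixed T2) (mixed (T1 :|: T2)) (fun c => @mixedS _ _ c (subsetUr _ _)) s2.
by move: l1 l2; rewrite /=; clear; lia.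
Qed.

(* Remove a color [c1], cut the rest into [C1 | C2] along a color [c2] by induction,
   and compare the traces of [c1] and [c2]: joining them inside [C1] and inside [C2]
   would close a rainbow cycle through [c1] and [c2], so on one of the two sides
   they can be separated by a further color. *)
Lemma good_cut_exists C s : all (colors_of C) s -> valid C s -> s != [::] ->
  exists X, good_cut C X s.
Proof.
have [n] := ubnP (#|C| + size s)%N; elim: n C s => // n IHn C s lt_n.
case: s lt_n => // c1 s lt_n al va _.
have IH C' s' : (#|C'| + size s' < #|C| + size (c1 :: s))%N ->
    all (colors_of C') s' -> valid C' s' -> s' != [::] -> exists X, good_cut C' X s'.
  by move=> lt'; apply: IHn; apply: leq_trans lt' _.
move: (al) => /= /andP[cc1 als].
case: (and3P cc1) => /andP[i11 i12] n11 n12.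
have [s0|sn0] := eqVneq s [::].
  exists c1.1; rewrite s0; apply: good_cut1 => //.
  rewrite /splits subxx /=; apply/orP; left; apply/subsetP => x x2.
  rewrite inE (subsetP i12) // andbT; apply/negP => x1.
  (* Validity on a singleton says that the two sides of a color are disjoint. *)
  have := va [set x]; rewrite sub1set (subsetP i12) // => /(_ isT).
  rewrite -card_gt0 cards1 => /(_ isT) /=; rewrite ltnS leqn0 addn_eq0 => /andP[+ _].
  rewrite /mixed; have -> : meets [set x] c1.1 by apply/meets_memP; exists x; rewrite ?inE.
  by have -> : meets [set x] c1.2 by apply/meets_memP; exists x; rewrite ?inE.
have [||||X gX] := IH C s => //.
- by rewrite /= addnS.
- by apply: valid_sub va => // T _ /=; apply: leq_addl.
have [c2 [C1 [s2 [sC1 pe sp2 al2]]]] : exists c2 C1 s2, [/\ C1 \subset C,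
    perm_eq s (c2 :: s2), (c2.1 \subset C1) && (c2.2 \subset C :\: C1) &
    all (fun c => inside C1 c || inside (C :\: C1) c) s2].
  case: (gX) => sX ct sp.
  have /hasP[c2 c2s cr2] : has (crosses C X) s by rewrite has_count ct.
  have pe := perm_to_rem c2s.
  have al2 : all (fun c => inside X c || inside (C :\: X) c) (rem c2 s).
    by apply: all_ncross; move: ct; rewrite (permP pe) /= cr2 add1n => -[].
  move: (allP sp _ c2s); rewrite cr2 /= => /orP[h|/andP[h1 h2]].
    by exists c2, X, (rem c2 s).
  exists c2, (C :\: X), (rem c2 s); rewrite setDDr setDv set0U (setIidPr sX).
  split=> //; [exact: subsetDl|by rewrite h2|].
  by apply: sub_all al2 => c; rewrite orbC.
case/andP: sp2 => sp1 sp2.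
set C2 := C :\: C1 in sp2 al2.
have dj12 : [disjoint C1 & C2] by rewrite -setI_eq0; apply/eqP/setP => x; rewrite !inE; case: (x \in C1).
pose s1 := filter (inside C1) s2; pose s3 := filter (predC (inside C1)) s2.
have pe2 : perm_eq s (c2 :: s1 ++ s3).
  by rewrite (perm_trans pe) // perm_cons perm_sym perm_filterC.
have cc2 : colors_of C c2 by apply: (allP als); rewrite (perm_mem pe2) inE eqxx.
case/and3P: (cc2) => _ n21 n22.
have is1 : all (inside C1) s1 by apply: filter_all.
have is3 : all (inside C2) s3.
  apply/allP => c; rewrite mem_filter /= => /andP[ni cs].
  by move: (allP al2 _ cs); rewrite (negPf ni).
have sC2 : C2 \subset C by apply: subsetDl.
have pC1 : C1 \proper C.
  rewrite properE sC1; apply/subsetPn; case/set0Pn: n22 => x /(subsetP sp2).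
  by rewrite inE => /andP[]; exists x.
have pC2 : C2 \proper C.
  rewrite properE sC2; apply/subsetPn; case/set0Pn: n21 => x /(subsetP sp1) xC1.
  by exists x; rewrite ?inE ?xC1 // (subsetP sC1).
have peA : perm_eq (c1 :: s) (c1 :: s1 ++ (c2 :: s3)).
  by rewrite perm_cons (perm_trans pe2) // -cat1s perm_catCA.
have peB : perm_eq (c1 :: s) (c1 :: s3 ++ (c2 :: s1)).
  by rewrite perm_cons (perm_trans pe2) // perm_sym perm_catC /= perm_cons.
have out (D E : {set V}) c : [disjoint D & E] -> inside D c -> (c.1 :|: c.2) :&: E = set0.
  move=> dj /andP[j1 j2]; apply/eqP; rewrite setI_eq0; apply: disjointWl dj.
  by rewrite subUset j1.
have oA : all (fun c => (c.1 :|: c.2) :&: C1 \subset c2.1) (c2 :: s3).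
  apply/andP; split.
    rewrite setIUl subUset subsetIl /=.
    by rewrite (_ : c2.2 :&: C1 = set0) ?sub0set //; apply/eqP; rewrite setI_eq0 disjoint_sym; apply: disjointWr sp2 dj12.
  by apply/allP => c cs; rewrite (out _ _ _ _ (allP is3 _ cs)) ?sub0set // disjoint_sym.
have oB : all (fun c => (c.1 :|: c.2) :&: C2 \subset c2.2) (c2 :: s1).
  apply/andP; split.
    rewrite setIUl subUset subsetIl andbT.
    by rewrite (_ : c2.1 :&: C2 = set0) ?sub0set //; apply/eqP; rewrite setI_eq0; apply: disjointWl sp1 dj12.
  by apply/allP => c cs; rewrite (out _ _ _ _ (allP is1 _ cs)) ?sub0set.
have va2 : valid C (c1 :: c2 :: s1 ++ s3) by apply: valid_perm va; rewrite perm_cons.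
have eU : c2.1 :&: C1 = c2.1 by apply/setIidPl.
have eV : c2.2 :&: C2 = c2.2 by apply/setIidPl.
have dich1 := unlinked_dichotomy sC1 sC2 dj12 va2.
have dich2 := unlinked_dichotomy sC1 sC2 dj12 (valid_swap va2).
rewrite /= eU eV in dich1 dich2.
have cover (P : {set V}) : P \subset C -> (P :&: C1) :|: (P :&: C2) = P.
  move=> sP; apply/setP => x; rewrite !inE.
  by case: (boolP (x \in P)) => //= /(subsetP sP) ->; case: (x \in C1).
have peC : perm_eq (c1 :: s) (c2 :: c1 :: s1 ++ s3).
  by apply: perm_trans (_ : perm_eq (c1 :: c2 :: s1 ++ s3) _);
    rewrite ?perm_cons // -[c1 :: c2 :: _]/([:: c1] ++ [:: c2] ++ _) perm_catCA.
(* If [c1] stays in one part, the cut along [c2] is good as it stands. *)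
have keep : inside C1 c1 || inside C2 c1 -> exists X, good_cut C X (c1 :: s).
  move=> i1; exists C1; apply: (good_cut_perm (s := c2 :: c1 :: s1 ++ s3)).
    by rewrite perm_sym.
  apply: good_cut1 => //; first by rewrite /splits sp1 sp2.
  apply/allP => c; rewrite inE mem_cat => /predU1P[->//|/orP[cs|cs]].
    by rewrite (allP is1).
  by rewrite (allP is3) ?orbT.
have [PQ1|PQ1] := eqVneq ((c1.1 :&: C1) :|: (c1.2 :&: C1)) set0.
  move/eqP: PQ1; rewrite setU_eq0 => /andP[/eqP e1 /eqP e2]; apply: keep.
  by rewrite orbC /inside -(cover _ i11) -(cover _ i12) e1 e2 !set0U !subsetIr.
have [PQ2|PQ2] := eqVneq ((c1.1 :&: C2) :|: (c1.2 :&: C2)) set0.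
  move/eqP: PQ2; rewrite setU_eq0 => /andP[/eqP e1 /eqP e2]; apply: keep.
  by rewrite /inside -(cover _ i11) -(cover _ i12) e1 e2 !setU0 !subsetIr.
have caseA1 := good_cut_caseA IH al va pC1 peA isT is1 sp1 n21 oA PQ1.
have caseA2 := good_cut_caseA IH al va pC2 peB isT is3 sp2 n22 oB PQ2.
have caseB1 := good_cut_caseB IH al va pC1 peA isT is1 sp1 n21 oA.
have caseB2 := good_cut_caseB IH al va pC2 peB isT is3 sp2 n22 oB.
(* The two dichotomies use the two orientations of [c1]. Equal outcomes separate both sides of [c1]
   from [c2] in the same part, which is case A. Different outcomes separate one side of [c1] from
   [c2] in both parts; that side has a nonempty trace in one of them, where case B applies. *)
case/orP: dich1 => u1; case/orP: dich2 => u2.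
- exact: caseA1.
- have [e|] := eqVneq (c1.1 :&: C1) set0; last by move/caseB1; apply.
  apply: caseB2 u2; move: (cover _ i11); rewrite e set0U => e'.
  by rewrite e'.
- suff [X' g'] : exists X', good_cut C X' (swap c1 :: s) by exists X'; apply: good_cut_swap.
  have al' : all (colors_of C) (swap c1 :: s) by rewrite /= colors_of_swap.
  have peA' : perm_eq (swap c1 :: s) (swap c1 :: s1 ++ (c2 :: s3)).
    by move: peA; rewrite !perm_cons.
  have peB' : perm_eq (swap c1 :: s) (swap c1 :: s3 ++ (c2 :: s1)).
    by move: peB; rewrite !perm_cons.
  have [e|ne] := eqVneq (c1.2 :&: C1) set0; last first.
    exact: (good_cut_caseB (s := swap c1 :: s) (c1 := swap c1) IH al' (valid_swap va) pC1 peA' isT is1 sp1 n21 oA ne u2).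
  apply: (good_cut_caseB (s := swap c1 :: s) (c1 := swap c1) IH al' (valid_swap va) pC2 peB' isT is3 sp2 n22 oB _ u1).
  by move: (cover _ i12); rewrite e set0U /= => ->.
- exact: caseA2.
Qed.

End Cuts.

(** * Positive functionals *)

Section DotProduct.
Variable N : nat.
Implicit Types c x y w : 'rV[rat]_N.

Lemma dotQE c x : dotQ c x = (x *m c^T) 0 0.
Proof. by rewrite mxE; apply: eq_bigr => j _; rewrite mxE mulrC. Qed.

Lemma dotQC c x : dotQ c x = dotQ x c.
Proof. by apply: eq_bigr => j _; rewrite mulrC. Qed.

Lemma dotQDr c x y : dotQ c (x + y) = dotQ c x + dotQ c y.
Proof. by rewrite !dotQE mulmxDl mxE. Qed.

Lemma dotQZr c a x : dotQ c (a *: x) = a * dotQ c x.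
Proof. by rewrite !dotQE -scalemxAl mxE. Qed.

Lemma dotQNr c x : dotQ c (- x) = - dotQ c x.
Proof. by rewrite !dotQE mulNmx mxE. Qed.

Lemma dotQ0r c : dotQ c 0 = 0.
Proof. by rewrite dotQE mul0mx mxE. Qed.

Lemma dotQDl c d x : dotQ (c + d) x = dotQ c x + dotQ d x.
Proof. by rewrite dotQC dotQDr !(dotQC x). Qed.

Lemma dotQZl a c x : dotQ (a *: c) x = a * dotQ c x.
Proof. by rewrite dotQC dotQZr dotQC. Qed.

Lemma dotQ_sumr (I : Type) (r : seq I) (P : pred I) (F : I -> 'rV[rat]_N) c :
  dotQ c (\sum_(i <- r | P i) F i) = \sum_(i <- r | P i) dotQ c (F i).
Proof. by elim/big_rec2: _ => [|i a b _ <-]; rewrite ?dotQ0r ?dotQDr. Qed.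

Lemma dotQ_gt0 x : x != 0 -> 0 < dotQ x x.
Proof.
move=> x0; rewrite lt_def sumr_ge0 ?andbT; last by move=> j _; rewrite -expr2 sqr_ge0.
apply: contra x0 => /eqP h; apply/eqP/rowP => j; rewrite mxE.
have : forall i, true -> 0 <= x 0 i * x 0 i by move=> i _; rewrite -expr2 sqr_ge0.
move/psumr_eq0P => /(_ h) /(_ j isT) /eqP; rewrite mulf_eq0 orbb; exact: eqP.
Qed.

Lemma between_family k (L : 'I_k -> rat) (U : rat) : (forall i, L i < U) ->
  exists t, t < U /\ forall i, L i < t.
Proof.
elim: k L => [|k IH] L lt; first by exists (U - 1); split=> [|[]//]; lra.
have [t [tU tL]] := IH (fun i => L (lift ord0 i)) (fun i => lt _).
exists ((Num.max t (L ord0) + U) / 2).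
have m1 : t <= Num.max t (L ord0) by rewrite le_max lexx.
have m2 : L ord0 <= Num.max t (L ord0) by rewrite le_max lexx orbT.
have m3 : Num.max t (L ord0) < U by rewrite gt_max tU lt.
split; first by lra.
move=> i; case: (unliftP ord0 i) => [j ->|->]; last by move: (lt ord0); lra.
by move: (tL j) (lt (lift ord0 j)); lra.
Qed.

(** Gordan's alternative, by eliminating [v0] in the manner of Fourier and Motzkin: a functional [w]
    positive on the other vectors is corrected according to the sign of [dotQ w v0]. *)
Lemma gordan_ord k (v : 'I_k -> 'rV[rat]_N) :
  (forall c : 'I_k -> rat, (forall i, 0 <= c i) -> \sum_i c i *: v i = 0 ->
     forall i, c i = 0) ->
  exists w, forall i, 0 < dotQ w (v i).
Proof.
elim: k v => [|k IH] v h; first by exists 0; case.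
set v0 := v ord0; pose v1 i := v (lift ord0 i).
have h1 : forall c : 'I_k -> rat, forall c0 : rat, 0 <= c0 -> (forall i, 0 <= c i) ->
    c0 *: v0 + \sum_i c i *: v1 i = 0 -> c0 = 0 /\ forall i, c i = 0.
  move=> c c0 c0p cp e.
  pose d i := if unlift ord0 i is Some j then c j else c0.
  have de j : d (lift ord0 j) = c j by rewrite /d liftK.
  have d0 : d ord0 = c0 by rewrite /d unlift_none.
  have dz : forall i, d i = 0.
    apply: h => [i|]; first by rewrite /d; case: (unlift _ _).
    by rewrite big_ord_recl d0; under eq_bigr => i _ do rewrite de.
  by split=> [|j]; rewrite -?d0 -?de.
have [w wp] : exists w, forall i, 0 < dotQ w (v1 i).
  apply: IH => c cp e; have [|_ //] := h1 c 0 (lexx _) cp.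
  by rewrite scale0r add0r.
have v00 : v0 != 0.
  apply/eqP => e; have [|| + _] := h1 (fun=> 0) 1 ler01; first by [].
    by rewrite scale1r e big1 ?addr0 // => i _; rewrite scale0r.
  by move/eqP; rewrite oner_eq0.
have fin w'' : 0 < dotQ w'' v0 -> (forall i, 0 < dotQ w'' (v1 i)) ->
    exists w, forall i, 0 < dotQ w (v i).
  by move=> w0 w1; exists w'' => i; case: (unliftP ord0 i) => [j ->|->] //; apply: w1.
have [w0|w0|w0] := ltgtP 0 (dotQ w v0); first exact: (fin w).
  (* [v' i] is the positive combination of [v0] and [v1 i] killed by [w]. If [w'] is positive on all
     of them, every lower bound for [t] in [w' + t *: w] is below the upper bound coming from
     [v0]. *)
  pose v' i := dotQ w (v1 i) *: v0 - dotQ w v0 *: v1 i.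
  have [w' w'p] : exists w', forall i, 0 < dotQ w' (v' i).
    apply: IH => c cp e.
    have [|||c0 _] := h1 (fun i => - dotQ w v0 * c i) (\sum_i c i * dotQ w (v1 i)).
    - by apply: sumr_ge0 => i _; rewrite mulr_ge0 // ltW.
    - by move=> i; rewrite mulr_ge0 // oppr_ge0 ltW.
    - rewrite -[RHS]e scaler_suml -big_split; apply: eq_bigr => i _ /=.
      by rewrite /v' scalerBr !scalerA mulNr scaleNr [_ * c i]mulrC.
    move=> i; have := psumr_eq0P _ c0 (i := i); move=> -/(_ (fun j _ => mulr_ge0 (cp j) (ltW (wp j)))) /(_ isT).
    by move/eqP; rewrite mulf_eq0 (gt_eqF (wp i)) orbF => /eqP.
  have np : 0 < - dotQ w v0 by rewrite oppr_gt0.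
  have [i|t [tU tL]] := @between_family k (fun i => - dotQ w' (v1 i) / dotQ w (v1 i))
    (dotQ w' v0 / - dotQ w v0).
    rewrite ltr_pdivrMr // mulrAC ltr_pdivlMr //.
    move: (w'p i); rewrite /v' dotQDr dotQNr !dotQZr; lra.
  apply: (fin (w' + t *: w)) => [|i]; rewrite dotQDl dotQZl.
    by move: tU; rewrite ltr_pdivlMr //; lra.
  by move: (tL i); rewrite ltr_pdivrMr //; lra.
(* Here [w] kills [v0], so [v0 + t *: w] is positive at [v0] for every [t], and at the others for
   large [t]. The upper bound is just some number above all the lower ones. *)
have [i|t [tU tL]] := @between_family k (fun i => - dotQ v0 (v1 i) / dotQ w (v1 i))
    (1 + \sum_i `|- dotQ v0 (v1 i) / dotQ w (v1 i)|).
  rewrite (bigD1 i) //=; apply: le_lt_trans (ler_norm _) _.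
  by rewrite addrCA ltrDl ltr_wpDr // sumr_ge0.
apply: (fin (v0 + t *: w)) => [|i]; rewrite dotQDl dotQZl.
  by rewrite -w0 mulr0 addr0 dotQ_gt0.
by move: (tL i); rewrite ltr_pdivrMr //; lra.
Qed.

Lemma gordan (I : finType) (A : {set I}) (v : I -> 'rV[rat]_N) :
  (forall c : I -> rat, (forall i, 0 <= c i) -> \sum_(i in A) c i *: v i = 0 ->
     forall i, i \in A -> c i = 0) ->
  exists w, forall i, i \in A -> 0 < dotQ w (v i).
Proof.
move=> h; have [|w wp] := @gordan_ord #|A| (v \o enum_val).
  move=> c cp e j.
  pose d i := if insub (index i (enum A)) is Some k then c k else 0.
  have de k : d (enum_val k) = c k.
    by rewrite /d (_ : index _ _ = k) ?valK // /enum_val index_uniq ?enum_uniq // -cardE.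
  rewrite -de; apply: h (enum_valP j) => [i|]; first by rewrite /d; case: insub.
  by rewrite -[RHS]e big_enum_val; apply: eq_bigr => k _; rewrite de.
exists w => i iA; have := wp (enum_rank_in iA i).
by rewrite /= enum_rankK_in.
Qed.
End DotProduct.

(** * Toric ideals *)

Lemma clear_denominators (m : nat) (x : 'rV[rat]_m) :
  exists (D : nat) (z : 'rV[int]_m), (0 < D)%N /\ map_mx intr z = D%:R *: x.
Proof.
pose D := (\prod_(i < m) `|denq (x 0%R i)|)%N.
exists D, (\row_i (numq (x 0 i) * (\prod_(j < m | j != i) `|denq (x 0%R j)|)%N%:Z)).
split; first by rewrite prodn_gt0 // => i; rewrite absz_gt0 denq_neq0.
apply/rowP => i; rewrite !mxE intrM /D [in RHS](bigD1 i) //= natrM mulrAC.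
have dE (q : rat) : (`|denq q|%N%:R : rat) = (denq q)%:~R.
  by rewrite -[LHS]/((`|denq q|%N%:Z)%:~R) absz_denq.
by rewrite dE [_%:~R * x 0 i]mulrC -numqE.
Qed.

Section Degrees.
Variables (m N : nat) (A : 'M[int]_(m, N)).
Implicit Types u v : 'X_{1..m}.

Definition mnm_row u : 'rV[int]_m := \row_i (u i)%:Z.

Lemma Adeg_mnm_row u : Adeg A u = mnm_row u *m A.
Proof. by apply/rowP => j; rewrite !mxE; apply: eq_bigr => i _; rewrite mxE. Qed.

Lemma mnm_rowD u v : mnm_row (u + v)%MM = mnm_row u + mnm_row v.
Proof. by apply/rowP => i; rewrite !mxE mnmDE PoszD. Qed.

Lemma AdegD u v : Adeg A (u + v)%MM = Adeg A u + Adeg A v.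
Proof. by rewrite !Adeg_mnm_row mnm_rowD mulmxDl. Qed.

Lemma Adeg0 : Adeg A 0%MM = 0.
Proof. by apply/rowP => j; rewrite !mxE big1 // => i _; rewrite mnm0E mul0r. Qed.

Lemma AdegU i : Adeg A U_(i)%MM = row i A.
Proof.
apply/rowP => j; rewrite !mxE (bigD1 i) //= mnm1E eqxx mul1r big1 ?addr0 // => k ki.
by rewrite mnm1E eq_sym (negPf ki) mul0r.
Qed.

Hypothesis pointed : pointed_semigroup A.

(** One term of the relation is moved to the other side; pointedness, applied to these two sums,
    makes it vanish by itself. *)
Lemma pointed_no_relation (c : 'rV[rat]_m) : (forall i, 0 <= c 0 i) ->
  c *m map_mx intr A = 0 -> forall i, row i A != 0 -> c 0 i = 0.
Proof.
move=> cp e i0 ri0; have [D [z [D0 zE]]] := clear_denominators c.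
have zc i : (z 0 i)%:~R = D%:R * c 0 i :> rat by have /rowP/(_ i) := zE; rewrite !mxE.
have zp i : 0 <= z 0 i by rewrite -(ler0z rat) zc mulr_ge0 ?ler0n.
have zA : z *m A = 0.
  have /rowP h : map_mx intr (z *m A) = 0 :> 'rV[rat]_N.
    by rewrite map_mxM zE -scalemxAl e scaler0.
  apply/rowP => j; move: (h j); rewrite mxE [X in _ = X -> _]mxE => /eqP.
  by rewrite intr_eq0 => /eqP ->; rewrite mxE.
pose u : 'rV[int]_m := \row_i (if i == i0 then z 0 i else 0).
have uA : u *m A = z 0 i0 *: row i0 A.
  apply/rowP => j; rewrite !mxE (bigD1 i0) //= big1 ?addr0; last first.
    by move=> k /negPf ki; rewrite mxE ki mul0r.
  by rewrite mxE eqxx.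
have /eqP : u *m A = 0.
  apply: (pointed (v := z - u)) => [i|i|].
  - by rewrite mxE; case: ifP.
  - by rewrite !mxE; case: ifP; rewrite ?subr0 ?subrr.
  - by rewrite mulmxBl zA sub0r opprK.
rewrite uA => /eqP/rowP uz.
have z0 : z 0 i0 = 0.
  apply: contraNeq ri0 => nz; apply/eqP/rowP => j; move: (uz j).
  by rewrite !mxE => /eqP; rewrite mulf_eq0 (negPf nz) => /eqP.
move: (zc i0); rewrite z0 => /esym/eqP; rewrite mulf_eq0 pnatr_eq0.
by rewrite -leqn0 leqNgt D0 => /eqP.
Qed.

(** Gordan's alternative for the nonzero rows, scaled to integers. The weight clears the negative
    exponents in [toric_kernel] and drives the induction on fibers in [connected_fibers]. *)
Lemma positive_weight : exists (w : 'cV[int]_N) (p : 'I_m -> nat),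
  (forall i, (A *m w) i 0 = (p i)%:Z) /\ (forall i, (0 < p i)%N = (row i A != 0)).
Proof.
pose S := [set i | row i A != 0].
have [|w0 w0p] := @gordan N 'I_m S (fun i => row i (map_mx intr A)).
  move=> c cp e i; rewrite inE => ri.
  pose d : 'rV[rat]_m := \row_i (if i \in S then c i else 0).
  have := @pointed_no_relation d _ _ i ri; rewrite mxE inE ri; apply.
    by move=> j; rewrite mxE; case: ifP.
  rewrite mulmx_sum_row -[RHS]e [RHS]big_mkcond; apply: eq_bigr => j _.
  by rewrite mxE; case: ifP; rewrite ?scale0r.
have [D [z [D0 zE]]] := clear_denominators w0.
have zi i : (((A *m z^T) i 0)%:~R : rat) = D%:R * dotQ w0 (row i (map_mx intr A)).
  rewrite mxE rmorph_sum /= mulr_sumr; apply: eq_bigr => j _.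
  by rewrite intrM !mxE; have /rowP/(_ j) := zE; rewrite !mxE => ->; lra.
have zp i : 0 <= (A *m z^T) i 0 /\ ((0 < (A *m z^T) i 0) = (row i A != 0)).
  have [ri|ri] := eqVneq (row i A) 0.
    have -> : (A *m z^T) i 0 = 0.
      by rewrite mxE big1 // => j _; have /rowP/(_ j) := ri; rewrite !mxE => ->; rewrite mul0r.
    by rewrite lexx.
  suff h : 0 < (A *m z^T) i 0 by rewrite h ltW.
  by rewrite -(ltr0z rat) zi mulr_gt0 ?ltr0n // w0p // inE.
exists z^T, (fun i => `|(A *m z^T) i 0%R|%N); split=> i.
  by rewrite gez0_abs //; case: (zp i).
by case: (zp i) => h1 <-; rewrite absz_gt0 lt_def h1 andbT.
Qed.
End Degrees.

(** * Linear functionals on polynomials *)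

Section MonomialFunctional.
Variables (K : fieldType) (m : nat).
Implicit Types (f g : {mpoly K[m]}) (chi : 'X_{1..m} -> K).

Definition mfun chi f : K := \sum_(u <- msupp f) f@_u * chi u.

Lemma mfun_wE chi f k : (msize f <= k)%N ->
  mfun chi f = \sum_(u : 'X_{1..m < k}) f@_u * chi u.
Proof.
move=> lt; pose I : subFinType _ := 'X_{1..m < k}.
rewrite /mfun (big_mksub I) //=; first last.
- by move=> x /msize_mdeg_lt /leq_trans; apply.
- by rewrite msupp_uniq.
by rewrite big_rmcond //= => i /memN_msupp_eq0 ->; rewrite mul0r.
Qed.

Lemma mfunDZ chi a f g : mfun chi (a *: f + g) = a * mfun chi f + mfun chi g.
Proof.
pose k := maxn (msize (a *: f + g)) (maxn (msize f) (msize g)).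
rewrite !(@mfun_wE _ _ k) ?leq_max ?leqnn ?orbT //.
rewrite mulr_sumr -big_split; apply: eq_bigr => u _ /=.
by rewrite mcoeffD mcoeffZ mulrDl mulrA.
Qed.

Lemma mfun0 chi : mfun chi 0 = 0.
Proof. by rewrite /mfun msupp0 big_nil. Qed.

Lemma mfunZ chi a f : mfun chi (a *: f) = a * mfun chi f.
Proof. by have := mfunDZ chi a f 0; rewrite mfun0 !addr0. Qed.

Lemma mfunD chi f g : mfun chi (f + g) = mfun chi f + mfun chi g.
Proof. by have := mfunDZ chi 1 f g; rewrite scale1r mul1r. Qed.

Lemma mfunB chi f g : mfun chi (f - g) = mfun chi f - mfun chi g.
Proof. by rewrite mfunD -scaleN1r mfunZ mulN1r. Qed.

Lemma mfun_sum chi (I : Type) (r : seq I) (P : pred I) (F : I -> {mpoly K[m]}) :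
  mfun chi (\sum_(i <- r | P i) F i) = \sum_(i <- r | P i) mfun chi (F i).
Proof. by elim/big_rec2: _ => [|i a b _ <-]; rewrite ?mfun0 ?mfunD. Qed.

Lemma mfunX chi u : mfun chi 'X_[u] = chi u.
Proof. by rewrite /mfun msuppX big_seq1 mcoeffX eqxx mul1r. Qed.

Lemma mfunMX chi f v : mfun chi ('X_[v] * f) = mfun (fun u => chi (v + u)%MM) f.
Proof.
rewrite [in LHS](mpolyE f) mulr_sumr mfun_sum; apply: eq_bigr => u _.
by rewrite -scalerAr -mpolyXD mfunZ mfunX.
Qed.

Lemma eq_mfun chi chi' f : chi =1 chi' -> mfun chi f = mfun chi' f.
Proof. by move=> e; apply: eq_bigr => u _; rewrite e. Qed.

End MonomialFunctional.

Section Toric.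
Variables (K : fieldType) (m N : nat) (A : 'M[int]_(m, N)).
Implicit Types (f g : {mpoly K[m]}) (chi : 'X_{1..m} -> K) (u v : 'X_{1..m}).

Lemma toric_mfunE f b : \sum_(u <- msupp f | Adeg A u == b) f@_u =
  mfun (fun u => (Adeg A u == b)%:R) f.
Proof.
by rewrite /mfun big_mkcond; apply: eq_bigr => u _; case: ifP; rewrite ?mulr1 ?mulr0.
Qed.

(** Such a functional factors through the degree, so it is a combination of the sums whose vanishing
    defines the toric ideal. *)
Lemma toric_mfun0 f chi : (forall u v, Adeg A u = Adeg A v -> chi u = chi v) ->
  toric_ideal A f -> mfun chi f = 0.
Proof.
move=> hchi If; pose B := undup (map (Adeg A) (msupp f)).
transitivity (\sum_(u <- msupp f) \sum_(b <- B) (Adeg A u == b)%:R * (f@_u * chi u)).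
  apply: eq_big_seq => u uf; rewrite (bigD1_seq (Adeg A u)) ?undup_uniq //=; last first.
    by rewrite mem_undup map_f.
  rewrite eqxx mul1r big1 ?addr0 // => b; rewrite eq_sym => /negPf ->.
  by rewrite mul0r.
rewrite exchange_big big1_seq // => b /andP[_].
rewrite mem_undup => /mapP[u0 _ ->].
transitivity (\sum_(u <- msupp f | Adeg A u == Adeg A u0) f@_u * chi u0).
  rewrite [RHS]big_mkcond; apply: eq_bigr => u _ /=.
  by case: eqP => [/hchi ->|_]; rewrite ?mul1r ?mul0r.
by rewrite -mulr_suml If mul0r.
Qed.

Lemma toric_binomial u v : Adeg A u = Adeg A v ->
  toric_ideal A ('X_[u] - 'X_[v] : {mpoly K[m]}).
Proof. by move=> e b; rewrite toric_mfunE mfunB !mfunX e subrr. Qed.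

Hypothesis pointed : pointed_semigroup A.

(** The Laurent monomials are made polynomial by adding [M * p i] to each exponent, and the weight
    [p i] is kept in coordinate [ord0], so that the shift can be undone. The target has no zero
    divisors, which makes the ideal prime. *)
Lemma toric_kernel : exists (k : nat) (psi : {rmorphism {mpoly K[m]} -> {mpoly K[k]}}),
  forall f, toric_ideal A f <-> psi f = 0.
Proof.
have [w [p [wp pp]]] := positive_weight pointed.
(* [M] bounds the absolute values of the entries and [p i] is positive on nonzero rows, so the
   shifted exponents are nonnegative. *)
pose M := (\sum_(i < m) \sum_(j < N) `|A i j|)%N.
pose E i : 'X_{1..N.+1} :=
  [multinom if unlift ord0 l is Some j then absz (A i j + M%:Z * (p i)%:Z)%R else p i | l < N.+1].
have E0 i : E i ord0 = p i by rewrite mnmE unlift_none.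
have Ej i j : (E i (lift ord0 j))%:Z = A i j + M%:Z * (p i)%:Z.
  rewrite mnmE liftK gez0_abs //; case: (posnP (p i)) => [pi0|pi0].
    have : row i A = 0 by apply/eqP; rewrite -[_ == _]negbK -pp pi0.
    by move/rowP/(_ j); rewrite !mxE => ->; rewrite pi0 mulr0.
  have : (`|A i j| <= M)%N.
    rewrite /M (bigD1 i) //= (bigD1 j) //= -addnA; exact: leq_addr.
  have : (M <= M * p i)%N by rewrite leq_pmulr.
  rewrite -PoszM; clear; lia.
pose Edeg u : 'X_{1..N.+1} := (\sum_(i < m) E i *+ u i)%MM.
have EdegE u l : (Edeg u l)%:Z = \sum_i (u i)%:Z * (E i l)%:Z.
  rewrite /Edeg mnm_sumE -[LHS]natz natr_sum; apply: eq_bigr => i _.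
  by rewrite mulmnE natz PoszM mulrC.
have wdeg u : (Adeg A u *m w) 0 0 = \sum_i (u i)%:Z * (p i)%:Z.
  rewrite Adeg_mnm_row -mulmxA mxE; apply: eq_bigr => i _.
  by rewrite wp mxE.
have EdegP u v : Edeg u = Edeg v <-> Adeg A u = Adeg A v.
  split=> e.
    have e0 : \sum_i (u i)%:Z * (p i)%:Z = \sum_i (v i)%:Z * (p i)%:Z.
      by have := congr1 (fun x : 'X_{1..N.+1} => (x ord0)%:Z) e; rewrite !EdegE;
         under eq_bigr => i _ do rewrite E0; under [X in _ = X]eq_bigr => i _ do rewrite E0.
    apply/rowP => j; have := congr1 (fun x : 'X_{1..N.+1} => (x (lift ord0 j))%:Z) e.
    rewrite !EdegE !mxE.
    have h z : \sum_(i < m) (z i)%:Z * (E i (lift ord0 j))%:Z =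
        \sum_i (z i)%:Z * A i j + M%:Z * \sum_(i < m) (z i)%:Z * (p i)%:Z.
      rewrite mulr_sumr -big_split; apply: eq_bigr => i _ /=; rewrite Ej; ring.
    by rewrite !h e0 => /addIr.
  apply/mnmP => l; suff [] : (Edeg u l)%:Z = (Edeg v l)%:Z by []; rewrite !EdegE.
  have e0 : \sum_i (u i)%:Z * (p i)%:Z = \sum_i (v i)%:Z * (p i)%:Z by rewrite -!wdeg e.
  case: (unliftP ord0 l) => [j|] ->; last first.
    by under eq_bigr => i _ do rewrite E0; under [RHS]eq_bigr => i _ do rewrite E0.
  have h z : \sum_(i < m) (z i)%:Z * (E i (lift ord0 j))%:Z =
      \sum_i (z i)%:Z * A i j + M%:Z * \sum_(i < m) (z i)%:Z * (p i)%:Z.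
    rewrite mulr_sumr -big_split; apply: eq_bigr => i _ /=; rewrite Ej; ring.
  by rewrite !h e0; have /rowP/(_ j) := e; rewrite !mxE => ->.
exists N.+1, (mmap (@mpolyC N.+1 K) (fun i => 'X_[E i])) => f.
have psiE c : (mmap (@mpolyC N.+1 K) (fun i => 'X_[E i]) f)@_c = mfun (fun u => (Edeg u == c)%:R) f.
  rewrite /mmap raddf_sum; apply: eq_bigr => u _ /=.
  by rewrite mcoeffCM /mmap1 mprodXnE mcoeffX.
split=> [If|psi0 b].
  apply/mpolyP => c; rewrite psiE mcoeff0; apply: toric_mfun0 If => u v e.
  by rewrite (_ : Edeg u = Edeg v) //; apply/EdegP.
rewrite toric_mfunE; have [/hasP[u0 _ /eqP <-]|/hasPn h] := boolP (has (fun u => Adeg A u == b) (msupp f)).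
  transitivity (mfun (fun u => (Edeg u == Edeg u0)%:R) f).
    apply: eq_mfun => u; congr (_%:R); congr nat_of_bool.
    by apply/eqP/eqP => /EdegP.
  by rewrite -psiE psi0 mcoeff0.
by rewrite /mfun big1_seq // => u /andP[_ /h /negPf ->]; rewrite mulr0.
Qed.

Lemma toric_prime : is_prime_ideal (@toric_ideal K m N A).
Proof.
have [k [psi psiP]] := toric_kernel; split; first split.
- by apply/psiP; rewrite rmorph0.
- by move=> f g /psiP f0 /psiP g0; apply/psiP; rewrite rmorphD f0 g0 addr0.
- by move=> r f /psiP f0; apply/psiP; rewrite rmorphM f0 mulr0.
- by move/psiP/eqP; rewrite rmorph1 oner_eq0.
- move=> f g /psiP/eqP; rewrite rmorphM mulf_eq0 => /orP[] /eqP h; [left|right]; exact/psiP.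
Qed.

End Toric.

(** * Height of a toric ideal *)

Section Height.
Variables (K : fieldType) (m : nat).
Notation P := {mpoly K[m]}.
Implicit Types (I : P -> Prop).

Definition indep_mod I (T : finType) (p : T -> P) :=
  forall c : T -> K, I (\sum_t c t *: p t) -> forall t, c t = 0.

Lemma ideal_sub I f g : is_ideal I -> I f -> I g -> I (f - g).
Proof. by case=> _ hD hM f0 g0; rewrite -mulN1r; apply: hD => //; apply: hM. Qed.

Lemma ideal_scale I (a : K) f : is_ideal I -> I f -> I (a *: f).
Proof. by case=> _ _ hM f0; rewrite -mul_mpolyC; apply: hM. Qed.

(* A relation mod [I] reduces mod [J] to its terms with [j = 0], which vanish; what
   remains is a multiple of [f] and [f] can be cancelled. *)
Lemma indep_mod_powers I J (T : finType) (p : T -> P) f D :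
  is_prime_ideal I -> is_ideal J -> (forall g, I g -> J g) -> J f -> ~ I f ->
  indep_mod J p -> indep_mod I (fun tj : T * 'I_D => f ^+ tj.2 * p tj.1).
Proof.
move=> [idI _ prI] idJ sIJ Jf nIf ind.
have key : forall c : T -> nat -> K, I (\sum_(j < D) f ^+ j * \sum_t c t j *: p t) ->
    forall t j, (j < D)%N -> c t j = 0.
  elim: D => // D IH c; rewrite big_ord_recl expr0 mul1r.
  pose rest := \sum_(j < D) f ^+ j * \sum_t c t j.+1 *: p t.
  have -> : \sum_(j < D) f ^+ lift ord0 j * \sum_t c t (lift ord0 j) *: p t = f * rest.
    by rewrite mulr_sumr; apply: eq_bigr => j _; rewrite exprS mulrA.
  move=> Ic.
  have c0 t : c t 0%N = 0.
    apply: (ind (fun t => c t 0%N)).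
    rewrite -[X in J X](addrK (f * rest)); apply: ideal_sub => //; first exact: sIJ.
    by case: idJ => _ _ hM; rewrite mulrC; apply: hM.
  move: Ic; rewrite big1 ?add0r => [|t _]; last by rewrite c0 scale0r.
  by move/prI => [//|/(IH (fun t j => c t j.+1)) h] t [|j] //; apply: h.
move=> c Ic [t [j jD]].
pose d t j := if insub j is Some k then c (t, k) else 0.
have de t' (j' : 'I_D) : d t' j' = c (t', j') by rewrite /d valK.
rewrite -(de t (Ordinal jD)); apply: key => //.
suff <- : \sum_(tj : T * 'I_D) c tj *: (f ^+ tj.2 * p tj.1) =
  \sum_(j < D) f ^+ j * \sum_t d t j *: p t by [].
transitivity (\sum_t \sum_(j < D) c (t, j) *: (f ^+ j * p t)).
  by rewrite pair_bigA; apply: eq_bigr => -[].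
rewrite exchange_big; apply: eq_bigr => j' _; rewrite mulr_sumr; apply: eq_bigr => t' _ /=.
by rewrite de scalerAr.
Qed.

Definition lin_indep (T : finType) (p : T -> P) := indep_mod (fun f => f = 0) p.

Lemma msizeX_le (f : P) j : (msize (f ^+ j) <= j * (msize f).+1 + 1)%N.
Proof.
elim: j => [|j IH]; first by rewrite expr0 msize1.
rewrite exprS mulSn; apply: leq_trans (msizeM_le _ _) _.
by rewrite -addnA addSn ltnS leq_add2l.
Qed.

(** Each strict inclusion multiplies the number of independent polynomials by [D], while the bound
    on their size grows only by a multiple of [D.+1]. It matters that [e] depends on the chain
    alone. *)
Lemma prime_chain_indep h (Pr : P -> Prop) : prime_chain_to Pr h ->
  exists e, forall D B (T : finType) (p : T -> P), indep_mod Pr p ->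
    (forall t, msize (p t) <= B)%N ->
  exists (T' : finType) (p' : T' -> P), [/\ #|T'| = (#|T| * D ^ h)%N,
    lin_indep p' & forall t, (msize (p' t) <= B + e * D.+1)%N].
Proof.
elim: h Pr => [|h IH] Pr [Q [Qpr Qlt QE]].
  exists 0%N => D B T p ind sz; exists T, p; split.
  - by rewrite muln1.
  - move=> c e; apply: ind; rewrite e; apply/QE.
    by case: (Qpr 0%N (leqnn _)) => -[].
  - by move=> t; rewrite mul0n addn0.
have [|e he] := IH (Q h).
  exists Q; split => // i ih; first by apply: Qpr; apply: leqW.
  by apply: Qlt; apply: leqW.
have [sub [f [Qf nQf]]] := Qlt h (ltnSn h).
exists (e + msize f + 2)%N => D B T p ind sz.
have idQ : is_ideal (Q h.+1) by case: (Qpr _ (leqnn h.+1)).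
have indQ : indep_mod (Q h.+1) p by move=> c /QE; apply: ind.
have indh := indep_mod_powers (D := D) (Qpr h (leqnSn h)) idQ sub Qf nQf indQ.
have [|T' [p' [cT' ind' sz']]] := he D (B + (msize f + 2) * D.+1)%N _ _ indh.
  case=> t j /=; apply: leq_trans (msizeM_le _ _) _.
  have := msizeX_le f j; have := sz t; have := ltn_ord j.
  have : (j * (msize f).+1 <= D * (msize f).+1)%N by rewrite leq_mul2r ltnW ?orbT.
  clear; nia.
exists T', p'; split=> //; first by rewrite cT' card_prod card_ord expnS mulnA.
by move=> t; apply: leq_trans (sz' t) _; clear; nia.
Qed.

Lemma lin_indep_card (T : finType) (p : T -> P) B : lin_indep p ->
  (forall t, msize (p t) <= B)%N -> (#|T| <= B ^ m)%N.
Proof.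
move=> ind sz; pose U := 'X_{1..m < B}.
have cU : (#|{: U}| <= B ^ m)%N.
  pose F (u : U) : {ffun 'I_m -> 'I_B.-1.+1} := [ffun i => inord (val u i)].
  have ltB (u : U) i : (val u i < B)%N.
    apply: leq_ltn_trans (bmdeg u); rewrite mdegE (bigD1 i) //=; exact: leq_addr.
  have [B0|B0] := posnP B.
    rewrite (_ : #|{: U}| = 0%N) //; apply: eq_card0 => u.
    by have := leq_trans (bmdeg u) (eq_leq B0).
  have Finj : injective F.
    move=> u v /ffunP e; apply: val_inj; apply/mnmP => i.
    have := e i; rewrite !ffunE => /(congr1 val); rewrite /= !inordK ?prednK //; exact: ltB.
  by have := leq_card F Finj; rewrite card_ffun !card_ord prednK.
apply: leq_trans cU; rewrite leqNgt; apply/negP => lt.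
pose M : 'M[K]_(#|T|, #|{: U}|) := \matrix_(i, j) (p (enum_val i))@_(val (enum_val j : U)).
have : kermx M != 0.
  rewrite -mxrank_eq0 mxrank_ker subn_eq0 -ltnNge.
  by apply: leq_ltn_trans lt; apply: rank_leq_col.
move/rowV0Pn => [x /sub_kermxP xM]; apply/negP; rewrite negbK.
have := ind (fun t => x 0 (enum_rank t)); set S := \sum_t _ => h.
have S0 : S = 0.
  apply/mpolyP => u; rewrite mcoeff0 raddf_sum /=.
  have [lu|gu] := ltnP (mdeg u) B; last first.
    rewrite big1 // => t _; rewrite mcoeffZ memN_msupp_eq0 ?mulr0 //.
    by apply: msize_mdeg_ge; apply: leq_trans gu.
  have /rowP/(_ (enum_rank (BMultinom lu : U))) := xM.
  rewrite !mxE => e; rewrite -[RHS]e (reindex (@enum_val T predT)) /=; last first.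
    by exists (@enum_rank T) => t _; rewrite ?enum_valK ?enum_rankK.
  by apply: eq_bigr => i _; rewrite mcoeffZ enum_valK mxE enum_rankK.
by apply/eqP/rowP => i; rewrite mxE -(enum_valK i) h.
Qed.

(** Monomials in [r] variables with independent degrees have pairwise distinct degrees, so they are
    independent modulo the toric ideal. Taking exponents below [D], the chain yields [D ^ (r + h)]
    independent polynomials of size linear in [D], in a space whose dimension is of order
    [D ^ m]. *)
Lemma toric_height_le N (A : 'M[int]_(m, N)) h : pointed_semigroup A ->
  prime_chain_to (@toric_ideal K m N A) h ->
  (h + \rank (map_mx intr A : 'M[rat]_(m, N)) <= m)%N.
Proof.
set AQ := map_mx _ _; set r := \rank AQ => pointed ch.
have [e he] := prime_chain_indep ch.
pose g := maxrankfun AQ.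
pose ex D (b : {ffun 'I_r -> 'I_D}) : 'X_{1..m} := (\sum_(k < r) U_(g k) *+ b k)%MM.
have exE D (b : {ffun 'I_r -> 'I_D}) i : ex D b i = (\sum_(k < r) (g k == i) * b k)%N.
  by rewrite mnm_sumE; apply: eq_bigr => k _; rewrite mulmnE mnm1E.
have ex_inj D (b b' : {ffun 'I_r -> 'I_D}) : Adeg A (ex D b) = Adeg A (ex D b') -> b = b'.
  move=> e'; pose z (b : {ffun 'I_r -> 'I_D}) : 'rV[rat]_r := \row_k (b k)%:R.
  have zE b0 : z b0 *m rowsub g AQ = map_mx intr (Adeg A (ex D b0)).
    apply/rowP => j; rewrite !mxE rmorph_sum /=.
    under [RHS]eq_bigr => i _ do rewrite intrM exE -[X in X * _]/((_)%:R) natr_sum mulr_suml.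
    rewrite exchange_big; apply: eq_bigr => k _ /=; rewrite !mxE (bigD1 (g k)) //=.
    rewrite eqxx mul1n big1 ?addr0 // => i; rewrite eq_sym => /negPf ->.
    by rewrite mul0n mul0r.
  have : z b = z b'.
    by apply: (row_free_inj (maxrowsub_free AQ)); rewrite !zE e'.
  move/rowP => zz; apply/ffunP => k; apply: val_inj; move: (zz k).
  by rewrite !mxE => /eqP; rewrite eqr_nat => /eqP.
(* The sizes are at most [r * D + 1 + e * D.+1], and [D.+1] is at most [2 * D]. *)
have bound D : (0 < D)%N -> (D ^ (r + h) <= ((r + e + e + 1) * D) ^ m)%N.
  move=> D0.
  pose p (b : {ffun 'I_r -> 'I_D}) : P := 'X_[ex D b].
  have [||T' [p' [cT ind sz]]] := he D (r * D + 1)%N _ p.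
  - move=> c Ic b; have := Ic (Adeg A (ex D b)).
    rewrite toric_mfunE mfun_sum (bigD1 b) //= mfunZ mfunX eqxx mulr1.
    rewrite big1 ?addr0 // => b' nb; rewrite mfunZ mfunX.
    by case: eqP => [/ex_inj eb|]; rewrite ?mulr0 // eb eqxx in nb *.
  - move=> b; rewrite msizeX mdegE addn1 ltnS.
    under eq_bigr => i _ do rewrite exE.
    rewrite exchange_big /=; apply: leq_trans (_ : \sum_(k < r) D <= _)%N; last first.
      by rewrite sum_nat_const card_ord.
    apply: leq_sum => k _; rewrite (bigD1 (g k)) //= eqxx mul1n big1 ?addn0 1?ltnW //.
    by move=> i; rewrite eq_sym => /negPf ->.
  have := lin_indep_card ind sz; rewrite cT card_ffun !card_ord -expnD => le1.
  apply: leq_trans le1 _; have [->|m0] := posnP m; first by rewrite !expn0.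
  by rewrite leq_exp2r //; move: D0; clear; nia.
rewrite addnC leqNgt; apply/negP => lt.
(* [D] exceeds [c ^ m], so [D ^ m.+1] exceeds [(c * D) ^ m]. *)
pose c := (r + e + e + 1)%N; pose D := (c ^ m).+1.
have := bound D isT; rewrite expnMn leqNgt => /negP; apply.
apply: leq_trans (_ : D ^ m.+1 <= _)%N; last by rewrite leq_pexp2l.
by rewrite expnS ltn_pmul2r ?expn_gt0.
Qed.
End Height.

(** * Binomial generators and fibers *)

Section Nakayama.
Variables (K : fieldType) (m N : nat) (A : 'M[int]_(m, N)).
Notation P := {mpoly K[m]}.
Notation I := (@toric_ideal K m N A).
Notation mpair := ('X_{1..m} * 'X_{1..m})%type.
Implicit Types (f : P) (chi : 'X_{1..m} -> K) (u v w : 'X_{1..m}) (s : seq mpair).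
Hypothesis pointed : pointed_semigroup A.

Let idI : is_ideal I.
Proof. by case: (toric_prime K pointed). Qed.

(* [base] is the closed point of the toric variety at which the localisation takes
   place: the cone point, with coordinate 1 for the variables of degree 0. *)
Definition base (j : 'I_m) : K := (row j A == 0)%:R.

(** The product of the toric ideal with the maximal ideal of the point [base]; Nakayama's argument
    takes place in the quotient by it. *)
Definition base_part f := exists q : 'I_m -> P, (forall j, I (q j)) /\
  f = \sum_j ('X_j - (base j)%:MP) * q j.

Lemma base_partDZ a f g : base_part f -> base_part g -> base_part (a *: f + g).
Proof.
move=> [q [Iq ->]] [r [Ir ->]]; exists (fun j => a *: q j + r j); split.
  by move=> j; case: idI => _ hD _; apply: hD => //; exact: ideal_scale idI (Iq j).
rewrite scaler_sumr -big_split; apply: eq_bigr => j _ /=.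
by rewrite mulrDr scalerAr.
Qed.

Lemma base_part0 : base_part 0.
Proof.
exists (fun=> 0); split; first by case: idI.
by rewrite big1 // => j _; rewrite mulr0.
Qed.

Lemma base_partD f g : base_part f -> base_part g -> base_part (f + g).
Proof. by move=> /(base_partDZ 1) h /h; rewrite scale1r. Qed.

Lemma base_partZ a f : base_part f -> base_part (a *: f).
Proof. by move=> h; rewrite -[a *: f]addr0; apply: base_partDZ base_part0. Qed.

Lemma base_part_sum (T : Type) (r : seq T) (F : T -> P) :
  (forall t, base_part (F t)) -> base_part (\sum_(t <- r) F t).
Proof.
move=> h; elim/big_ind: _ => //; [exact: base_part0|exact: base_partD].
Qed.

(** One variable at a time, a factor [x_i] is replaced by its value at [base]. *)
Lemma base_residue (r : P) : exists (c : K) (q : 'I_m -> P),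
  r = c%:MP + \sum_j ('X_j - (base j)%:MP) * q j.
Proof.
have hDZ a f g : (exists c q, f = c%:MP + \sum_j ('X_j - (base j)%:MP) * q j) ->
    (exists c q, g = c%:MP + \sum_j ('X_j - (base j)%:MP) * q j) ->
    exists c q, a *: f + g = c%:MP + \sum_j ('X_j - (base j)%:MP) * q j.
  move=> [c [q ->]] [d [r' ->]]; exists (a * c + d), (fun j => a *: q j + r' j).
  rewrite mpolyCD mpolyCM mul_mpolyC scalerDr addrACA; congr (_ + _).
  rewrite scaler_sumr -big_split; apply: eq_bigr => j _ /=.
  by rewrite mulrDr scalerAr.
elim/mpolyind: r => [|a u p _ _ hp].
  exists 0, (fun=> 0); rewrite big1 ?addr0 // => j _; exact: mulr0.
apply: (hDZ _ _ _ _ hp); have [n] := ubnP (mdeg u); elim: n u => // n IH u lt.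
have [->|u0] := eqVneq u 0%MM.
  exists 1, (fun=> 0); rewrite big1 ?addr0 ?mpolyX0 // => j _; exact: mulr0.
have [i ui] : exists i, u i != 0%N.
  apply/existsP; apply: contraNT u0 => /existsPn h; apply/eqP/mnmP => i.
  by rewrite mnm0E; apply/eqP; move: (h i); rewrite negbK.
have uE : u = (U_(i) + (u - U_(i)))%MM by rewrite addmC submK // lep1mP.
have [||c [q e]] := @hDZ (base i) 'X_[u - U_(i)] (('X_i - (base i)%:MP) * 'X_[u - U_(i)]).
- by apply: IH; move: lt; rewrite {1}uE mdegD mdeg1.
- exists 0, (fun j => if j == i then 'X_[u - U_(i)] else 0).
  rewrite add0r (bigD1 i) //= eqxx big1 ?addr0 // => j /negPf ->; exact: mulr0.
exists c, q; rewrite -e {1}uE mpolyXD mulrBl mul_mpolyC addrC subrK //.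
Qed.

Lemma toric_generators_mod h (g : 'I_h -> P) f : generated_by g I -> I f ->
  exists a : 'I_h -> K, base_part (f - \sum_i a i *: g i).
Proof.
move=> gen /gen[r ->].
have [c] := fin_all_exists (fun i => base_residue (r i)).
move/fin_all_exists => [q e]; exists c.
exists (fun j => \sum_i q i j * g i); split.
  by move=> j; apply/gen; exists (fun i => q i j).
under [RHS]eq_bigr => j _ do rewrite mulr_sumr.
rewrite exchange_big -sumrB; apply: eq_bigr => i _ /=.
rewrite {1}(e i) mulrDl mul_mpolyC addrC addKr mulr_suml.
by apply: eq_bigr => j _; rewrite mulrA.
Qed.

Definition binomial_poly (x : mpair) : P := 'X_[x.1] - 'X_[x.2].
Definition isodeg (x : mpair) := Adeg A x.1 == Adeg A x.2.
Definition free_mod s := indep_mod base_part (fun i : 'I_(size s) => binomial_poly (tnth (in_tuple s) i)).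

Lemma isodeg_toric x : isodeg x -> I (binomial_poly x).
Proof. by move/eqP; apply: toric_binomial. Qed.

Lemma free_mod_size h (g : 'I_h -> P) s : generated_by g I -> all isodeg s ->
  free_mod s -> (size s <= h)%N.
Proof.
move=> gen hom fr; rewrite leqNgt; apply/negP => lt.
have [M hM] := fin_all_exists (fun i : 'I_(size s) =>
  toric_generators_mod gen (isodeg_toric (allP hom _ (mem_tnth i (in_tuple s))))).
pose B : 'M[K]_(size s, h) := \matrix_(i, j) M i j.
have : kermx B != 0.
  rewrite -mxrank_eq0 mxrank_ker subn_eq0 -ltnNge.
  by apply: leq_ltn_trans lt; apply: rank_leq_col.
move/rowV0Pn => [x /sub_kermxP xB]; apply/negP; rewrite negbK.
apply/eqP/rowP => i; rewrite mxE; apply: (fr (fun i => x 0 i)).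
have -> : \sum_t x 0 t *: binomial_poly (tnth (in_tuple s) t) =
    \sum_t x 0 t *: (binomial_poly (tnth (in_tuple s) t) - \sum_j M t j *: g j).
  under [RHS]eq_bigr => t _ do rewrite scalerBr.
  rewrite sumrB [X in _ = _ - X](_ : _ = 0) ?subr0 //.
  under eq_bigr => t _ do rewrite scaler_sumr.
  rewrite exchange_big big1 // => j _ /=.
  under eq_bigr => t _ do rewrite scalerA.
  rewrite -scaler_suml; have /rowP/(_ j) := xB; rewrite !mxE => e.
  by rewrite (_ : \sum_t _ = 0) ?scale0r // -[RHS]e; apply: eq_bigr => t _; rewrite mxE.
by apply: base_part_sum => t; apply: base_partZ.
Qed.

Definition in_span_mod s f := exists a : 'I_(size s) -> K,
  base_part (f - \sum_i a i *: binomial_poly (tnth (in_tuple s) i)).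

Lemma free_mod_cons s x : free_mod s -> ~ in_span_mod s (binomial_poly x) -> free_mod (x :: s).
Proof.
move=> fr nsp c; rewrite big_ord_recl (tnth_nth x) /=.
have e i : tnth (in_tuple (x :: s)) (lift ord0 i) = tnth (in_tuple s) i.
  by rewrite !(tnth_nth x).
under eq_bigr => i _ do rewrite e.
move=> W; have c0 : c ord0 = 0.
  apply/eqP; apply: contra_notT nsp => c0.
  exists (fun i => - (c ord0)^-1 * c (lift ord0 i)).
  have := base_partZ (c ord0)^-1 W; rewrite scalerDr scalerA mulVf // scale1r.
  congr (base_part (_ + _)); rewrite scaler_sumr -sumrN; apply: eq_bigr => i _.
  by rewrite scalerA mulNr scaleNr opprK.
move: W; rewrite c0 scale0r add0r => /(fr (fun i => c (lift ord0 i))) h t.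
by case: (unliftP ord0 t) => [j ->|->].
Qed.

(** The greedy extension stops because the toric ideal modulo [base_part] is spanned by the [h]
    generators. *)
Lemma free_mod_extend h (g : 'I_h -> P) s : generated_by g I -> all isodeg s -> free_mod s ->
  exists s', [/\ all isodeg (s' ++ s), (size (s' ++ s) <= h)%N &
    forall x, isodeg x -> in_span_mod (s' ++ s) (binomial_poly x)].
Proof.
move=> gen; have [n] := ubnP (h - size s)%N; elim: n s => // n IH s lt hom fr.
have sz := free_mod_size gen hom fr.
case: (classic (forall x, isodeg x -> in_span_mod s (binomial_poly x))) => [all_in|].
  by exists [::].
move/not_all_ex_not => [x nx]; have [hx nsp] := imply_to_and _ _ nx.
have hom' : all isodeg (x :: s) by rewrite /= hx.
have fr' := free_mod_cons fr nsp.
have [|s' hs'] := IH (x :: s) _ hom' fr'.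
  by have := free_mod_size gen hom' fr'; move: lt => /=; clear; lia.
by exists (s' ++ [:: x]); rewrite -catA.
Qed.

(** Multiplication by ['X_j - (base j)%:MP] turns [chi] into the functional in the hypothesis; being
    constant on fibers, that one kills the factor in the toric ideal. *)
Lemma base_part_mfun chi f : base_part f ->
  (forall j u v, Adeg A u = Adeg A v ->
    chi (U_(j) + u)%MM - base j * chi u = chi (U_(j) + v)%MM - base j * chi v) ->
  mfun chi f = 0.
Proof.
move=> [q [Iq ->]] hchi; rewrite mfun_sum big1 // => j _.
rewrite mulrBl mfunB mfunMX mul_mpolyC mfunZ.
rewrite -(toric_mfun0 (chi := fun u => chi (U_(j) + u)%MM - base j * chi u) _ (Iq j)); last exact: hchi.
rewrite /mfun mulr_sumr -sumrB; apply: eq_bigr => u _; ring.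
Qed.

Definition zero_cols := enum [pred j | row j A == 0].
(** The binomials [x_j - 1] for the variables of degree 0. An extension of this family to a spanning
    one has at most [h - size zero_moves] further moves. *)
Definition zero_moves : seq mpair := [seq (U_(j)%MM, 0%MM) | j <- zero_cols].

Lemma zero_moves_isodeg : all isodeg zero_moves.
Proof.
apply/allP => x /mapP[j]; rewrite mem_enum inE => /eqP rj ->.
by rewrite /isodeg /= AdegU rj Adeg0.
Qed.

(* [u] only involves variables of degree 0. *)
Definition supp0 u := [forall j, (row j A != 0) ==> (u j == 0%N)].

Lemma supp0P u : supp0 u = (Adeg A u == 0).
Proof.
have [w [p [wp pp]]] := positive_weight pointed.
apply/forallP/eqP => [h|h j].
  apply/rowP => l; rewrite !mxE big1 // => j _; have [rj|rj] := eqVneq (row j A) 0.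
    by have /rowP/(_ l) := rj; rewrite !mxE => ->; rewrite mulr0.
  by move: (h j); rewrite rj => /eqP ->; rewrite mul0r.
apply/implyP; rewrite -pp => pj.
have : \sum_i (u i)%:Z * (p i)%:Z = 0.
  transitivity ((Adeg A u *m w) 0 0); last by rewrite h mul0mx mxE.
  by rewrite Adeg_mnm_row -mulmxA mxE; apply: eq_bigr => i _; rewrite wp mxE.
move/psumr_eq0P => /(_ (fun i _ => mulr_ge0 (le0z_nat _) (le0z_nat _))) /(_ j isT) /eqP.
by rewrite mulf_eq0 !eqz_nat orbC => /orP[/eqP e|//]; rewrite e in pj.
Qed.

Lemma zero_moves_free : free_mod zero_moves.
Proof.
move=> c W t; set z := tnth (in_tuple zero_moves) t.
have : z \in zero_moves by apply: mem_tnth.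
case/mapP => k; rewrite mem_enum inE => /eqP rk zE.
(* [chi] is the partial derivative in [x_k] at [base]: it takes the value 1 on [x_k - 1] and 0 on
   the other members of the family. *)
pose chi u : K := if supp0 u then (u k)%:R else 0.
have := base_part_mfun (chi := chi) W; move=> h.
have {h} : mfun chi (\sum_i c i *: binomial_poly (tnth (in_tuple zero_moves) i)) = 0.
  apply: h => j u v e; have su : supp0 u = supp0 v by rewrite !supp0P e.
  rewrite /chi /base; have [rj|rj] := eqVneq (row j A) 0; last first.
    have nz (y : 'X_{1..m}) : supp0 (U_(j) + y)%MM = false.
      by apply/negP => /forallP/(_ j); rewrite rj mnmDE mnm1E eqxx.
    by rewrite !nz !mul0r.
  have e1 (y : 'X_{1..m}) : supp0 (U_(j) + y)%MM = supp0 y by rewrite !supp0P AdegD AdegU rj add0r.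
  rewrite !e1 su; case: ifP => // _; rewrite !mnmDE !mul1r !natrD; ring.
have s00 : supp0 0%MM by rewrite supp0P Adeg0.
have sk i : row i A = 0 -> supp0 U_(i)%MM by move=> ri; rewrite supp0P AdegU ri.
rewrite mfun_sum (bigD1 t) //= big1 => [|i nit].
  rewrite -/z zE mfunZ mfunB !mfunX /chi /= s00 sk // mnm1E eqxx mnm0E subr0 mulr1 addr0.
  by [].
rewrite mfunZ mfunB !mfunX.
have : tnth (in_tuple zero_moves) i \in zero_moves by apply: mem_tnth.
case/mapP => l; rewrite mem_enum inE => /eqP rl lE.
have lk : l != k.
  apply: contra nit => /eqP lk; apply/eqP.
  have : uniq zero_moves.
    rewrite map_inj_uniq ?enum_uniq // => a b /(congr1 fst)/eqP.
    by rewrite /= eq_mnm1 => /eqP.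
  by move/(@tuple_uniqP _ _ (in_tuple zero_moves)); apply; rewrite -/z zE lE lk.
by rewrite lE /chi /= s00 sk // mnm1E (negPf lk) mnm0E subr0 mulr0.
Qed.

(** [C] is a union of connected components of the graph on monomials whose edges are the translates
    of the moves of [s]. *)
Definition closed_under s (C : pred 'X_{1..m}) :=
  forall x, x \in s -> forall w, C (w + x.1)%MM = C (w + x.2)%MM.

(* Sum the coefficients over the monomials of one fiber that satisfy [C].  By
   induction on the weight of the fiber this functional kills [base_part], and it
   kills the moves of [s], hence every binomial of the fiber. *)
Lemma connected_fibers s : all isodeg s -> {subset zero_moves <= s} ->
  (forall x, isodeg x -> in_span_mod s (binomial_poly x)) ->
  forall C, closed_under s C -> forall u v, Adeg A u = Adeg A v -> C u = C v.
Proof.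
move=> hom sub sp; have [w0 [p [wp pp]]] := positive_weight pointed.
pose wt u := (\sum_i u i * p i)%N.
have wtE u v : Adeg A u = Adeg A v -> wt u = wt v.
  have h y : (wt y)%:Z = (Adeg A y *m w0) 0 0.
    rewrite Adeg_mnm_row -mulmxA mxE -natz natr_sum; apply: eq_bigr => i _.
    by rewrite wp mxE natz PoszM.
  by move=> e; suff [] : (wt u)%:Z = (wt v)%:Z by []; rewrite !h e.
have wtD u v : wt (u + v)%MM = (wt u + wt v)%N.
  by rewrite /wt -big_split; apply: eq_bigr => i _; rewrite mnmDE mulnDl.
have wtU j : wt U_(j)%MM = p j.
  rewrite /wt (bigD1 j) //= mnm1E eqxx mul1n big1 ?addn0 // => i ij.
  by rewrite mnm1E eq_sym (negPf ij).
suff main n C u v : closed_under s C -> (wt u < n)%N -> Adeg A u = Adeg A v -> C u -> C v.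
  move=> C cl u v e; apply/idP/idP; first exact: (main (wt u).+1).
  exact: (main (wt v).+1).
elim: n C u v => // n IH C u v cl lt e Cu.
have [a W] := sp (u, v) (introT eqP e).
pose chi y : K := (C y && (Adeg A y == Adeg A u))%:R.
have := base_part_mfun (chi := chi) W => h.
have {h} : mfun chi (binomial_poly (u, v) - \sum_i a i *: binomial_poly (tnth (in_tuple s) i)) = 0.
  apply: h => j y y' ey; rewrite /chi /base; have [rj|rj] := eqVneq (row j A) 0.
    (* [base j] is 1 here, and the move [x_j - 1] of [s] does not change [C], so both sides
       vanish. *)
    have zj : (U_(j)%MM, 0%MM) \in s by apply: sub; rewrite map_f // mem_enum inE rj.
    have CE q : C (U_(j) + q)%MM = C q by have := cl _ zj q; rewrite /= addm0 addmC.
    by rewrite !CE !AdegD AdegU rj !add0r !mul1r !subrr.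
  rewrite !mul0r !subr0 !AdegD ey.
  case: eqP => [eb|_]; last by rewrite !andbF.
  rewrite !andbT; congr (_%:R); congr nat_of_bool.
  (* [x_j] has positive weight, so dividing by it leads to a fiber of smaller weight, where the
     induction hypothesis applies to a translate of [C]. *)
  have lt' q : Adeg A q = Adeg A y -> (wt q < n)%N.
    move=> eq; apply: leq_trans (_ : wt (U_(j) + q)%MM <= _)%N.
      by rewrite wtD wtU -addn1 addnC leq_add2r pp.
    by rewrite (wtE _ u) // AdegD eq ey.
  have cl' : closed_under s (fun q => C (U_(j) + q)%MM).
    by move=> x xs q; rewrite !addmA; apply: cl.
  by apply/idP/idP; apply: (IH _ _ _ cl') => //; apply: lt'.
rewrite mfunB mfunB !mfunX /= mfun_sum big1 ?subr0 => [|i _].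
  rewrite /chi Cu eqxx -e eqxx andbT /= => /eqP; rewrite subr_eq0.
  by case: (C v) => //; rewrite oner_eq0.
rewrite mfunZ mfunB !mfunX; set x := tnth _ i.
have xs : x \in s by apply: mem_tnth.
have := cl x xs 0%MM; rewrite !add0m => Cx.
by rewrite /chi Cx (eqP (allP hom _ xs)) subrr mulr0.
Qed.

End Nakayama.

(** * Rainbow cycles are impossible *)

Section Supports.
Variable m : nat.
Implicit Types (x y : 'rV[rat]_m) (S T C : {set 'I_m}) (M : seq ('rV[rat]_m * 'rV[rat]_m)).

Definition qsupp x := [set j | x 0 j != 0].
Definition coord_mx S : 'M[rat]_(#|S|, m) := rowsub enum_val 1%:M.
Definition relation_span M : 'M[rat]_m := (\sum_(x <- M) <<x.1 - x.2>>)%MS.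
Definition color (p : 'rV[rat]_m * 'rV[rat]_m) := (qsupp p.1, qsupp p.2).

Lemma qsupp_eq0 x : (qsupp x == set0) = (x == 0).
Proof.
apply/eqP/eqP => [/setP h|->]; last by apply/setP => j; rewrite !inE mxE eqxx.
by apply/rowP => j; rewrite mxE; move: (h j); rewrite !inE => /negbFE/eqP.
Qed.

Lemma qsuppP x S : reflect (forall j, j \notin S -> x 0 j = 0) (qsupp x \subset S).
Proof.
apply: (iffP subsetP) => h j.
  by move=> jS; apply/eqP; apply: contraR jS => n; apply: h; rewrite inE.
by rewrite inE => n; apply: contraR n => /h ->.
Qed.

Lemma coord_mx_free S : \rank (coord_mx S) = #|S|.
Proof.
apply/eqP; apply/row_freeP; exists (coord_mx S)^T; apply/matrixP => i j.
rewrite !mxE (bigD1 (enum_val i)) //= !mxE eqxx mul1r big1 ?addr0.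
  by rewrite (inj_eq enum_val_inj) eq_sym.
by move=> k; rewrite !mxE eq_sym => /negPf ->; rewrite mul0r.
Qed.

Lemma sub_coord_mx x S : (x <= coord_mx S)%MS = (qsupp x \subset S).
Proof.
apply/idP/qsuppP => [/submxP[y ->] j jS|h].
  rewrite !mxE big1 // => i _; rewrite !mxE.
  by case: eqP => [e|]; rewrite ?mulr0 //; move: jS; rewrite -e enum_valP.
apply/submxP; exists (x *m (coord_mx S)^T); apply/rowP => j.
rewrite !mxE; have [jS|jS] := boolP (j \in S).
  rewrite (bigD1 (enum_rank_in jS j)) //= big1 ?addr0 => [|i ni].
    rewrite !mxE enum_rankK_in // eqxx mulr1 (bigD1 j) //= !mxE enum_rankK_in // eqxx mulr1.
    rewrite big1 ?addr0 // => k kj; rewrite !mxE enum_rankK_in // eq_sym (negPf kj) mulr0 //.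
  rewrite [X in _ * X]mxE [X in _ * X]mxE; case: eqP => [e|]; rewrite ?mulr0 //.
  by case/eqP: ni; apply: enum_val_inj; rewrite enum_rankK_in.
rewrite h // big1 // => i _; rewrite [X in _ * X]mxE [X in _ * X]mxE.
by case: eqP => [e|]; rewrite ?mulr0 //; move: jS; rewrite -e enum_valP.
Qed.

Lemma relation_span_mem M (x : 'rV[rat]_m * 'rV[rat]_m) : x \in M -> (x.1 - x.2 <= relation_span M)%MS.
Proof.
elim: M => // y M IH; rewrite inE /relation_span big_cons => /predU1P[->|/IH h].
  by apply: submx_trans (addsmxSl _ _); rewrite genmxE.
exact: submx_trans h (addsmxSr _ _).
Qed.

Lemma relation_span_sub M k (R : 'M[rat]_(k, m)) :
  (forall x : 'rV[rat]_m * 'rV[rat]_m, x \in M -> (x.1 - x.2 <= R)%MS) -> (relation_span M <= R)%MS.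
Proof.
elim: M => [|y M IH] h; first by rewrite /relation_span big_nil sub0mx.
rewrite /relation_span big_cons addsmx_sub genmxE h ?mem_head //=.
by apply: IH => x xM; apply: h; rewrite inE xM orbT.
Qed.

Lemma rank_relation_span M : (\rank (relation_span M) <= size M)%N.
Proof.
elim: M => [|x M IH]; first by rewrite /relation_span big_nil mxrank0.
rewrite /relation_span big_cons; apply: leq_trans (mxrank_adds_leqif _ _).1 _.
rewrite -[size (x :: M)]add1n leq_add //; rewrite genmxE; exact: rank_leq_row.
Qed.

End Supports.
Arguments color {m} p.

Section Validity.
Variables (m N : nat) (A : 'M[int]_(m, N)).
Hypothesis pointed : pointed_semigroup A.
Notation AQ := (map_mx intr A : 'M[rat]_(m, N)).
Implicit Types (u v w : 'X_{1..m}) (s : seq ('X_{1..m} * 'X_{1..m})) (T : {set 'I_m}).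

Let C0 := [set j | row j A != 0].

(* The coordinates of degree 0 are discarded. *)
Definition rowq u : 'rV[rat]_m := \row_j (if j \in C0 then (u j)%:R else 0).

Lemma rowqD u v : rowq (u + v)%MM = rowq u + rowq v.
Proof.
by apply/rowP => j; rewrite !mxE; case: ifP; rewrite ?addr0 // mnmDE natrD.
Qed.

Lemma rowq_Adeg u : rowq u *m AQ = map_mx intr (Adeg A u).
Proof.
apply/rowP => j; rewrite !mxE rmorph_sum; apply: eq_bigr => i _ /=.
rewrite !mxE intrM inE; have [ri|//] := eqVneq (row i A) 0.
by have /rowP/(_ j) := ri; rewrite !mxE => ->; rewrite !mulr0.
Qed.

Lemma rowq_qsupp u : qsupp (rowq u) \subset C0.
Proof. by apply/qsuppP => j /negPf jC; rewrite mxE jC. Qed.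

Lemma rowq_ge0 u j : 0 <= rowq u 0 j.
Proof. by rewrite mxE; case: ifP. Qed.

Lemma rowq_eq0 u : (rowq u == 0) = (Adeg A u == 0).
Proof.
rewrite -(supp0P pointed); apply/eqP/forallP => [/rowP h j|h].
  apply/implyP => rj; move: (h j); rewrite !mxE inE rj => /eqP.
  by rewrite pnatr_eq0.
apply/rowP => j; rewrite !mxE; case: ifP => //; rewrite inE => rj.
by move: (h j); rewrite rj => /eqP ->.
Qed.

Definition avoids T u := ~~ meets T (qsupp (rowq u)).

Lemma avoidsD T u v : avoids T (u + v)%MM = avoids T u && avoids T v.
Proof.
rewrite /avoids -negb_or -meetsU; congr (~~ meets T _); apply/setP => j.
rewrite !inE !mxE; case: ifP; rewrite ?eqxx // mnmDE natrD paddr_eq0 //.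
by rewrite negb_and.
Qed.

Lemma avoids_rowq0 T u : rowq u = 0 -> avoids T u.
Proof.
move=> e; rewrite /avoids e; have /eqP -> : qsupp (0 : 'rV[rat]_m) == set0 by rewrite qsupp_eq0.
by rewrite /meets setI0 eqxx.
Qed.

Section Connected.
Variable s : seq ('X_{1..m} * 'X_{1..m}).
Hypothesis isodeg_s : all (isodeg A) s.
(** The fibers are connected once variables of degree 0 may be inserted and removed freely. *)
Hypothesis connected : forall C : pred 'X_{1..m},
  (forall j, row j A = 0 -> forall w, C (w + U_(j))%MM = C w) ->
  closed_under s C -> forall u v, Adeg A u = Adeg A v -> C u = C v.

Definition qmove (x : 'X_{1..m} * 'X_{1..m}) := (rowq x.1, rowq x.2).
(** A move of degree 0 becomes trivial under [rowq] and would give a color with empty sides. *)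
Definition effective : seq ('rV[rat]_m * 'rV[rat]_m) :=
  [seq qmove x | x <- s & rowq x.1 != 0].

Lemma effectiveP y : y \in effective -> exists2 x, x \in s & y = qmove x /\ rowq x.1 != 0.
Proof. by case/mapP => x; rewrite mem_filter => /andP[h xs] ->; exists x. Qed.

Lemma effective_colors y : y \in effective ->
  [/\ colors_of C0 (color y), (forall j, 0 <= y.1 0 j), (forall j, 0 <= y.2 0 j)
    & y.1 *m AQ = y.2 *m AQ].
Proof.
case/effectiveP => x /(allP isodeg_s)/eqP e [-> x1]; split=> /=.
- rewrite /colors_of /color /inside /= !rowq_qsupp !qsupp_eq0 x1 /=.
  by rewrite rowq_eq0 -e -rowq_eq0.
- exact: rowq_ge0.
- exact: rowq_ge0.
- by rewrite !rowq_Adeg e.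
Qed.

Definition avoiding T := [seq y <- effective | ~~ mixed T (color y)].

(** On a walk from [u] through its fiber a move mixed on [T] never applies: the monomials avoid [T]
    and both sides of the move meet it. Every other move leaves the coordinates in [T] alone. *)
Lemma fiber_relation T u v : T \subset C0 ->
  all (fun y => mixed T (color y) || ~~ meets T (qsupp y.1) && ~~ meets T (qsupp y.2)) effective ->
  Adeg A u = Adeg A v -> avoids T u ->
  avoids T v /\ (rowq v - rowq u <= relation_span (avoiding T))%MS.
Proof.
move=> sT al e au.
pose C w := avoids T w && (rowq w - rowq u <= relation_span (avoiding T))%MS.
have : C u = C v.
  apply: connected e => [j rj w|x xs w].
    have z : rowq U_(j)%MM = 0 by apply/eqP; rewrite rowq_eq0 AdegU rj.
    by rewrite /C avoidsD (avoids_rowq0 T z) andbT rowqD z addr0.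
  have ex := eqP (allP isodeg_s _ xs).
  have [x0|xn0] := eqVneq (rowq x.1) 0.
    have x20 : rowq x.2 = 0 by apply/eqP; rewrite rowq_eq0 -ex -rowq_eq0 x0.
    by rewrite /C !avoidsD (avoids_rowq0 T x0) (avoids_rowq0 T x20) !rowqD x0 x20.
  have xe : qmove x \in effective by rewrite map_f // mem_filter xn0.
  have /orP[/andP[m1 m2]|/andP[m1 m2]] := allP al _ xe.
    by rewrite /C !avoidsD /avoids m1 m2 !andbF.
  rewrite /C !avoidsD /avoids /= m1 m2 !andbT; congr (_ && _).
  have xa : (rowq x.1 - rowq x.2 <= relation_span (avoiding T))%MS.
    apply: (@relation_span_mem _ _ (qmove x)); rewrite mem_filter xe andbT.
    by rewrite /mixed negb_and m1.
  have -> : rowq (w + x.1)%MM - rowq u = (rowq (w + x.2)%MM - rowq u) + (rowq x.1 - rowq x.2).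
    by rewrite !rowqD; apply/rowP => j; rewrite !mxE; ring.
  apply/idP/idP => h; last exact: addmx_sub.
  by rewrite -[X in (X <= _)%MS](addrK (rowq x.1 - rowq x.2)) addmx_sub // eqmx_opp.
rewrite /C au subrr sub0mx /= => /esym/andP[].
by [].
Qed.

(** A multiple of [z] is the difference of the exponents of two monomials in one fiber, and the one
    carrying the negative part avoids [T] because [z] is nonnegative there. *)
Lemma relation_sub T (z : 'rV[rat]_m) : T \subset C0 ->
  all (fun y => mixed T (color y) || ~~ meets T (qsupp y.1) && ~~ meets T (qsupp y.2)) effective ->
  qsupp z \subset C0 -> z *m AQ = 0 -> (forall j, j \in T -> 0 <= z 0 j) ->
  (forall j, j \in T -> z 0 j = 0) /\ (z <= relation_span (avoiding T))%MS.
Proof.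
move=> sT al sz zA zT.
have [D [y [D0 yE]]] := clear_denominators z.
have yj j : (y 0 j)%:~R = D%:R * z 0 j :> rat by have /rowP/(_ j) := yE; rewrite !mxE.
have Dp : 0 < D%:R :> rat by rewrite ltr0n.
pose u : 'X_{1..m} := [multinom (if (0%R <= y 0%R j)%R then 0%N else `|y 0%R j|%N) | j < m].
pose v : 'X_{1..m} := [multinom (if (0%R <= y 0%R j)%R then `|y 0%R j|%N else 0%N) | j < m].
have uv j : (v j)%:Z - (u j)%:Z = y 0 j.
  rewrite !mnmE; case: ifP => h; first by rewrite subr0 gez0_abs.
  by rewrite sub0r ltz0_abs ?opprK // ltNge h.
have ruv : rowq v - rowq u = D%:R *: z.
  apply/rowP => j; rewrite !mxE; case: ifP => jC.
    by rewrite -yj -uv rmorphB.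
  by rewrite (qsuppP _ _ sz) ?jC // mulr0 subrr.
have e : Adeg A u = Adeg A v.
  apply/rowP => j; apply/eqP; rewrite -(eqr_int rat) -subr_eq0.
  have /rowP/(_ j) : (rowq u - rowq v) *m AQ = 0.
    by rewrite -opprB ruv mulNmx -scalemxAl zA scaler0 oppr0.
  by rewrite mulmxBl !rowq_Adeg !mxE => ->.
have au : avoids T u.
  rewrite /avoids; apply/negP => /meets_memP[j jT jq]; move: jq; rewrite inE !mxE mnmE (subsetP sT) //.
  have : 0 <= y 0 j by rewrite -(ler0z rat) yj mulr_ge0 ?zT ?ler0n.
  by move=> ->; rewrite eqxx.
have [av sp] := fiber_relation sT al e au; split; last first.
  have -> : z = D%:R^-1 *: (rowq v - rowq u) by rewrite ruv scalerA mulVf ?scale1r // gt_eqF.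
  exact: scalemx_sub.
move=> j jT; have jC := subsetP sT _ jT.
have vj : v j = 0%N.
  apply/eqP; apply: contraNT av => vj; apply/meets_memP; exists j => //.
  by rewrite inE mxE jC pnatr_eq0.
have uj : u j = 0%N.
  apply/eqP; apply: contraNT au => uj; apply/meets_memP; exists j => //.
  by rewrite inE mxE jC pnatr_eq0.
have := yj j; rewrite -uv vj uj subrr => /esym/eqP.
by rewrite mulf_eq0 gt_eqF //= => /eqP.
Qed.

Lemma effective_span (z : 'rV[rat]_m) : qsupp z \subset C0 -> z *m AQ = 0 ->
  (z <= relation_span effective)%MS.
Proof.
move=> sz zA.
have m0 P : meets set0 P = false by rewrite /meets set0I eqxx.
have [|||_] := @relation_sub set0 z _ _ sz zA _.
- exact: sub0set.
- by apply/allP => y _; rewrite !m0 orbT.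
- by move=> j; rewrite inE.
by rewrite /avoiding (eq_filter (a2 := predT)) ?filter_predT // => y; rewrite /mixed !m0.
Qed.

(* A counterexample [T] of maximal size is met by every move on both sides or not at
   all.  Then the columns outside [T] already have full rank, and an integral
   relation expressing a column of [T] joins a monomial avoiding [T] to one that
   does not. *)
Lemma effective_valid : (size effective + \rank AQ <= #|C0|)%N ->
  valid C0 (map color effective).
Proof.
move=> sz T0 sT0 T0n; rewrite ltnNge; apply/negP => le0.
pose bad T := [&& T \subset C0, T != set0 & (#|T| <= count (mixed T) (map color effective))%N].
have : bad T0 by rewrite /bad sT0 T0n.
move=> /(@maxset_exists _ bad)[T /maxsetP[/and3P[sT Tn leT] maxT] _].
have al : all (fun y => mixed T (color y) || ~~ meets T (qsupp y.1) && ~~ meets T (qsupp y.2))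
    effective.
  (* A move meeting [T] on one side only becomes mixed when an element of its other side is added to
     [T], and the enlarged set would again be bad. *)
  apply/allP => y ye; apply/negPn/negP; rewrite negb_or => /andP[nm nav].
  have [j [jC jT mx]] : exists j, [/\ j \in C0, j \notin T & mixed (j |: T) (color y)].
    have [/and3P[/andP[/= i1 i2] n1 n2] _ _ _] := effective_colors ye.
    have key (P Q : {set 'I_m}) : P \subset C0 -> P != set0 -> meets T Q -> ~~ meets T P ->
        exists j, [/\ j \in C0, j \notin T, meets (j |: T) P & meets (j |: T) Q].
      move=> sP /set0Pn[j jP] mQ mP; exists j; split.
      - exact: (subsetP sP).
      - by apply: contra mP => jT; apply/meets_memP; exists j.
      - by apply/meets_memP; exists j; rewrite ?setU11.
      - by apply: meetsS mQ; rewrite ?subsetUr.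
    move: nm nav; rewrite /mixed /=.
    case m1 : (meets T (qsupp y.1)); case m2 : (meets T (qsupp y.2)) => // _ _.
      by have [j [h1 h2 h3 h4]] := key _ _ i2 n2 m1 (negbT m2); exists j; rewrite h3 h4.
    by have [j [h1 h2 h3 h4]] := key _ _ i1 n1 m2 (negbT m1); exists j; rewrite h3 h4.
  have : j |: T = T.
    apply: maxT; last exact: subsetUr.
    apply/and3P; split; first by rewrite subUset sub1set jC.
      by apply/set0Pn; exists j; rewrite setU11.
    rewrite cardsU1 jT add1n; apply: leq_ltn_trans leT _.
    have e a : count a (map color effective) =
        (a (color y) + count a (map color (rem y effective)))%N.
      by have /permP -> := perm_map color (perm_to_rem ye).
    rewrite !e mx (negPf nm) add0n add1n ltnS; apply: sub_count => z.
    by apply: mixedS; apply: subsetUr.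
  by move/setP/(_ j); rewrite setU11 (negPf jT).
set S := C0 :\: T.
have szav : (size (avoiding T) + #|T| <= size effective)%N.
  rewrite size_filter -(count_predC (fun y => mixed T (color y)) effective) addnC leq_add //.
  by move: leT; rewrite count_map.
have cS : (#|S| = #|C0| - #|T|)%N by rewrite cardsD (setIidPr sT).
have kerS : (coord_mx S :&: kermx AQ <= relation_span (avoiding T))%MS.
  apply/rV_subP => z; rewrite sub_capmx sub_coord_mx => /andP[szz /sub_kermxP zA].
  apply: (relation_sub sT al _ zA _).2.
    exact: subset_trans szz (subsetDl _ _).
  by move=> j jT; rewrite (qsuppP _ _ szz) // inE jT.
(* Discarding [T] removes at least [#|T|] moves along with [#|T|] variables, so the bound on the
   number of moves still forces full rank. *)
have rk : (\rank AQ <= \rank (coord_mx S *m AQ))%N.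
  have rn := mxrank_mul_ker (coord_mx S) AQ; rewrite coord_mx_free in rn.
  have kr := leq_trans (mxrankS kerS) (rank_relation_span _).
  have aux (e r c t a k q : nat) : (e + r <= c)%N -> (a + t <= e)%N -> (t <= c)%N ->
    (k <= a)%N -> (q + k = c - t)%N -> (r <= q)%N by clear; lia.
  by apply: aux sz szav (subset_leq_card sT) kr _; rewrite -cS.
have /submxP[y yE] : (AQ <= coord_mx S *m AQ)%MS.
  by rewrite -(geq_leqif (mxrank_leqif_sup (submxMl (coord_mx S) AQ))).
have [j jT] := set0Pn _ Tn.
have jC := subsetP sT _ jT.
pose z : 'rV[rat]_m := delta_mx 0 j - row j y *m coord_mx S.
have sr : qsupp (row j y *m coord_mx S) \subset S by rewrite -sub_coord_mx submxMl.
have zz k : z 0 k = (k == j)%:R - (row j y *m coord_mx S) 0 k.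
  by rewrite !mxE eqxx.
have zj : z 0 j = 1 by rewrite zz eqxx (qsuppP _ _ sr) ?subr0 // inE jT.
have [|||h _] := @relation_sub T z sT al.
- apply/qsuppP => k kC; rewrite zz (qsuppP _ _ sr) ?subr0.
    by case: eqP => // e; rewrite e jC in kC.
  by rewrite inE (negPf kC) andbF.
- rewrite mulmxBl -rowE -mulmxA -row_mul -yE subrr //.
- move=> k kT; rewrite zz (qsuppP _ _ sr) ?subr0 ?ler0n // inE kT //.
by move: (h j jT); rewrite zj => /eqP; rewrite oner_eq0.
Qed.

End Connected.
End Validity.

(** * Faces and sums of cones *)

Section Dimension.
Variable N : nat.
Implicit Types (S : vset N) (x y : 'rV[rat]_N).

Lemma vset_ext S S' : (forall x, S x <-> S' x) -> S = S'.
Proof.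
by move=> h; apply: functional_extensionality => x; apply: propositional_extensionality.
Qed.

Definition spans S k (M : 'M[rat]_(k, N)) :=
  (forall i, S (row i M)) /\ (forall x, S x -> (x <= M)%MS).

Lemma set_dim_spans S k (M : 'M[rat]_(k, N)) : spans S M -> set_dim S (\rank M).
Proof.
case=> rS sM; split.
  exists (rowsub (maxrankfun M) M); split; last exact/eqP/maxrowsub_free.
  by move=> i; rewrite row_rowsub.
by move=> k' M' rS'; apply: mxrankS; apply/row_subP => i; apply: sM.
Qed.

Lemma spans_set_dim S n : set_dim S n -> exists M : 'M[rat]_(n, N), spans S M /\ \rank M = n.
Proof.
case=> [[M [rS rk]] ub]; exists M; split=> //; split=> // x Sx.
have := ub _ (col_mx M x) _; rewrite -[X in (X -> _)]/(forall i, _) => le.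
have {le} le : (\rank (col_mx M x) <= n)%N.
  apply: le => i; rewrite -(splitK i); case: (split i) => j /=.
    by rewrite rowKu.
  by rewrite rowKd row_id.
have sM : (M <= col_mx M x)%MS by rewrite -addsmxE addsmxSl.
have := mxrank_leqif_sup sM; move/geq_leqif; rewrite rk le => /esym.
by apply: submx_trans; rewrite -addsmxE addsmxSr.
Qed.

Lemma set_dim_uniq S n n' : set_dim S n -> set_dim S n' -> n = n'.
Proof.
move=> [[M [rS rk]] ub] [[M' [rS' rk']] ub'].
by apply/eqP; rewrite eqn_leq -{1}rk -{2}rk' ub ?ub'.
Qed.

Lemma spanQ_spans S k (M : 'M[rat]_(k, N)) x : spans S M -> spanQ S x <-> (x <= M)%MS.
Proof.
case=> rS sM; split=> [[k' [v [c [Sv ->]]]]|/submxP[y ->]].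
  by apply: summx_sub => i _; apply: scalemx_sub; apply: sM.
by exists k, (fun i => row i M), (fun i => y 0 i); split=> //; rewrite mulmx_sum_row.
Qed.

Lemma set_dim1P S : set_dim S 1 <->
  exists x, [/\ x != 0, S x & forall y, S y -> exists q : rat, y = q *: x].
Proof.
split=> [/spans_set_dim[M [[rS sM] rk]]|[x [x0 Sx h]]].
  exists M; split; first by rewrite -mxrank_eq0 rk.
    by have := rS 0; rewrite row_id.
  by move=> y /sM/sub_rVP.
have <- : \rank x = 1%N by rewrite rank_rV x0.
apply: set_dim_spans; split=> [i|y /h[q ->]]; first by rewrite row_id.
exact: scalemx_sub.
Qed.

End Dimension.

Section Glue.
Variable N : nat.

(** [c1] is corrected by [c2 - c1] composed with a projection that kills [M1] and is the identity on
    a complement of the intersection in [M2]. On the intersection the two functionals agree, since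
    it lies on the line through [a]. *)
Lemma glue_functionals k1 k2 (M1 : 'M[rat]_(k1, N)) (M2 : 'M[rat]_(k2, N))
    (a c1 c2 : 'rV[rat]_N) :
  (forall x : 'rV_N, (x <= M1)%MS -> (x <= M2)%MS -> exists q : rat, x = q *: a) ->
  dotQ c1 a = dotQ c2 a ->
  exists c, (forall x, (x <= M1)%MS -> dotQ c x = dotQ c1 x) /\
            (forall x, (x <= M2)%MS -> dotQ c x = dotQ c2 x).
Proof.
move=> cap ca; pose U := (M2 :\: M1)%MS; pose pr := proj_mx U <<M1>>%MS.
have dx : (U :&: <<M1>>)%MS = 0.
  by apply/eqP; rewrite -submx0 -(capmx_diff M2 M1) capmxS // genmxE.
pose c := c1 + (c2 - c1) *m pr^T.
have cE x : dotQ c x = dotQ c1 x + dotQ (c2 - c1) (x *m pr).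
  rewrite /c dotQDl; congr (_ + _); rewrite !dotQE trmx_mul trmxK mulmxA //.
exists c; split=> x xM.
  by rewrite cE proj_mx_0 ?dotQ0r ?addr0 ?genmxE.
have : (x <= M2 :&: M1 + U)%MS by rewrite addsmxC addsmx_diff_cap_eq.
case/sub_addsmxP => -[u1 u2] /= e.
have cap1 : (u1 *m (M2 :&: M1) <= M2 :&: M1)%MS by apply: submxMl.
move: cap1; rewrite sub_capmx => /andP[s2 s1].
rewrite cE e mulmxDl (@proj_mx_0 _ _ _ _ _ (u1 *m _) dx) ?genmxE // add0r.
rewrite proj_mx_id ?submxMl // !dotQDr dotQDl.
have [q ->] := cap _ s1 s2.
have dN y : dotQ (- c1) y = - dotQ c1 y by rewrite -scaleN1r dotQZl mulN1r.
rewrite !dotQZr dN ca; ring.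
Qed.
End Glue.

Section Cones.
Variable N : nat.
Implicit Types (S : vset N) (x y a c d : 'rV[rat]_N).

Definition is_cone S := [/\ S 0, forall x y, S x -> S y -> S (x + y)
  & forall (q : rat) x, 0 <= q -> S x -> S (q *: x)].
Definition positive_on S w := forall x, S x -> x != 0 -> 0 < dotQ w x.
Definition is_sum S1 S2 S := forall x, S x <-> exists x1 x2, [/\ S1 x1, S2 x2 & x = x1 + x2].

Lemma posQ_cone S : is_cone (posQ S).
Proof.
split.
- exists 0%N, (fun=> 0), (fun=> 0); split=> [[]|[]|] //.
  by rewrite big_ord0.
- move=> x y [k1 [v1 [c1 [S1 p1 ->]]]] [k2 [v2 [c2 [S2 p2 ->]]]].
  exists (k1 + k2)%N, (fun i => match split i with inl j => v1 j | inr j => v2 j end),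
    (fun i => match split i with inl j => c1 j | inr j => c2 j end); split.
  + by move=> i; case: (split i).
  + by move=> i; case: (split i).
  rewrite big_split_ord; congr (_ + _); apply: eq_bigr => i _.
    by rewrite (unsplitK (inl i)).
  by rewrite (unsplitK (inr i)).
- move=> q x q0 [k [v [c [Sv p ->]]]]; exists k, v, (fun i => q * c i); split=> //.
    by move=> i; rewrite mulr_ge0.
  by rewrite scaler_sumr; apply: eq_bigr => i _; rewrite scalerA.
Qed.

Lemma cone_sum S (I : Type) (r : seq I) (P : pred I) (F : I -> 'rV[rat]_N) : is_cone S ->
  (forall i, P i -> S (F i)) -> S (\sum_(i <- r | P i) F i).
Proof. by case=> h0 hD _ h; elim/big_ind: _. Qed.

Lemma posQ_sub S S' : is_cone S' -> (forall x, S x -> S' x) -> forall x, posQ S x -> S' x.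
Proof.
move=> cS h x [k [v [c [Sv p ->]]]]; apply: cone_sum => // i _.
by case: cS => _ _; apply => //; apply: h.
Qed.

Lemma posQ_incl S x : S x -> posQ S x.
Proof.
move=> Sx; exists 1%N, (fun=> x), (fun=> 1); split=> //.
by rewrite big_ord1 scale1r.
Qed.

Lemma posQ_is_sum S1 S2 S : is_cone S1 -> is_cone S2 ->
  (forall x, S x <-> posQ (fun y => S1 y \/ S2 y) x) -> is_sum S1 S2 S.
Proof.
move=> c1 c2 h x; rewrite h; split=> [|[x1 [x2 [h1 h2 ->]]]].
  apply: (@posQ_sub _ (fun x => exists x1 x2, [/\ S1 x1, S2 x2 & x = x1 + x2]))
    => [|y [yS|yS]].
  - case: c1 c2 => z1 d1 m1 [z2 d2 m2]; split.
    + by exists 0, 0; rewrite addr0.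
    + move=> _ _ [x1 [x2 [? ? ->]]] [y1 [y2 [? ? ->]]].
      by exists (x1 + y1), (x2 + y2); rewrite addrACA; split; auto.
    + move=> q _ q0 [x1 [x2 [? ? ->]]]; exists (q *: x1), (q *: x2).
      by rewrite scalerDr; split; auto.
  - by exists y, 0; rewrite addr0; split=> //; case: c2.
  - by exists 0, y; rewrite add0r; split=> //; case: c1.
case: (posQ_cone (fun y => S1 y \/ S2 y)) => _ hD _.
by apply: hD; apply: posQ_incl; [left|right].
Qed.

Lemma is_sum_cone S1 S2 S : is_cone S1 -> is_cone S2 -> is_sum S1 S2 S -> is_cone S.
Proof.
case=> z1 d1 m1 [z2 d2 m2] h; split.
- by apply/h; exists 0, 0; rewrite addr0.
- move=> _ _ /h[x1 [x2 [? ? ->]]] /h[y1 [y2 [? ? ->]]]; apply/h.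
  by exists (x1 + y1), (x2 + y2); rewrite addrACA; split; auto.
- move=> q _ q0 /h[x1 [x2 [? ? ->]]]; apply/h; exists (q *: x1), (q *: x2).
  by rewrite scalerDr; split; auto.
Qed.

Lemma is_sum_l S1 S2 S : is_cone S2 -> is_sum S1 S2 S -> forall x, S1 x -> S x.
Proof. by case=> z _ _ h x Sx; apply/h; exists x, 0; rewrite addr0. Qed.

Lemma is_sumC S1 S2 S : is_sum S1 S2 S -> is_sum S2 S1 S.
Proof.
by move=> h x; rewrite h; split=> -[x1 [x2 [? ? ->]]]; exists x2, x1; rewrite addrC.
Qed.

Lemma is_sum_r S1 S2 S : is_cone S1 -> is_sum S1 S2 S -> forall x, S2 x -> S x.
Proof. by move=> c1 h; apply: is_sum_l c1 (is_sumC h). Qed.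

Lemma set_dim_is_sum S1 S2 S n1 n2 a : is_cone S1 -> is_cone S2 -> is_sum S1 S2 S ->
  set_dim S1 n1 -> set_dim S2 n2 -> a != 0 -> S1 a -> S2 a ->
  (forall x, spanQ S1 x -> spanQ S2 x -> exists q : rat, x = q *: a) ->
  set_dim S (n1 + n2 - 1)%N.
Proof.
move=> c1 c2 h /spans_set_dim[M1 [s1 r1]] /spans_set_dim[M2 [s2 r2]] a0 a1 a2 cap.
have rc : \rank (M1 :&: M2)%MS = 1%N.
  have -> : \rank (M1 :&: M2)%MS = \rank a.
    apply/eqmx_rank/andP; split.
      apply/rV_subP => x; rewrite sub_capmx => /andP[x1 x2].
      have [||q ->] := cap x; [exact/(spanQ_spans _ s1)|exact/(spanQ_spans _ s2)|].
      exact: scalemx_sub.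
    by rewrite sub_capmx; case: (s1) (s2) => _ -> // [_ ->].
  by rewrite rank_rV a0.
have -> : (n1 + n2 - 1)%N = \rank (col_mx M1 M2).
  by have := mxrank_sum_cap M1 M2; rewrite -addsmxE r1 r2 rc => <-; rewrite addnK.
apply: set_dim_spans; split.
  move=> i; rewrite -(splitK i); case: (split i) => j /=.
    by rewrite rowKu; apply: (is_sum_l c2 h); case: s1.
  by rewrite rowKd; apply: (is_sum_r c1 h); case: s2.
move=> _ /h[x1 [x2 [h1 h2 ->]]]; rewrite -addsmxE addmx_sub_adds //.
  by case: s1 => _; apply.
by case: s2 => _; apply.
Qed.

Lemma face_scale S c x q : is_cone S -> 0 <= q -> face S c x -> face S c (q *: x).
Proof. by case=> _ _ m q0 [Sx cx]; split; [apply: m|rewrite dotQZr cx mulr0]. Qed.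

(** Points of the face are rational multiples of [x], and [w] excludes the negative ones. *)
Lemma face_ray S c x w : is_cone S -> positive_on S w -> extreme_ray_normal S c ->
  face S c x -> x != 0 -> forall y, face S c y <-> exists2 q : rat, 0 <= q & y = q *: x.
Proof.
move=> cS wS [_ /set_dim1P[z [z0 _ hz]]] fx x0 y; split=> [fy|[q q0 ->]]; last exact: face_scale.
have [p px] := hz _ fx; have [r ry] := hz _ fy.
have p0 : p != 0 by apply: contraNneq x0 => p0; rewrite px p0 scale0r.
exists (r / p); last by rewrite px scalerA divfK.
have [y0|y0] := eqVneq y 0.
  by move/esym/eqP: ry; rewrite y0 scaler_eq0 (negPf z0) orbF => /eqP ->; rewrite mul0r.
have wx := wS _ (proj1 fx) x0; have wy := wS _ (proj1 fy) y0.
have e : dotQ w y = (r / p) * dotQ w x by rewrite ry px !dotQZr mulrA divfK.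
by apply: ltW; rewrite -(pmulr_lgt0 _ wx) -e.
Qed.

(** Any nonzero point of a face that is a ray generates it, so a subcone containing such a point has
    the same face. *)
Lemma extreme_sub S S' c x w : is_cone S -> is_cone S' -> positive_on S' w ->
  (forall y, S y -> S' y) -> extreme_ray_normal S' c -> face S c x -> x != 0 ->
  extreme_ray_normal S c /\ face S c = face S' c.
Proof.
move=> cS cS' wS' sub ec fx x0; have [sc d1] := ec.
have fx' : face S' c x by case: fx => /sub.
have wS : positive_on S w by move=> y /sub; apply: wS'.
have ray := face_ray cS' wS' ec fx' x0.
have eq y : face S c y <-> face S' c y.
  split=> [[/sub] //|/ray[q q0 ->]]; exact: face_scale.
split; last exact: vset_ext.
by split; [move=> y /sub/sc|rewrite (vset_ext eq)].
Qed.

(** [c] is nonnegative on both summands of a point of its face, hence vanishes on both; a nonzero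
    one already spans the ray. *)
Lemma extreme_is_sum S1 S2 S w c : is_cone S1 -> is_cone S2 -> is_sum S1 S2 S ->
  positive_on S w -> extreme_ray_normal S c ->
  (extreme_ray_normal S1 c /\ face S1 c = face S c) \/
  (extreme_ray_normal S2 c /\ face S2 c = face S c).
Proof.
move=> c1 c2 h wS ec; have cS := is_sum_cone c1 c2 h.
have [sc /set_dim1P[x [x0 [Sx cx] _]]] := ec.
have /h[x1 [x2 [h1 h2 e]]] := Sx.
have l1 := is_sum_l c2 h; have l2 := is_sum_r c1 h.
have p1 := sc _ (l1 _ h1); have p2 := sc _ (l2 _ h2).
have e0 : dotQ c x1 + dotQ c x2 = 0 by rewrite -dotQDr -e.
have [x10|x1n] := eqVneq x1 0.
  right; apply: (extreme_sub (x := x2) c2 cS wS l2 ec); first by split=> //; move: p1 p2 e0; lra.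
  by apply: contraNneq x0 => x20; rewrite e x10 x20 addr0.
by left; apply: (extreme_sub (x := x1) c1 cS wS l1 ec) => //; split=> //; move: p1 p2 e0; lra.
Qed.

End Cones.

(** * Counting extreme rays *)

Section Rays.
Variable N : nat.
Implicit Types (S : vset N) (x y a c d w : 'rV[rat]_N).

Lemma num_extreme_raysE S k : num_extreme_rays S k <->
  exists c : 'I_k -> 'rV[rat]_N, [/\ forall i, extreme_ray_normal S (c i),
    forall i j, face S (c i) = face S (c j) -> i = j &
    forall d, extreme_ray_normal S d -> exists i, face S d = face S (c i)].
Proof.
split=> -[c [h1 h2 h3]]; exists c; split=> //.
- move=> i j e; apply/eqP/negPn/negP => ij; by apply: (h2 _ _ ij) => x; rewrite e; split.
- by move=> d /h3[i e]; exists i; apply: vset_ext.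
- by move=> i j /eqP ij e; apply: ij; apply: h2; apply: vset_ext.
- by move=> d /h3[i e]; exists i => x; rewrite e; split.
Qed.

Lemma num_extreme_rays_le S k k' :
  num_extreme_rays S k -> num_extreme_rays S k' -> (k <= k')%N.
Proof.
move=> /num_extreme_raysE[c [h1 h2 _]] /num_extreme_raysE[c' [_ _ h3]].
have [f fE] := fin_all_exists (fun i => h3 _ (h1 i)).
have fi : injective f by move=> i j e; apply: h2; rewrite !fE e.
by have := leq_card f fi; rewrite !card_ord.
Qed.

Lemma num_extreme_rays_uniq S k k' :
  num_extreme_rays S k -> num_extreme_rays S k' -> k = k'.
Proof.
by move=> h h'; apply/eqP; rewrite eqn_leq (num_extreme_rays_le h h') (num_extreme_rays_le h' h).
Qed.

(** Counting rays requires a complete list of them. A list without repetition is extended until it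
    is complete, and its length cannot exceed [K] because a tag determines the face. *)
Lemma count_rays_tagged S K (R : 'rV[rat]_N -> 'I_K -> Prop) :
  (forall d, extreme_ray_normal S d -> exists i, R d i) ->
  (forall d d' i, R d i -> R d' i -> face S d = face S d') ->
  exists k (c : 'I_k -> 'rV[rat]_N) (t : 'I_k -> 'I_K),
    [/\ injective t, forall i, R (c i) (t i), forall i, extreme_ray_normal S (c i),
      forall i j, face S (c i) = face S (c j) -> i = j &
      forall d, extreme_ray_normal S d -> exists i, face S d = face S (c i)].
Proof.
move=> hR hE.
suff main n k (c : 'I_k -> 'rV[rat]_N) (t : 'I_k -> 'I_K) : (K - k < n)%N ->
    (forall i, R (c i) (t i)) -> (forall i, extreme_ray_normal S (c i)) ->
    (forall i j, face S (c i) = face S (c j) -> i = j) ->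
    exists k (c : 'I_k -> 'rV[rat]_N) (t : 'I_k -> 'I_K),
    [/\ injective t, forall i, R (c i) (t i), forall i, extreme_ray_normal S (c i),
      forall i j, face S (c i) = face S (c j) -> i = j &
      forall d, extreme_ray_normal S d -> exists i, face S d = face S (c i)].
  have f0 (T : Type) : 'I_0 -> T by case.
  by apply: (main K.+1 0%N (f0 _) (f0 _)) => [|[]|[]|[]] //; rewrite subn0.
elim: n k c t => // n IH k c t lt Rt Ec inj.
have ti (k0 : nat) (c0 : 'I_k0 -> 'rV[rat]_N) (t0 : 'I_k0 -> 'I_K) : (forall i, R (c0 i) (t0 i)) ->
    (forall i j, face S (c0 i) = face S (c0 j) -> i = j) -> injective t0.
  by move=> R0 inj0 i j e; apply: inj0; apply: hE (R0 i) _; rewrite e.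
case: (classic (forall d, extreme_ray_normal S d -> exists i, face S d = face S (c i))).
  by move=> comp; exists k, c, t; split=> //; apply: ti Rt inj.
move=> /not_all_ex_not[d nd]; have [Ed ne] := imply_to_and _ _ nd.
have [l Rl] := hR _ Ed.
pose c' (i : 'I_k.+1) := if unlift ord0 i is Some j then c j else d.
pose t' (i : 'I_k.+1) := if unlift ord0 i is Some j then t j else l.
have Rt' i : R (c' i) (t' i) by rewrite /c' /t'; case: (unlift _ _).
have inj' i j : face S (c' i) = face S (c' j) -> i = j.
  rewrite /c'; case: (unliftP ord0 i) => [i'|] ->; case: (unliftP ord0 j) => [j'|] ->.
  - by move/inj ->.
  - by move=> e; case: ne; exists i'.
  - by move=> e; case: ne; exists j'.
  - by [].
have le : (k.+1 <= K)%N by have := leq_card t' (ti _ _ _ Rt' inj'); rewrite !card_ord.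
apply: (IH k.+1 c' t') => //; first by move: lt le; clear; lia.
by move=> i; rewrite /c'; case: (unlift _ _).
Qed.

Section Sum.
Variables (S1 S2 S : vset N) (w : 'rV[rat]_N).
Hypotheses (cone1 : is_cone S1) (cone2 : is_cone S2) (sumS : is_sum S1 S2 S).
Hypothesis wS : positive_on S w.

Lemma rays_is_sum k1 k2 (c1 : 'I_k1 -> 'rV[rat]_N) (c2 : 'I_k2 -> 'rV[rat]_N) :
  (forall d, extreme_ray_normal S1 d -> exists i, face S1 d = face S1 (c1 i)) ->
  (forall d, extreme_ray_normal S2 d -> exists i, face S2 d = face S2 (c2 i)) ->
  exists k (c : 'I_k -> 'rV[rat]_N) (t : 'I_k -> 'I_(k1 + k2)),
    [/\ injective t,
      forall i, face S (c i) =
        match split (t i) with inl j => face S1 (c1 j) | inr j => face S2 (c2 j) end,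
      forall i, extreme_ray_normal S (c i),
      forall i j, face S (c i) = face S (c j) -> i = j &
      forall d, extreme_ray_normal S d -> exists i, face S d = face S (c i)].
Proof.
move=> h1 h2; apply: (@count_rays_tagged S _ (fun d i => face S d =
  match split i with inl j => face S1 (c1 j) | inr j => face S2 (c2 j) end)) => [d ed|d d' i -> ->] //.
case: (extreme_is_sum cone1 cone2 sumS wS ed) => -[e1 <-].
  by have [i ->] := h1 _ e1; exists (lshift k2 i); rewrite (unsplitK (inl i)).
by have [i ->] := h2 _ e1; exists (rshift k1 i); rewrite (unsplitK (inr i)).
Qed.

Lemma num_rays_is_sum k1 k2 : num_extreme_rays S1 k1 -> num_extreme_rays S2 k2 ->
  exists2 k, num_extreme_rays S k & (k <= k1 + k2)%N.
Proof.
move=> /num_extreme_raysE[c1 [_ _ h1]] /num_extreme_raysE[c2 [_ _ h2]].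
have [k [c [t [ti _ Ec inj comp]]]] := rays_is_sum h1 h2.
exists k; first by apply/num_extreme_raysE; exists c.
by have := leq_card t ti; rewrite !card_ord.
Qed.

(** With [k1 + k2] rays the tagging of [rays_is_sum] is a bijection, so every ray of a summand is a
    ray of the sum and carries a single tag. An extreme ray of [S1] through [a] would be one of [S2]
    as well and carry two. *)
Lemma max_rays_internal k1 k2 a : num_extreme_rays S1 k1 -> num_extreme_rays S2 k2 ->
  num_extreme_rays S (k1 + k2) -> S1 a -> S2 a -> a != 0 -> ~ on_extreme_ray S1 a.
Proof.
move=> /num_extreme_raysE[c1 [_ _ h1]] /num_extreme_raysE[c2 [_ _ h2]] nS a1 a2 a0.
have [k [c [t [ti tE Ec inj comp]]]] := rays_is_sum h1 h2.
have kE : k = (k1 + k2)%N.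
  by apply: (num_extreme_rays_uniq _ nS); apply/num_extreme_raysE; exists c.
have onto j : exists i, t i = j.
  have : j \in codom t by apply: (inj_card_onto ti); rewrite !card_ord kE.
  by case/codomP => i ->; exists i.
case=> d [/h1[i ei]]; rewrite ei => f1.
have [j tj] := onto (lshift k2 i).
have fj : face S (c j) = face S1 (c1 i) by rewrite tE tj (unsplitK (inl i)).
have f2 : face S2 (c j) a by split=> //; rewrite -fj in f1; case: f1.
have [e2 eq2] := extreme_sub cone2 (is_sum_cone cone1 cone2 sumS) wS (is_sum_r cone1 sumS) (Ec j) f2 a0.
have [i2 ei2] := h2 _ e2.
have [j2 tj2] := onto (rshift k1 i2).
have ej : j = j2.
  by apply: inj; rewrite -eq2 ei2 [RHS]tE tj2 (unsplitK (inr i2)).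
move: tj2; rewrite -ej tj => /eqP; by rewrite eq_lrshift.
Qed.

End Sum.

Lemma row_cone k (M : 'M[rat]_(k, N)) :
  is_cone (fun x => exists2 l : 'rV[rat]_k, (forall i, 0 <= l 0 i) & x = l *m M).
Proof.
split.
- by exists 0; rewrite ?mul0mx // => i; rewrite mxE.
- move=> _ _ [l lp ->] [l' lp' ->]; exists (l + l'); rewrite ?mulmxDl // => i.
  by rewrite mxE addr_ge0.
- move=> q _ q0 [l lp ->]; exists (q *: l); rewrite -?scalemxAl // => i.
  by rewrite mxE mulr_ge0.
Qed.

Lemma simplicial_cone S k (M : 'M[rat]_(k, N)) : row_free M ->
  (forall x, S x <-> exists2 l : 'rV[rat]_k, (forall i, 0 <= l 0 i) & x = l *m M) ->
  set_dim S k /\ num_extreme_rays S k.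
Proof.
move=> fr SE; have rk := eqP fr; have [R MR] := row_freeP fr.
have rowS i : S (row i M).
  by apply/SE; exists (delta_mx 0 i) => [j|]; rewrite ?rowE // !mxE; case: (_ && _).
split.
  rewrite -[k in set_dim _ k]rk; apply: set_dim_spans; split=> // x /SE[l _ ->].
  exact: submxMl.
(* With [R] a right inverse of [M], the functional [c i] is the sum of all coordinates but the
   [i]-th. *)
pose c i : 'rV[rat]_N := (R *m \col_j (j != i)%:R)^T.
have cE i l : dotQ (c i) (l *m M) = \sum_(j | j != i) l 0 j.
  rewrite dotQE trmxK mulmxA -(mulmxA l) MR mulmx1 mxE [RHS]big_mkcond.
  by apply: eq_bigr => j _; rewrite mxE; case: (j != i); rewrite ?mulr1 ?mulr0.
have faceP i x : face S (c i) x <-> exists2 q : rat, 0 <= q & x = q *: row i M.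
  split=> [[/SE[l lp ->]]|[q q0 ->]].
    rewrite cE => /psumr_eq0P e; exists (l 0 i) => //.
    rewrite mulmx_sum_row (bigD1 i) //= big1 ?addr0 // => j ji.
    by rewrite e ?scale0r.
  have -> : q *: row i M = (q *: delta_mx 0 i) *m M by rewrite -scalemxAl -rowE.
  split; last first.
    by rewrite cE big1 // => j /negPf ji; rewrite !mxE ji mulr0.
  apply/SE; exists (q *: delta_mx 0 i) => // j; rewrite !mxE mulr_ge0 // ler0n //.
have row0 i : row i M != 0.
  apply/eqP => e; have := congr1 (mulmx^~ R) e; rewrite -row_mul MR mul0mx => /rowP/(_ i).
  by rewrite !mxE eqxx => /eqP; rewrite oner_eq0.
have row_inj q i j : row i M = q *: row j M -> i = j.
  move=> e; have := congr1 (mulmx^~ R) e; rewrite -scalemxAl -!row_mul MR => /rowP/(_ i).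
  rewrite !mxE eqxx; case: eqP => // _ /eqP; by rewrite mulr0 oner_eq0.
apply/num_extreme_raysE; exists c; split.
- move=> i; split.
    by move=> x /SE[l lp ->]; rewrite cE sumr_ge0.
  apply/set_dim1P; exists (row i M); split=> //.
    by apply/faceP; exists 1; rewrite ?scale1r.
  by move=> y /faceP[q _ ->]; exists q.
- move=> i j e; have : face S (c j) (row i M).
    by rewrite -e; apply/faceP; exists 1; rewrite ?scale1r.
  by case/faceP => q _ /row_inj.
move=> d [sd /set_dim1P[x [x0 [Sx dx] hx]]].
have [l lp xE] := (SE x).1 Sx.
(* A generator with nonzero coefficient in a point of the face lies in the face itself, hence spans
   it. *)
have [i li] : exists i, l 0 i != 0.
  apply/existsP; apply: contraNT x0 => /existsPn h; apply/eqP.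
  rewrite xE mulmx_sum_row big1 // => i _; move: (h i); rewrite negbK => /eqP ->.
  by rewrite scale0r.
have di : dotQ d (row i M) = 0.
  have nn j : true -> 0 <= dotQ d (l 0 j *: row j M) by move=> _; rewrite dotQZr mulr_ge0 ?sd.
  move: dx; rewrite xE mulmx_sum_row dotQ_sumr => /(psumr_eq0P nn)/(_ i isT)/eqP.
  by rewrite dotQZr mulf_eq0 (negPf li) => /eqP.
exists i; apply: vset_ext => y; rewrite faceP; split=> [[Sy dy]|[q q0 ->]]; last first.
  split; last by rewrite dotQZr di mulr0.
  apply/SE; exists (q *: delta_mx 0 i); last by rewrite -scalemxAl -rowE.
  by move=> j; rewrite !mxE mulr_ge0 //; case: (_ && _).
have [p pE] := hx _ (conj (rowS i) di); have [r rE] := hx _ (conj Sy dy).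
have p0 : p != 0 by apply: contraNneq (row0 i) => p0; rewrite pE p0 scale0r.
have yE : y = (r / p) *: row i M by rewrite pE scalerA divfK.
exists (r / p) => //; have [l' l'p y'E] := (SE y).1 Sy.
have : l' = (r / p) *: delta_mx 0 i.
  by apply: (row_free_inj fr); rewrite -y'E -scalemxAl -rowE.
by move/rowP/(_ i); rewrite !mxE !eqxx mulr1 => <-.
Qed.

Lemma scrp_is_cone S : scrp_cone S -> is_cone S.
Proof. by case=> -[k [v h]] _; rewrite (vset_ext h); apply: posQ_cone. Qed.

(** A nontrivial nonnegative relation among the nonzero generators would put the negative of one of
    them into the cone; so Gordan's alternative applies. *)
Lemma scrp_positive S : scrp_cone S -> exists w, positive_on S w.
Proof.
move=> scrp; have cS := scrp_is_cone scrp; case: scrp => -[k [v SE]] sc.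
have vS i : S (v i) by apply/SE; apply: posQ_incl; exists i.
pose A := [set i | v i != 0].
have [|w0 wp] := @gordan N _ A v.
  move=> c cp e i iA; apply/eqP; apply: contraLR (iA) => ci.
  rewrite inE negbK; apply/eqP; apply: sc => //.
  have -> : - v i = \sum_(j in A | j != i) ((c i)^-1 * c j) *: v j.
    have := e; rewrite (bigD1 i) //= addrC => /eqP; rewrite addr_eq0 => /eqP e'.
    under eq_bigr => j _ do rewrite -scalerA.
    by rewrite -scaler_sumr e' scalerN scalerA mulVf // scale1r.
  apply: cone_sum => // j _; case: cS => _ _; apply => //.
  by rewrite mulr_ge0 // invr_ge0.
exists w0 => x /SE[l [u [c [hu cp ->]]]] x0; rewrite dotQ_sumr.
have up i : 0 <= dotQ w0 (u i) /\ (dotQ w0 (u i) = 0 -> u i = 0).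
  have [j ->] := hu i; have [->|vj] := eqVneq (v j) 0; first by rewrite dotQ0r.
  have := wp j; rewrite inE => /(_ vj) h; split; first exact: ltW.
  by move=> e; rewrite e ltxx in h.
have nn i : true -> 0 <= dotQ w0 (c i *: u i).
  by move=> _; rewrite dotQZr mulr_ge0 //; case: (up i).
rewrite lt_def sumr_ge0 ?andbT //.
apply: contra x0 => /eqP/(psumr_eq0P nn) e; rewrite big1 // => i _.
have /eqP := e i isT; rewrite dotQZr mulf_eq0 => /orP[/eqP->|/eqP h]; rewrite ?scale0r //.
by case: (up i) => _ /(_ h) ->; rewrite scaler0.
Qed.

(** * Direct sums of internal type *)

Section Internal.
Variables (S1 S2 S : vset N) (a w1 w2 : 'rV[rat]_N) (n1 n2 : nat).
Hypotheses (cone1 : is_cone S1) (cone2 : is_cone S2) (sumS : is_sum S1 S2 S).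
Hypotheses (pos1 : positive_on S1 w1) (pos2 : positive_on S2 w2).
Hypotheses (dim1 : set_dim S1 n1) (dim2 : set_dim S2 n2).
Hypotheses (a0 : a != 0) (a1 : S1 a) (a2 : S2 a).
Hypothesis cap : forall x, spanQ S1 x -> spanQ S2 x -> exists q : rat, x = q *: a.

Lemma glue_positive c : 0 < dotQ c a -> exists c',
  (forall x, S1 x -> dotQ c' x = dotQ c x) /\ positive_on S2 c'.
Proof.
move=> ca; have w2a := pos2 a2 a0.
have [M1 [s1 _]] := spans_set_dim dim1; have [M2 [s2 _]] := spans_set_dim dim2.
(* [w2] is rescaled to agree with [c] at [a], as gluing along the line through [a] requires. *)
have [x x1 x2||c' [h1 h2]] := @glue_functionals N _ _ M1 M2 a c ((dotQ c a / dotQ w2 a) *: w2).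
- by apply: cap; [apply/(spanQ_spans _ s1)|apply/(spanQ_spans _ s2)].
- by rewrite dotQZl divfK // gt_eqF.
exists c'; split=> [x /(proj2 s1) /h1 //|x x2 x0].
by rewrite h2; [rewrite dotQZl mulr_gt0 ?divr_gt0 // pos2|apply: (proj2 s2)].
Qed.

Lemma positive_is_sum : exists w, positive_on S w.
Proof.
have [w [h1 h2]] := glue_positive (pos1 a1 a0).
exists w => _ /sumS[x1 [x2 [s1 s2 ->]]] x0; rewrite dotQDr h1 //.
have [x10|x1n] := eqVneq x1 0.
  by rewrite x10 dotQ0r add0r h2 //; apply: contraNneq x0 => ->; rewrite x10 addr0.
rewrite ltr_wpDr ?pos1 //; have [->|x2n] := eqVneq x2 0; first by rewrite dotQ0r.
by rewrite ltW // h2.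
Qed.

Lemma extreme_internal c : extreme_ray_normal S1 c -> ~ on_extreme_ray S1 a ->
  exists c', extreme_ray_normal S c' /\ face S c' = face S1 c.
Proof.
move=> ec na; have [sc d1] := ec.
have ca : 0 < dotQ c a.
  rewrite lt_def sc // andbT; apply/eqP => e; apply: na; exists c; split=> //.
have [c' [h1 h2]] := glue_positive ca.
have nn x2 : S2 x2 -> 0 <= dotQ c' x2 /\ (dotQ c' x2 = 0 -> x2 = 0).
  move=> s2; have [->|x2n] := eqVneq x2 0; first by rewrite dotQ0r.
  by have h := h2 _ s2 x2n; split; [exact: ltW|move=> e; rewrite e ltxx in h].
have fE : face S c' = face S1 c.
  apply: vset_ext => x; split=> [[/sumS[x1 [x2 [s1 s2 ->]]]]|[s1 e]]; last first.
    by split; [apply: (is_sum_l cone2 sumS)|rewrite h1].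
  rewrite dotQDr h1 // => e; have [p2 z2] := nn _ s2; have p1 := sc _ s1.
  have x20 : x2 = 0 by apply: z2; move: p1 p2 e; lra.
  by split; rewrite x20 ?addr0 //; move: p1 p2 e; lra.
exists c'; split=> //; split; last by rewrite fE.
move=> _ /sumS[x1 [x2 [s1 s2 ->]]]; rewrite dotQDr h1 //.
by rewrite addr_ge0 ?sc //; case: (nn _ s2).
Qed.

End Internal.

Lemma num_rays_internal S1 S2 S a w1 w2 n1 n2 k1 k2 :
  is_cone S1 -> is_cone S2 -> is_sum S1 S2 S -> positive_on S1 w1 -> positive_on S2 w2 ->
  set_dim S1 n1 -> set_dim S2 n2 -> a != 0 -> S1 a -> S2 a ->
  (forall x, spanQ S1 x -> spanQ S2 x -> exists q : rat, x = q *: a) ->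
  ~ on_extreme_ray S1 a -> ~ on_extreme_ray S2 a ->
  num_extreme_rays S1 k1 -> num_extreme_rays S2 k2 -> num_extreme_rays S (k1 + k2).
Proof.
move=> cone1 cone2 sumS pos1 pos2 dim1 dim2 a0 a1 a2 cap na1 na2.
move=> /num_extreme_raysE[c1 [E1 inj1 comp1]] /num_extreme_raysE[c2 [E2 inj2 comp2]].
have cap' x : spanQ S2 x -> spanQ S1 x -> exists q : rat, x = q *: a by move=> h2 h1; apply: cap.
have [w wS] := positive_is_sum sumS pos1 pos2 dim1 dim2 a0 a1 a2 cap.
have [d1 d1E] := fin_all_exists (fun i =>
  extreme_internal cone2 sumS pos2 dim1 dim2 a0 a1 a2 cap (E1 i) na1).
have [d2 d2E] := fin_all_exists (fun i =>
  extreme_internal cone1 (is_sumC sumS) pos1 dim2 dim1 a0 a2 a1 cap' (E2 i) na2).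
(* A ray common to both summands lies on the line through [a]; by [w1], [a] is a positive multiple
   of its points and so would lie on an extreme ray. *)
have ne i j : face S1 (c1 i) <> face S2 (c2 j).
  move=> e; have [s1 /set_dim1P[x [x0 fx _]]] := E1 i.
  have fx2 : face S2 (c2 j) x by rewrite -e.
  have inc (Z : vset N) z : Z z -> spanQ Z z.
    move=> Zz; exists 1%N, (fun=> z), (fun=> 1); split=> //.
    by rewrite big_ord1 scale1r.
  have [q xE] := cap x (inc _ _ (proj1 fx)) (inc _ _ (proj1 fx2)).
  have wx := pos1 _ (proj1 fx) x0; have wa := pos1 _ a1 a0.
  have q0 : 0 < q by move: wx; rewrite xE dotQZr pmulr_lgt0.
  apply: na1; exists (c1 i); split=> //.
  have -> : a = q^-1 *: x by rewrite xE scalerA mulVf ?scale1r // gt_eqF.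
  by apply: face_scale => //; rewrite invr_ge0 ltW.
apply/num_extreme_raysE.
exists (fun i => match split i with inl j => d1 j | inr j => d2 j end); split.
- by move=> i; case: (split i) => j; [case: (d1E j)|case: (d2E j)].
- move=> i j; rewrite -{2}(splitK i) -{2}(splitK j); case: (split i) => i'; case: (split j) => j' /=.
  + by rewrite !(proj2 (d1E _)) => /inj1 ->.
  + by rewrite (proj2 (d1E _)) (proj2 (d2E _)) => /ne.
  + by rewrite (proj2 (d1E _)) (proj2 (d2E _)) => /esym/ne.
  + by rewrite !(proj2 (d2E _)) => /inj2 ->.
move=> d ed; case: (extreme_is_sum cone1 cone2 sumS wS ed) => -[e1 <-].
  have [i ->] := comp1 _ e1; exists (lshift k2 i).
  by rewrite (unsplitK (inl i)) (proj2 (d1E _)).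
have [i ->] := comp2 _ e1; exists (rshift k1 i).
by rewrite (unsplitK (inr i)) (proj2 (d2E _)).
Qed.

Theorem bipyramidal_rays S : bipyramidal S ->
  exists n, [/\ (1 < n)%N, set_dim S n & num_extreme_rays S (2 * n - 2)].
Proof.
elim=> {S} [r1 r2 S ind SE|S1 S2 S _ [n1 [n1g d1 k1]] _ [n2 [n2g d2 k2]] [sc1 sc2 [a [a1 a2 cap na1 na2]] SE]].
  pose M : 'M[rat]_(1 + 1, N) := col_mx r1 r2.
  have lM (l : 'rV[rat]_(1 + 1)) : l *m M = l 0 (lshift 1 0) *: r1 + l 0 (rshift 1 0) *: r2.
    rewrite -[l]hsubmxK mul_row_col; congr (_ + _); rewrite [X in X *m _]mx11_scalar mul_scalar_mx.
      by rewrite row_mxEl.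
    by rewrite row_mxEr.
  have fr : row_free M.
    rewrite -kermx_eq0; apply/eqP/row_matrixP => i; rewrite row0.
    set l := row i _; have /sub_kermxP : (l <= kermx M)%MS by apply: row_sub.
    rewrite lM => /ind[l1 l2]; apply/rowP => j; rewrite [RHS]mxE -(splitK j).
    by case: (split j) => j' /=; rewrite ord1.
  have [|d k] := simplicial_cone (S := S) fr; last by exists 2%N.
  move=> x; rewrite SE; split=> [|[l lp ->]].
    apply: (@posQ_sub _ _ (fun x => exists2 l : 'rV[rat]_(1 + 1), (forall i, 0 <= l 0 i) & x = l *m M)).
      exact: row_cone.
    move=> y [->|->].
      exists (delta_mx 0 (lshift 1 0)); first by move=> i; rewrite mxE; case: (_ && _).
      by rewrite lM !mxE !eqxx eq_rlshift scale1r scale0r addr0.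
    exists (delta_mx 0 (rshift 1 0)); first by move=> i; rewrite mxE; case: (_ && _).
    by rewrite lM !mxE !eqxx eq_lrshift scale1r scale0r add0r.
  rewrite lM; have [_ hD hM] := posQ_cone (fun y => y = r1 \/ y = r2).
  by apply: hD; apply: hM => //; apply: posQ_incl; [left|right].
have c1 := scrp_is_cone sc1; have c2 := scrp_is_cone sc2.
have [w1 p1] := scrp_positive sc1; have [w2 p2] := scrp_positive sc2.
have sumS := posQ_is_sum c1 c2 SE.
(* 0 lies on every face, and [S1] has an extreme ray because [n1] exceeds 1, so [a = 0] would lie on
   one. *)
have a0 : a != 0.
  apply/eqP => a0; apply: na1; move: (k1) => /num_extreme_raysE[c [E _ _]].
  have pos : (0 < 2 * n1 - 2)%N by move: n1g; clear; lia.
  exists (c (Ordinal pos)); split=> //; split=> //; by rewrite a0 dotQ0r.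
have cap' x : spanQ S1 x -> spanQ S2 x -> exists q : rat, x = q *: a.
  by move=> h1 h2; apply/cap.
exists (n1 + n2 - 1)%N; split; first by move: n1g n2g; clear; lia.
  exact: set_dim_is_sum c1 c2 sumS d1 d2 a0 a1 a2 cap'.
have -> : (2 * (n1 + n2 - 1) - 2 = (2 * n1 - 2) + (2 * n2 - 2))%N by move: n1g n2g; clear; lia.
exact: num_rays_internal c1 c2 sumS p1 p2 d1 d2 a0 a1 a2 cap' na1 na2 k1 k2.
Qed.

End Rays.

(** * Complete intersection cones *)

Section Configurations.
Variables (m N : nat) (B : 'M[rat]_(m, N)) (w : 'rV[rat]_N).
Implicit Types (C X : {set 'I_m}) (M : seq ('rV[rat]_m * 'rV[rat]_m)) (z l : 'rV[rat]_m).

Definition cone_on C : vset N := fun x =>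
  exists l : 'rV[rat]_m, [/\ forall j, 0 <= l 0 j, qsupp l \subset C & x = l *m B].

Definition is_move C (y : 'rV[rat]_m * 'rV[rat]_m) :=
  [/\ colors_of C (color y), forall j, 0 <= y.1 0 j, forall j, 0 <= y.2 0 j
    & y.1 *m B = y.2 *m B].

(** The invariant of the induction: it passes to both parts of a good cut and makes no reference to
    an ideal. *)
Definition config C M := [/\ forall y, y \in M -> is_move C y, valid C (map color M)
  & forall z, qsupp z \subset C -> z *m B = 0 -> (z <= relation_span M)%MS].

Definition positive_rows C := forall j, j \in C -> 0 < dotQ w (row j B).

Lemma qsupp_sub0 z C : qsupp z \subset C -> forall j, j \notin C -> z 0 j = 0.
Proof. by move/qsuppP. Qed.

Lemma qsuppD z l C : qsupp z \subset C -> qsupp l \subset C -> qsupp (z + l) \subset C.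
Proof.
by move=> hz hl; apply/qsuppP => j jC; rewrite mxE (qsupp_sub0 hz) ?(qsupp_sub0 hl) ?addr0.
Qed.

Lemma qsuppZ q z C : qsupp z \subset C -> qsupp (q *: z) \subset C.
Proof. by move=> hz; apply/qsuppP => j jC; rewrite mxE (qsupp_sub0 hz) ?mulr0. Qed.

Lemma cone_on_is_cone C : is_cone (cone_on C).
Proof.
split.
- exists 0; split; [by move=> j; rewrite mxE|by apply/qsuppP => j _; rewrite mxE|].
  by rewrite mul0mx.
- move=> _ _ [l [lp sl ->]] [l' [lp' sl' ->]]; exists (l + l'); split; rewrite ?mulmxDl //.
    by move=> j; rewrite mxE addr_ge0.
  exact: qsuppD.
- move=> q _ q0 [l [lp sl ->]]; exists (q *: l); split; rewrite ?scalemxAl //.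
    by move=> j; rewrite mxE mulr_ge0.
  exact: qsuppZ.
Qed.

Lemma qsupp_delta C j : j \in C -> qsupp (delta_mx 0 j) \subset C.
Proof.
by move=> jC; apply/qsuppP => k kC; rewrite !mxE; case: (eqVneq k j) => [e|]; rewrite ?andbF // e jC in kC *.
Qed.

Lemma cone_on_row C j : j \in C -> cone_on C (row j B).
Proof.
move=> jC; exists (delta_mx 0 j); split; rewrite -?rowE // ?qsupp_delta //.
by move=> k; rewrite mxE ler0n.
Qed.

Lemma cone_on_spans C : spans (cone_on C) (coord_mx C *m B).
Proof.
split=> [i|_ [l [_ sl ->]]]; last by apply: submxMr; rewrite sub_coord_mx.
have -> : row i (coord_mx C *m B) = row (enum_val i) B.
  by rewrite row_mul row_rowsub row1 -rowE.
exact/cone_on_row/enum_valP.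
Qed.

Lemma dotQ_mulmx l : dotQ w (l *m B) = \sum_j l 0 j * dotQ w (row j B).
Proof. by rewrite mulmx_sum_row dotQ_sumr; apply: eq_bigr => j _; rewrite dotQZr. Qed.

Lemma positive_nonneg C l : positive_rows C -> (forall j, 0 <= l 0 j) -> qsupp l \subset C ->
  l != 0 -> 0 < dotQ w (l *m B).
Proof.
move=> pw lp sl l0; rewrite dotQ_mulmx.
have nn j : true -> 0 <= l 0 j * dotQ w (row j B).
  move=> _; have [jC|jC] := boolP (j \in C); first by rewrite mulr_ge0 // ltW ?pw.
  by rewrite (qsupp_sub0 sl) ?mul0r.
rewrite lt_def sumr_ge0 ?andbT //; apply: contra l0 => /eqP/(psumr_eq0P nn) e.
apply/eqP/rowP => j; rewrite mxE; have [jC|jC] := boolP (j \in C); last exact: qsupp_sub0 sl _ jC.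
by have /eqP := e j isT; rewrite mulf_eq0 (gt_eqF (pw _ jC)) orbF => /eqP.
Qed.

Lemma cone_on_positive C : positive_rows C -> positive_on (cone_on C) w.
Proof.
move=> pw _ [l [lp sl ->]] x0; apply: positive_nonneg pw lp sl _.
by apply: contraNneq x0 => ->; rewrite mul0mx.
Qed.

Lemma cone_on_scrp C : positive_rows C -> scrp_cone (cone_on C).
Proof.
move=> pw; split.
  exists #|C|, (fun i => row (enum_val i) B) => x; split=> [[l [lp sl ->]]|].
    have [_ _ hM] := posQ_cone (fun y => exists i : 'I_#|C|, y = row (enum_val i) B).
    rewrite mulmx_sum_row; apply: cone_sum => [|j _]; first exact: posQ_cone.
    have [jC|jC] := boolP (j \in C); last first.
      by rewrite (qsupp_sub0 sl) // scale0r; case: (posQ_cone (fun y => exists i : 'I_#|C|, y = row (enum_val i) B)).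
    apply: hM => //; apply: posQ_incl; exists (enum_rank_in jC j).
    by rewrite enum_rankK_in.
  apply: posQ_sub; first exact: cone_on_is_cone.
  by move=> _ [i ->]; apply/cone_on_row/enum_valP.
move=> x hx hnx; apply/eqP/negPn/negP => x0.
have := cone_on_positive pw hx x0; have := cone_on_positive pw hnx _.
by rewrite oppr_eq0 dotQNr => /(_ x0); lra.
Qed.

Lemma cone_on_sum C X : X \subset C -> is_sum (cone_on X) (cone_on (C :\: X)) (cone_on C).
Proof.
move=> sX x; split=> [[l [lp sl ->]]|[_ [_ [[l [lp sl ->]] [l' [lp' sl' ->]] ->]]]].
  pose l1 : 'rV[rat]_m := \row_j (if j \in X then l 0 j else 0).
  pose l2 : 'rV[rat]_m := \row_j (if j \in X then 0 else l 0 j).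
  exists (l1 *m B), (l2 *m B); split.
  - exists l1; split=> // [j|]; first by rewrite mxE; case: ifP.
    by apply/qsuppP => j /negPf jX; rewrite mxE jX.
  - exists l2; split=> // [j|]; first by rewrite mxE; case: ifP.
    apply/qsuppP => j; rewrite mxE inE; case: (j \in X) => //= jC.
    exact: qsupp_sub0 sl _ jC.
  - rewrite -mulmxDl; congr (_ *m _); apply/rowP => j; rewrite !mxE.
    by case: ifP; rewrite ?addr0 ?add0r.
exists (l + l'); split; rewrite ?mulmxDl //; first by move=> j; rewrite mxE addr_ge0.
by apply: qsuppD; [apply: subset_trans sX|apply: subset_trans sl' (subsetDl _ _)].
Qed.

Lemma relation_span_kernel C M : (forall y, y \in M -> is_move C y) ->
  (relation_span M <= kermx B)%MS.
Proof.
move=> h; apply: relation_span_sub => y /h[_ _ _ e].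
by apply/sub_kermxP; rewrite mulmxBl e subrr.
Qed.

Lemma relation_span_supp C M z : (forall y, y \in M -> inside C (color y)) ->
  (z <= relation_span M)%MS -> qsupp z \subset C.
Proof.
move=> h zM; rewrite -sub_coord_mx; apply: submx_trans zM _.
apply: relation_span_sub => y /h/andP[/= h1 h2].
by rewrite addmx_sub ?eqmx_opp // sub_coord_mx.
Qed.

Section Gluing.
Variables (C X : {set 'I_m}) (p q : 'rV[rat]_m) (R1 R2 : 'rV[rat]_m -> Prop).
Hypothesis sX : X \subset C.
Hypotheses (R1s : forall z, R1 z -> qsupp z \subset X)
           (R2s : forall z, R2 z -> qsupp z \subset C :\: X).
Hypotheses (sp : qsupp p \subset X) (sq : qsupp q \subset C :\: X).
Hypothesis dec : forall z, qsupp z \subset C -> z *m B = 0 ->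
  exists (c : rat) z1 z2, [/\ R1 z1, R2 z2 & z = c *: (p - q) + z1 + z2].

(** Each coordinate belongs to one part only, so a decomposition of the relation [z1 - z2] can be
    read off on either part, and both see the same coefficient [c] of the crossing move. *)
Lemma glue_coords z1 z2 : qsupp z1 \subset X -> qsupp z2 \subset C :\: X ->
  (z1 - z2) *m B = 0 -> exists (c : rat) y1 y2, [/\ R1 y1, R2 y2, z1 = c *: p + y1 &
    z2 = c *: q - y2].
Proof.
move=> s1 s2 zB; have [|c [y1 [y2 [h1 h2 e]]]] := dec _ zB.
  apply: qsuppD; first exact: subset_trans s1 sX.
  by rewrite -scaleN1r; apply: qsuppZ; apply: subset_trans s2 (subsetDl _ _).
have t1 := R1s h1; have t2 := R2s h2.
exists c, y1, y2; split=> //; apply/rowP => j; have /rowP/(_ j) := e; rewrite !mxE;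
  have [jX|jX] := boolP (j \in X).
- have jD : j \notin C :\: X by rewrite inE jX.
  by rewrite (qsupp_sub0 s2 jD) (qsupp_sub0 sq jD) (qsupp_sub0 t2 jD); lra.
- by rewrite (qsupp_sub0 s1 jX) (qsupp_sub0 sp jX) (qsupp_sub0 t1 jX); lra.
- have jD : j \notin C :\: X by rewrite inE jX.
  by rewrite (qsupp_sub0 s2 jD) (qsupp_sub0 sq jD) (qsupp_sub0 t2 jD); lra.
- by rewrite (qsupp_sub0 s1 jX) (qsupp_sub0 sp jX) (qsupp_sub0 t1 jX); lra.
Qed.

End Gluing.

Lemma config_split C M : config C M -> positive_rows C -> M != [::] ->
  exists X M1 M2 a, [/\ X \proper C, X != set0 /\ (config X M1 /\ config (C :\: X) M2), a != 0,
    cone_on X a /\ cone_on (C :\: X) a &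
    forall x, spanQ (cone_on X) x -> spanQ (cone_on (C :\: X)) x -> exists c : rat, x = c *: a].
Proof.
case=> hM va sp pw M0.
have [||X0 gX] := good_cut_exists _ va; first by apply/allP => c /mapP[y /hM[h _ _ _] ->].
  by case: (M) M0.
have [X [y0 [sX y0M s1 s2 al]]] : exists X y0, [/\ X \subset C, y0 \in M, qsupp y0.1 \subset X,
    qsupp y0.2 \subset C :\: X &
    all (fun y => inside X (color y) || inside (C :\: X) (color y)) (rem y0 M)].
  case: gX => sX ct spl.
  have /hasP[c /mapP[y0 y0M ->] cr] : has (crosses C X0) (map color M) by rewrite has_count ct.
  have pe := perm_map color (perm_to_rem y0M).
  have al : all (fun c => inside X0 c || inside (C :\: X0) c) (map color (rem y0 M)).
    by apply: all_ncross; move: ct; rewrite (permP pe) /= cr add1n => -[].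
  rewrite all_map in al.
  move: (allP spl _ (map_f color y0M)); rewrite cr /= => /orP[] /andP[/= h1 h2].
    by exists X0, y0.
  exists (C :\: X0), y0; rewrite setDDr setDv set0U (setIidPr sX); split=> //.
    exact: subsetDl.
  by apply: sub_all al => y /=; rewrite orbC.
have [cy p0 q0 ey] := hM _ y0M; case/and3P: (cy) => _ n1 n2; rewrite !qsupp_eq0 /= in n1 n2.
set D := C :\: X in s2 al *.
pose M1 := [seq y <- rem y0 M | inside X (color y)].
pose M2 := [seq y <- rem y0 M | ~~ inside X (color y)].
have subM y : y \in rem y0 M -> y \in M by apply: mem_rem.
have i1 y : y \in M1 -> inside X (color y) by rewrite mem_filter => /andP[].
have i2 y : y \in M2 -> inside D (color y).
  by rewrite mem_filter => /andP[/negPf ni /(allP al)]; rewrite ni.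
have m1 y : y \in M1 -> is_move X y.
  move=> yM; have [h1 h2 h3 h4] : is_move C y.
    by apply: hM; apply: subM; move: yM; rewrite mem_filter => /andP[].
  by split=> //; apply: colorsS h1; apply: i1.
have m2 y : y \in M2 -> is_move D y.
  move=> yM; have [h1 h2 h3 h4] : is_move C y.
    by apply: hM; apply: subM; move: yM; rewrite mem_filter => /andP[].
  by split=> //; apply: colorsS h1; apply: i2.
have vsub M' X' : subseq M' (rem y0 M) -> X' \subset C -> valid X' (map color M').
  move=> ss sX'; apply: valid_sub sX' _ va => T _; apply: leq_count_subseq.
  by apply: map_subseq; apply: subseq_trans ss (rem_subseq _ _).
pose R1 z := (z <= relation_span M1)%MS; pose R2 z := (z <= relation_span M2)%MS.
have R1s z : R1 z -> qsupp z \subset X by apply: relation_span_supp.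
have R2s z : R2 z -> qsupp z \subset D by apply: relation_span_supp.
have R1k z : R1 z -> z *m B = 0.
  by move=> h; apply/sub_kermxP; apply: submx_trans h (relation_span_kernel m1).
have R2k z : R2 z -> z *m B = 0.
  by move=> h; apply/sub_kermxP; apply: submx_trans h (relation_span_kernel m2).
have dec z : qsupp z \subset C -> z *m B = 0 ->
    exists (c : rat) z1 z2, [/\ R1 z1, R2 z2 & z = c *: (y0.1 - y0.2) + z1 + z2].
  move=> sz zB; have := sp z sz zB; rewrite /relation_span (perm_big _ (perm_to_rem y0M)) big_cons.
  rewrite (perm_big (M1 ++ M2)) /=; last by rewrite perm_sym perm_filterC.
  rewrite big_cat => /sub_addsmxP[[u v] /= ->].
  have : (v *m (relation_span M1 + relation_span M2)%MS <= relation_span M1 + relation_span M2)%MS.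
    exact: submxMl.
  case/sub_addsmxP => -[u1 u2] /= ->.
  have /sub_rVP[c ->] : (u *m <<y0.1 - y0.2>> <= y0.1 - y0.2)%MS.
    by rewrite (submx_trans (submxMl _ _)) // genmxE.
  by exists c, (u1 *m relation_span M1), (u2 *m relation_span M2); rewrite -addrA; split=> //; apply: submxMl.
have sD : D \subset C by apply: subsetDl.
have pwX : positive_rows X by move=> j /(subsetP sX); apply: pw.
have pwD : positive_rows D by move=> j /(subsetP sD); apply: pw.
have a0 : y0.1 *m B != 0.
  apply/eqP => e; have := positive_nonneg pwX p0 s1 n1.
  by rewrite e dotQ0r ltxx.
(* For a relation within one part, the other part equates a multiple of [a] with 0, so the crossing
   move does not occur in it. *)
have c0 c z : R1 z \/ R2 z -> (c *: y0.1 + z) *m B = 0 \/ (c *: y0.2 - z) *m B = 0 -> c = 0.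
  move=> Rz h; have zB : z *m B = 0 by case: Rz => [/R1k|/R2k].
  apply/eqP; apply: contraTT a0 => cn; apply/negPn.
  move: h; rewrite !mulmxDl mulNmx zB oppr0 !addr0 -!scalemxAl -ey.
  by case=> /eqP; rewrite scaler_eq0 (negPf cn).
have glue := glue_coords sX R1s R2s s1 s2 dec.
exists X, M1, M2, (y0.1 *m B); split.
- rewrite properE sX /=; apply/subsetPn.
  have /set0Pn[j jq] : qsupp y0.2 != set0 by rewrite qsupp_eq0.
  by exists j; move: (subsetP s2 _ jq); rewrite inE => /andP[].
- split; first by apply: contraNneq n1 => X0'; rewrite -qsupp_eq0 -subset0 -X0'.
  split; split=> //.
  + by apply: vsub => //; apply: filter_subseq.
  + move=> z sz zB; have [|||c [y1 [y2 [h1 h2 e1 e2]]]] := glue z 0 => //.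
    * by apply/qsuppP => j _; rewrite mxE.
    * by rewrite subr0.
    have c00 : c = 0 by apply: (c0 c y2); [right|right; rewrite -e2 mul0mx].
    by rewrite e1 c00 scale0r add0r.
  + by apply: vsub => //; apply: filter_subseq.
  + move=> z sz zB; have [|||c [y1 [y2 [h1 h2 e1 e2]]]] := glue 0 z => //.
    * by apply/qsuppP => j _; rewrite mxE.
    * by rewrite sub0r mulNmx zB oppr0.
    have c00 : c = 0 by apply: (c0 c y1); [left|left; rewrite -e1 mul0mx].
    by rewrite e2 c00 scale0r sub0r eqmx_opp.
- exact: a0.
- by split; [exists y0.1|exists y0.2; rewrite -ey].
- move=> x /(spanQ_spans _ (cone_on_spans X))/submxP[l1 e1].
  move=> /(spanQ_spans _ (cone_on_spans D))/submxP[l2 e2].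
  have [|||c [y1 [y2 [h1 h2 f1 f2]]]] := glue (l1 *m coord_mx X) (l2 *m coord_mx D).
  + by rewrite -sub_coord_mx submxMl.
  + by rewrite -sub_coord_mx submxMl.
  + by rewrite mulmxBl -!mulmxA -e1 -e2 subrr.
  by exists c; rewrite e1 mulmxA f1 mulmxDl (R1k _ h1) addr0 scalemxAl.
Qed.

End Configurations.

Lemma bipyramidal_simplicial N (S : vset N) k (M : 'M[rat]_(k, N)) : row_free M -> k = 2%N ->
  (forall x, S x <-> exists2 l : 'rV[rat]_k, (forall i, 0 <= l 0 i) & x = l *m M) ->
  bipyramidal S.
Proof.
move=> fr k2 SE; subst k.
have lM (l : 'rV[rat]_2) : l *m M = l 0 0 *: row 0 M + l 0 1 *: row 1 M.
  by rewrite mulmx_sum_row big_ord_recl big_ord1; congr (_ + l 0 _ *: row _ M); apply: val_inj.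
pose v (c1 c2 : rat) : 'rV[rat]_2 := \row_i (if i == 0 then c1 else c2).
have vM c1 c2 : v c1 c2 *m M = c1 *: row 0 M + c2 *: row 1 M.
  by rewrite lM !mxE.
apply: (bipyr_simplex (r1 := row 0 M) (r2 := row 1 M)).
  move=> c1 c2; rewrite -vM => e.
  have /rowP h : v c1 c2 = 0 by apply: (row_free_inj fr); rewrite e mul0mx.
  by move: (h 0) (h 1); rewrite !mxE.
move=> x; rewrite SE; split=> [[l lp ->]|].
  rewrite lM; have [_ hD hM] := posQ_cone (fun y => y = row 0 M \/ y = row 1 M).
  by apply: hD; apply: hM => //; apply: posQ_incl; [left|right].
apply: (@posQ_sub _ _ (fun x => exists2 l : 'rV[rat]_2, (forall i, 0 <= l 0 i) & x = l *m M)).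
  exact: row_cone.
move=> y [->|->].
  exists (v 1 0); first by move=> i; rewrite mxE; case: ifP.
  by rewrite vM scale1r scale0r addr0.
exists (v 0 1); first by move=> i; rewrite mxE; case: ifP.
by rewrite vM scale1r scale0r add0r.
Qed.

(** A summand of dimension 1 is the half-line through [a], which the other summand contains. *)
Lemma sum_ray_absorb N (S1 S2 S : vset N) (w a : 'rV[rat]_N) : is_cone S1 -> is_cone S2 ->
  is_sum S1 S2 S -> positive_on S1 w -> set_dim S1 1 -> S1 a -> S2 a -> a != 0 -> S = S2.
Proof.
move=> c1 c2 sumS pos /set_dim1P[x0 [x00 _ hx]] a1 a2 a0.
have [p pE] := hx _ a1.
have p0 : p != 0 by apply: contraNneq a0 => p0; rewrite pE p0 scale0r.
apply: vset_ext => x; split=> [/sumS[x1 [x2 [s1 s2 ->]]]|s2]; last exact: is_sum_r c1 sumS _ s2.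
case: c2 => z2 hD hM; apply: hD => //.
have [r rE] := hx _ s1; have xE : x1 = (r / p) *: a by rewrite pE scalerA divfK.
have [->//|x1n] := eqVneq x1 0; rewrite xE.
apply: hM => //; apply: ltW.
by rewrite -(pmulr_lgt0 _ (pos _ a1 a0)) -dotQZr -xE pos.
Qed.

(** In dimension 1 the bound fails: a half-line has one extreme ray, and [2 * n - 2] is 0. *)
Definition ray_bound N (S : vset N) n := (1 < n)%N ->
  exists k, [/\ num_extreme_rays S k, (k <= 2 * n - 2)%N & k = (2 * n - 2)%N -> bipyramidal S].

Lemma config_rays m N (B : 'M[rat]_(m, N)) w C M : config B C M -> positive_rows B w C ->
  exists2 n, set_dim (cone_on B C) n & ray_bound (cone_on B C) n.
Proof.
have [b] := ubnP #|C|; elim: b C M => // b IH C M lt cf pw.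
have [M0|M0] := eqVneq M [::].
  have fr : row_free (coord_mx C *m B).
    rewrite -kermx_eq0; apply/eqP/row_matrixP => i; rewrite row0.
    set l := row i _; have /sub_kermxP : (l <= kermx (coord_mx C *m B))%MS by apply: row_sub.
    rewrite mulmxA => e; case: cf => _ _ /(_ (l *m coord_mx C)).
    rewrite -sub_coord_mx submxMl M0 /relation_span big_nil submx0 => /(_ isT e)/eqP e'.
    by apply: (row_free_inj (_ : row_free (coord_mx C))); rewrite /row_free ?coord_mx_free // e' mul0mx.
  have SE x : cone_on B C x <-> exists2 l : 'rV[rat]_#|C|, (forall i, 0 <= l 0 i) &
      x = l *m (coord_mx C *m B).
    split=> [[l [lp]]|[l lp ->]].
      rewrite -sub_coord_mx => /submxP[y yE] ->; exists y; last by rewrite yE mulmxA.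
      move=> i; have := lp (enum_val i); rewrite yE mxE (bigD1 i) //= !mxE eqxx mulr1.
      rewrite big1 ?addr0 // => j ji; rewrite !mxE (inj_eq enum_val_inj) (negPf ji) mulr0 //.
    exists (l *m coord_mx C); rewrite mulmxA -sub_coord_mx submxMl; split=> // j.
    by rewrite mxE sumr_ge0 // => i _; rewrite !mxE mulr_ge0 ?ler0n.
  (* A simplicial cone has as many rays as its dimension [n], and [n = 2 * n - 2] only for
     [n = 2]. *)
  have [d k] := simplicial_cone fr SE; exists #|C| => // n1; exists #|C|; split=> //.
    by move: n1; clear; lia.
  by move=> e; apply: bipyramidal_simplicial fr _ SE; move: n1 e; clear; lia.
have [X [M1 [M2 [a [pX [X0 [cf1 cf2]] a0 [a1 a2] cap]]]]] := config_split cf pw M0.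
have sX := proper_sub pX; have sD := subsetDl C X.
have pw1 : positive_rows B w X by move=> j /(subsetP sX); apply: pw.
have pw2 : positive_rows B w (C :\: X) by move=> j /(subsetP sD); apply: pw.
have [|n1 d1 r1] := IH _ _ _ cf1 pw1; first by apply: leq_trans (proper_card pX) _.
have [|n2 d2 r2] := IH _ _ _ cf2 pw2.
  apply: leq_trans (_ : (#|C| <= _)%N) => //; apply: proper_card.
  rewrite properE sD; case/set0Pn: X0 => j jX; apply/subsetPn; exists j; rewrite ?(subsetP sX) //.
  by rewrite inE jX.
have sumS := cone_on_sum B sX.
have c1 := cone_on_is_cone B X; have c2 := cone_on_is_cone B (C :\: X).
have p1 := cone_on_positive pw1; have p2 := cone_on_positive pw2; have p := cone_on_positive pw.
have npos (S : vset N) n : set_dim S n -> S a -> (0 < n)%N.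
  move=> /spans_set_dim[T [[_ sT] rT]] Sa; rewrite -rT lt0n mxrank_eq0.
  by apply: contraNneq a0 => T0; have := sT _ Sa; rewrite T0 eqmx0 submx0.
have g1 := npos _ _ d1 a1; have g2 := npos _ _ d2 a2.
(* [ray_bound] says nothing about a half-line, but the other part absorbs it, so both parts may be
   assumed of dimension at least 2. *)
have [e1|n11] := eqVneq n1 1%N.
  by rewrite e1 in d1; rewrite (sum_ray_absorb c1 c2 sumS p1 d1 a1 a2 a0); exists n2.
have [e2|n21] := eqVneq n2 1%N.
  by rewrite e2 in d2; rewrite (sum_ray_absorb c2 c1 (is_sumC sumS) p2 d2 a2 a1 a0); exists n1.
exists (n1 + n2 - 1)%N => [|_]; first exact: set_dim_is_sum c1 c2 sumS d1 d2 a0 a1 a2 cap.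
have {n11} g1' : (1 < n1)%N by rewrite ltn_neqAle eq_sym n11.
have {n21} g2' : (1 < n2)%N by rewrite ltn_neqAle eq_sym n21.
have [k1 [nk1 le1 b1]] := r1 g1'; have [k2 [nk2 le2 b2]] := r2 g2'.
have [k nk le] := num_rays_is_sum c1 c2 sumS p nk1 nk2.
exists k; split=> //; first by move: le le1 le2 g1' g2'; clear; lia.
move=> ek.
(* [k <= k1 + k2 <= (2 * n1 - 2) + (2 * n2 - 2)], and the last term is the bound for dimension
   [n1 + n2 - 1], so equality holds throughout. *)
have [ek1 ek2 ekk] : [/\ k1 = (2 * n1 - 2)%N, k2 = (2 * n2 - 2)%N & k = (k1 + k2)%N].
  by split; move: ek le le1 le2 g1' g2'; clear; lia.
apply: (bipyr_sum (b1 ek1) (b2 ek2)); split; [exact: cone_on_scrp pw1|exact: cone_on_scrp pw2| |].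
  exists a; split=> //.
  - move=> x; split=> [[h1 h2]|[q ->]]; first exact: cap.
    split; [apply/(spanQ_spans _ (cone_on_spans B X))|apply/(spanQ_spans _ (cone_on_spans B (C :\: X)))];
      by apply: scalemx_sub; apply: (proj2 (cone_on_spans B _)).
  - by rewrite ekk in nk; exact: (max_rays_internal c1 c2 sumS p nk1 nk2 nk a1 a2 a0).
  - by rewrite ekk addnC in nk; exact: (max_rays_internal c2 c1 (is_sumC sumS) p nk2 nk1 nk a2 a1 a0).
move=> x; split=> [/sumS[x1 [x2 [s1 s2 ->]]]|].
  have [_ hD _] := posQ_cone (fun y => cone_on B X y \/ cone_on B (C :\: X) y).
  by apply: hD; apply: posQ_incl; [left|right].
apply: posQ_sub; first exact: cone_on_is_cone.
by move=> y [h|h]; [exact: (is_sum_l c2 sumS h)|exact: (is_sum_r c1 sumS h)].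
Qed.

Lemma CI_config (K : fieldType) m N (A : 'M[int]_(m, N)) : pointed_semigroup A ->
  complete_intersection (@toric_ideal K m N A) ->
  exists M, config (map_mx intr A) [set j | row j A != 0] M.
Proof.
move=> pointed [h [[chains _] [[g gen] _]]].
(* The toric ideal is a prime containing itself, so the definition of height provides a chain of
   length [h] ending at it. *)
have hle : (h + \rank (map_mx intr A : 'M[rat]_(m, N)) <= m)%N.
  apply: (@toric_height_le K _ _ A h pointed); apply: chains => //; exact: (toric_prime K pointed).
have [s' [hom sz sp]] := free_mod_extend pointed gen (zero_moves_isodeg A) (@zero_moves_free K _ _ _ pointed).
have isos : all (isodeg A) s' by move: hom; rewrite all_cat => /andP[].
have conn (C : pred 'X_{1..m}) : (forall j, row j A = 0 -> forall w, C (w + U_(j))%MM = C w) ->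
    closed_under s' C -> forall u v, Adeg A u = Adeg A v -> C u = C v.
  move=> hz cl; apply: (connected_fibers pointed hom) sp _ _.
    by move=> x xz; rewrite mem_cat xz orbT.
  move=> x; rewrite mem_cat => /orP[xs|/mapP[j]]; first exact: cl.
  by rewrite mem_enum inE => /eqP rj -> w; rewrite /= hz // addm0.
exists (effective A s'); split.
- move=> y ye; exact: (effective_colors pointed isos ye).
- apply: (effective_valid pointed isos conn).
  (* Setting the variables of degree 0 against their moves turns [h + rank <= m] into the bound on
     [s'] for the remaining variables. *)
  have cz : (size (zero_moves A) + #|[set j | (row j A != 0)%R]| = m)%N.
    rewrite size_map -cardE -[RHS]card_ord -(cardC [pred j | (row j A == 0)%R]).
    by congr (_ + _)%N; apply: eq_card => j; rewrite !inE.
  have : (size (effective A s') <= size s')%N by rewrite size_map size_filter count_size.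
  by move: hle sz cz; rewrite size_cat; clear; lia.
- exact: (@effective_span _ _ _ pointed _ isos conn).
Qed.

Lemma CI_cone_config (K : fieldType) N (sigma : vset N) : CI_cone K sigma ->
  exists m (B : 'M[rat]_(m, N)) w C M, [/\ config B C M, positive_rows B w C & sigma = cone_on B C].
Proof.
case=> m [A [_ pointed ci sE]]; have [M cf] := CI_config pointed ci.
have [w [p [wp pp]]] := positive_weight pointed.
exists m, (map_mx intr A), (map_mx intr w^T), [set j | row j A != 0], M; split=> //.
  move=> j; rewrite inE -pp => pj.
  suff -> : dotQ (map_mx intr w^T) (row j (map_mx intr A)) = (p j)%:R by rewrite ltr0n.
  rewrite -[RHS]/(((p j)%:Z)%:~R) -wp mxE rmorph_sum; apply: eq_bigr => i _ /=.
  by rewrite !mxE intrM mulrC.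
apply: vset_ext => x; rewrite sE; split.
  apply: posQ_sub; first exact: cone_on_is_cone.
  move=> _ [i ->]; have [ri|ri] := eqVneq (row i A) 0; last by apply: cone_on_row; rewrite inE.
  rewrite (_ : row i _ = 0); first by case: (cone_on_is_cone (map_mx intr A : 'M[rat]_(m, N)) [set j | row j A != 0]).
  by rewrite -map_row ri map_mx0.
case=> l [lp _ ->]; rewrite mulmx_sum_row.
have cP := posQ_cone (fun y => exists i, y = row i (map_mx intr A : 'M[rat]_(m, N))).
apply: cone_sum => // j _; case: cP => _ _; apply=> //.
by apply: posQ_incl; exists j.
Qed.

Theorem theorem3p5 (K : fieldType) (N : nat) (sigma : vset N) (n : nat) :
  CI_cone K sigma -> set_dim sigma n -> (1 < n)%N ->
  exists k, [/\ num_extreme_rays sigma k, (k <= 2 * n - 2)%N &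
                (k = 2 * n - 2)%N <-> bipyramidal sigma].
Proof.
case/CI_cone_config => m [B [w [C [M [cf pw sE]]]]] dn n1.
have [n' dn' rb] := config_rays cf pw; rewrite -sE in dn' rb.
have en := set_dim_uniq dn' dn; rewrite en in rb.
have [k [nk lek kb]] := rb n1; exists k; split=> //; split=> // bp.
have [n0 [_ d0 k0]] := bipyramidal_rays bp.
by rewrite (num_extreme_rays_uniq nk k0) (set_dim_uniq d0 dn).
Qed.
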